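(* For every $N\ge1$, the dg commutative algebra $\mathcal A_N$ is a model, in dg commutative algebras over $\mathbb C$, of the derived global sections of the structure sheaf on the ravioli configuration space $\mathrm{RavConf}_N$: $$\mathcal A_N\simeq R\Gamma(\mathrm{RavConf}_N,\mathcal O).$$
   Context: **Ravioli configuration space.** $[1,N]=\{1,\dots,N\}$. $S_N$ is the set of permutations of $[1,N]$, identified with the set of total orders on $[1,N]$ by $\sigma\leftrightarrow(\sigma(1)\prec_\sigma\cdots\prec_\sigma\sigma(N))$. For a partial order $\prec$ on $[1,N]$ let $$\mathcal O(U_\prec)=\mathbb C[z_1,\dots,z_N]\bigl[(z_i-z_j)^{-1}: i\neq j,\ i\not\prec j,\ j\not\prec i\bigr],\qquad U_\prec=\mathrm{Spec}\,\mathcal O(U_\prec).$$ If $\prec'$ refines $\prec$ there is a canonical inclusion $\mathcal O(U_{\prec'})\to\mathcal O(U_\prec)$, hence $U_\prec\to U_{\prec'}$. For partial orders $\prec_1,\dots,\prec_k$, let $\prec_1\wedge\cdots\wedge\prec_k$ be their finest common coarsening ($i\prec j$ iff $i\prec_l j$ for all $l$). $\mathrm{RavConf}_N$ is the $\mathbb C$-scheme obtained by gluing the $N!$ affine schemes $U_{\prec_\sigma}\cong\mathbb A^N_{\mathbb C}$, $\sigma\in S_N$, with pairwise intersections $U_{\prec_{\sigma_1}}\cap U_{\prec_{\sigma_2}}=U_{\prec_{\sigma_1}\wedge\prec_{\sigma_2}}$ and the canonical inclusions; then multiple intersections are $U_{\prec_{\sigma_1}\wedge\cdots\wedge\prec_{\sigma_k}}$.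 **Derived sections.** $R\Gamma(X,\mathcal O)$ is the dg commutative algebra defined, up to zig-zags of quasi-isomorphisms of dg commutative algebras, as the homotopy limit in dg commutative algebras of the semicosimplicial commutative algebra $\Gamma(\check C(\mathscr U),\mathcal O)$, where $\check C(\mathscr U)$ is the Čech nerve of a finite Leray cover $\mathscr U$ (here one may take $\mathscr U=\{U_{\prec_\sigma}\}_{\sigma\in S_N}$ with any fixed total order on $S_N$). ''$\simeq$'' means connected by a zig-zag of quasi-isomorphisms of dg commutative algebras. **The algebra $\mathcal A_N$.** Let $\mathcal B_N=\mathbb C[z_i,(z_i-z_j)^{-1}]_{1\le i\ne j\le N}$. For nonempty $S\subseteq S_N$ let $\Omega_S=\mathbb C[u_\sigma,\mathrm du_\sigma]_{\sigma\in S}/\langle\sum_{\sigma\in S}u_\sigma-1,\sum_{\sigma\in S}\mathrm du_\sigma\rangle$ ($u_\sigma$ in degree 0, $\mathrm du_\sigma$ in degree 1, de Rham differential). Then $$\mathcal A_N=\Bigl\{\omega\in\mathcal B_N\otimes\Omega_{S_N}:\ \omega|_{\{u_\sigma=0\ \forall\sigma\in S_N\setminus S\}}\in\mathcal O\bigl(U_{\bigwedge_{\sigma\in S}\prec_\sigma}\bigr)\otimes\Omega_S\ \text{ for all nonempty } S\subseteq S_N\Bigr\},$$ where $\omega|_{\{\cdots\}}$ denotes pullback of differential forms (setting $u_\sigma$ and $\mathrm du_\sigma$ to zero for $\sigma\notin S$). *)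

(* Defs.v *)
From HB Require Import structures.
From mathcomp Require Import all_boot all_order all_algebra all_fingroup.
From mathcomp Require Import generic_quotient ring_quotient mpoly.
From mathcomp Require Import boolp.

Set Implicit Arguments.
Unset Strict Implicit.
Unset Printing Implicit Defensive.

Import GRing.Theory.
Local Open Scope ring_scope.
Local Open Scope quotient_scope.

(* A Z-graded commutative dg algebra over K, with cohomological differential.
   An algebra over K is a ring with a structure map from K; it may be the zero
   ring, which MathComp's algType excludes.  The underlying object is the total
   space (+)_n A^n, and the grading is given by the projections onto the
   summands A^n. *)
Record cdga (K : fieldType) := Cdga {
  cdga_ring :> pzRingType;
  cdga_unit : {rmorphism K -> cdga_ring};
  cdga_proj : int -> cdga_ring -> cdga_ring;
  cdga_d : cdga_ring -> cdga_ring;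
  cdga_projD : forall n x y,
    cdga_proj n (x + y) = cdga_proj n x + cdga_proj n y;
  cdga_proj_proj : forall m n x,
    cdga_proj m (cdga_proj n x) = if m == n then cdga_proj n x else 0;
  cdga_proj_sum : forall x,
    exists2 s : seq int, uniq s & x = \sum_(n <- s) cdga_proj n x;
  cdga_unit_deg : forall c, cdga_proj 0 (cdga_unit c) = cdga_unit c;
  cdga_mul_deg : forall m n x y, cdga_proj m x = x -> cdga_proj n y = y ->
    cdga_proj (m + n) (x * y) = x * y;
  cdga_mulC : forall m n x y, cdga_proj m x = x -> cdga_proj n y = y ->
    x * y = (-1) ^+ absz (m * n) * (y * x);
  cdga_dD : forall x y, cdga_d (x + y) = cdga_d x + cdga_d y;
  cdga_d_unit : forall c, cdga_d (cdga_unit c) = 0;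
  cdga_d_deg : forall n x, cdga_proj n x = x ->
    cdga_proj (n + 1) (cdga_d x) = cdga_d x;
  cdga_dM : forall m x y, cdga_proj m x = x ->
    cdga_d (x * y) = cdga_d x * y + (-1) ^+ absz m * (x * cdga_d y);
  cdga_dd : forall x, cdga_d (cdga_d x) = 0
}.

Arguments cdga_unit {K}.
Arguments cdga_proj {K}.
Arguments cdga_d {K}.

Record cdga_hom (K : fieldType) (A B : cdga K) := CdgaHom {
  cdga_hom_fun :> {rmorphism A -> B};
  cdga_hom_unit : forall c, cdga_hom_fun (cdga_unit A c) = cdga_unit B c;
  cdga_hom_proj : forall n x,
    cdga_hom_fun (cdga_proj A n x) = cdga_proj B n (cdga_hom_fun x);
  cdga_hom_d : forall x, cdga_hom_fun (cdga_d A x) = cdga_d B (cdga_hom_fun x)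
}.

Section Homotopy.
Variable K : fieldType.

(* H(f) is injective and surjective; as f preserves degrees, this is the same
   as H^n(f) being bijective for every n. *)
Definition quasi_iso (A B : cdga K) (f : cdga_hom A B) : Prop :=
  (forall x, cdga_d A x = 0 -> (exists y, f x = cdga_d B y) ->
     exists x', x = cdga_d A x') /\
  (forall y, cdga_d B y = 0 ->
     exists x, cdga_d A x = 0 /\ exists z, f x - y = cdga_d B z).

Inductive zigzag : cdga K -> cdga K -> Prop :=
| zigzag_refl A : zigzag A A
| zigzag_fwd A B C (f : cdga_hom A B) : quasi_iso f -> zigzag B C -> zigzag A C
| zigzag_bwd A B C (f : cdga_hom B A) : quasi_iso f -> zigzag B C -> zigzag A C.

(* The projective model structure on cdga's over a field of characteristic 0:
   weak equivalences are the quasi-isomorphisms, fibrations the surjections. *)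
Definition fibration (A B : cdga K) (f : cdga_hom A B) : Prop :=
  forall y, exists x, f x = y.

Definition cofibration (A B : cdga K) (i : cdga_hom A B) : Prop :=
  forall (X Y : cdga K) (p : cdga_hom X Y), fibration p -> quasi_iso p ->
  forall (u : cdga_hom A X) (v : cdga_hom B Y), (forall a, p (u a) = v (i a)) ->
  exists h : cdga_hom B X, (forall a, h (i a) = u a) /\ (forall b, p (h b) = v b).

End Homotopy.

(* Morphisms [m] -> [n] of the category of finite nonempty ordinals
   [n] = {0,...,n} and strictly increasing maps. *)
Record dinj (m n : nat) := Dinj {
  dinj_fun :> 'I_m.+1 -> 'I_n.+1;
  dinj_mono : forall i j : 'I_m.+1, (i < j)%N -> (dinj_fun i < dinj_fun j)%N
}.

Definition dinj_id n : dinj n n :=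
  @Dinj n n id (fun i j ij => ij).

Definition dinj_comp m n p (g : dinj n p) (f : dinj m n) : dinj m p :=
  @Dinj m p (g \o f) (fun i j ij => dinj_mono g (dinj_mono f ij)).

Record semicosimplicial (K : fieldType) := SemiCosimplicial {
  sc_obj :> nat -> cdga K;
  sc_map : forall m n, dinj m n -> cdga_hom (sc_obj m) (sc_obj n);
  sc_map_id : forall n x, sc_map (dinj_id n) x = x;
  sc_map_comp : forall m n p (g : dinj n p) (f : dinj m n) x,
    sc_map (dinj_comp g f) x = sc_map g (sc_map f x)
}.

Arguments sc_map {K} s {m n}.

Record sc_hom (K : fieldType) (D E : semicosimplicial K) := ScHom {
  sc_hom_fun :> forall n, cdga_hom (D n) (E n);
  sc_hom_natural : forall m n (t : dinj m n) x,
    sc_hom_fun n (sc_map D t x) = sc_map E t (sc_hom_fun m x)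
}.

Section HomotopyLimit.
Variable K : fieldType.

Record cone (D : semicosimplicial K) (L : cdga K) := Cone {
  cone_fun :> forall n, cdga_hom L (D n);
  cone_natural : forall m n (t : dinj m n) x,
    sc_map D t (cone_fun m x) = cone_fun n x
}.

Definition is_limit (D : semicosimplicial K) (L : cdga K) : Prop :=
  exists pi : cone D L, forall (B : cdga K) (rho : cone D B),
  exists h : cdga_hom B L,
    (forall n b, pi n (h b) = rho n b) /\
    (forall h' : cdga_hom B L, (forall n b, pi n (h' b) = rho n b) -> h' =1 h).

(* Fibrant objects of the injective model structure on semicosimplicial cdga's,
   whose weak equivalences and cofibrations are defined levelwise. *)
Definition injectively_fibrant (D : semicosimplicial K) : Prop :=
  forall (A B : semicosimplicial K) (i : sc_hom A B),
  (forall n, cofibration (i n)) -> (forall n, quasi_iso (i n)) ->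
  forall f : sc_hom A D,
  exists g : sc_hom B D, forall n a, g n (i n a) = f n a.

(* The homotopy limit is the total right derived functor of lim: the limit of
   an injectively fibrant replacement. *)
Definition is_holim (D : semicosimplicial K) (L : cdga K) : Prop :=
  exists (D' : semicosimplicial K) (j : sc_hom D D'),
    [/\ forall n, quasi_iso (j n), injectively_fibrant D' & is_limit D' L].

End HomotopyLimit.

Section CdgaTheory.
Variables (K : fieldType) (A : cdga K).

Lemma cdga_proj0 n : cdga_proj A n 0 = 0.
Proof. by apply: (addrI (cdga_proj A n 0)); rewrite -cdga_projD !addr0. Qed.

Lemma cdga_projN n x : cdga_proj A n (- x) = - cdga_proj A n x.
Proof. by apply: (addrI (cdga_proj A n x)); rewrite -cdga_projD !subrr cdga_proj0. Qed.

Lemma cdga_projB n x y : cdga_proj A n (x - y) = cdga_proj A n x - cdga_proj A n y.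
Proof. by rewrite cdga_projD cdga_projN. Qed.

Lemma cdga_d0 : cdga_d A 0 = 0.
Proof. by apply: (addrI (cdga_d A 0)); rewrite -cdga_dD !addr0. Qed.

Lemma cdga_dN x : cdga_d A (- x) = - cdga_d A x.
Proof. by apply: (addrI (cdga_d A x)); rewrite -cdga_dD !subrr cdga_d0. Qed.

Lemma cdga_dB x y : cdga_d A (x - y) = cdga_d A x - cdga_d A y.
Proof. by rewrite cdga_dD cdga_dN. Qed.

Lemma cdga_proj_id n x : cdga_proj A n (cdga_proj A n x) = cdga_proj A n x.
Proof. by rewrite cdga_proj_proj eqxx. Qed.

End CdgaTheory.

Record dg_subalgebra (K : fieldType) (A : cdga K) (P : A -> Prop) : Prop :=
  DgSubalgebra {
    dgs_unit : forall c, P (cdga_unit A c);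
    dgs_sub : forall x y, P x -> P y -> P (x - y);
    dgs_mul : forall x y, P x -> P y -> P (x * y);
    dgs_proj : forall n x, P x -> P (cdga_proj A n x);
    dgs_d : forall x, P x -> P (cdga_d A x)
  }.

Section SubCdga.
Variables (K : fieldType) (A : cdga K) (P : A -> Prop) (hP : dg_subalgebra P).

Definition sub_mem (_ : dg_subalgebra P) : {pred A} := fun x => `[< P x >].

Fact sub_mem_subring : subring_closed (sub_mem hP).
Proof.
split.
- by apply/asboolP; rewrite -(rmorph1 (cdga_unit A)); apply: dgs_unit hP _.
- by move=> x y /asboolP Px /asboolP Py; apply/asboolP; apply: (dgs_sub hP).
- by move=> x y /asboolP Px /asboolP Py; apply/asboolP; apply: (dgs_mul hP).
Qed.

Record sub_type := SubType { sub_val : A; _ : sub_val \in sub_mem hP }.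

HB.instance Definition _ := [isSub for sub_val].
HB.instance Definition _ := [Choice of sub_type by <:].
HB.instance Definition _ :=
  GRing.SubChoice_isSubPzRing.Build A (sub_mem hP) sub_type sub_mem_subring.

Fact sub_valP (x : sub_type) : P (\val x).
Proof. by case: x => x /= /asboolP. Qed.

Definition sub_in x (Px : P x) : sub_type := SubType (introT (asboolP _) Px).

Definition sub_unit c := sub_in (dgs_unit hP c).

Fact sub_unit_zmod : zmod_morphism sub_unit.
Proof. by move=> x y; apply: val_inj; rewrite /= rmorphB. Qed.

Fact sub_unit_monoid : monoid_morphism sub_unit.
Proof.
by split=> [|x y]; apply: val_inj; rewrite /= ?rmorph1 ?rmorphM.
Qed.

HB.instance Definition _ :=
  GRing.isZmodMorphism.Build K sub_type sub_unit sub_unit_zmod.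
HB.instance Definition _ :=
  GRing.isMonoidMorphism.Build K sub_type sub_unit sub_unit_monoid.

Definition sub_proj n (x : sub_type) := sub_in (dgs_proj hP n (sub_valP x)).
Definition sub_d (x : sub_type) := sub_in (dgs_d hP (sub_valP x)).

Fact sub_sign n (x : sub_type) : \val ((-1) ^+ n * x) = (-1) ^+ n * \val x.
Proof. by rewrite rmorphM rmorphXn rmorphN rmorph1. Qed.

Fact sub_valD (x y : sub_type) : sub_val (x + y) = sub_val x + sub_val y.
Proof. by []. Qed.

Definition sub_cdga : cdga K.
Proof.
refine (@Cdga K sub_type sub_unit sub_proj sub_d _ _ _ _ _ _ _ _ _ _ _).
- by move=> n x y; apply: val_inj; rewrite /= cdga_projD.
- move=> m n x; apply: val_inj; rewrite /= cdga_proj_proj.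
  by case: eqP.
- move=> x; have [s us xE] := cdga_proj_sum (\val x); exists s => //.
  by apply: val_inj; rewrite raddf_sum /= -xE.
- by move=> c; apply: val_inj; rewrite /= cdga_unit_deg.
- move=> m n x y /(congr1 val) /= hx /(congr1 val) /= hy.
  by apply: val_inj; rewrite /= cdga_mul_deg.
- move=> m n x y /(congr1 val) /= hx /(congr1 val) /= hy.
  by apply: val_inj; apply: etrans (cdga_mulC hx hy) (esym (sub_sign _ (y * x))).
- by move=> x y; apply: val_inj; rewrite /= cdga_dD.
- by move=> c; apply: val_inj; rewrite /= cdga_d_unit.
- by move=> n x /(congr1 val) /= hx; apply: val_inj; rewrite /= cdga_d_deg.
- move=> m x y /(congr1 val) /= hx; apply: val_inj.
  apply: etrans (cdga_dM _ hx) _;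
  apply/esym; apply: etrans (sub_valD _ _) _.
  by congr (_ + _); apply: sub_sign.
- by move=> x; apply: val_inj; rewrite /= cdga_dd.
Defined.

End SubCdga.

Record dg_ideal (K : fieldType) (A : cdga K) (I : A -> Prop) : Prop :=
  DgIdeal {
    dgi_0 : I 0;
    dgi_sub : forall x y, I x -> I y -> I (x - y);
    dgi_mulr : forall a x, I x -> I (x * a);
    dgi_mull : forall a x, I x -> I (a * x);
    dgi_proj : forall n x, I x -> I (cdga_proj A n x);
    dgi_d : forall x, I x -> I (cdga_d A x)
  }.

Section QuotCdga.
Variables (K : fieldType) (A : cdga K) (I : A -> Prop) (hI : dg_ideal I).

Definition quot_mem (_ : dg_ideal I) : {pred A} := fun x => `[< I x >].

Fact quot_mem_zmod : zmod_closed (quot_mem hI).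
Proof.
split; first by apply/asboolP; apply: dgi_0 hI.
by move=> x y /asboolP Px /asboolP Py; apply/asboolP; apply: (dgi_sub hI).
Qed.

HB.instance Definition _ :=
  GRing.isZmodClosed.Build A (quot_mem hI) quot_mem_zmod.

Definition quot_type := Quotient.quot (quot_mem hI).
HB.instance Definition _ := GRing.Zmodule.on quot_type.

Definition quot_pi (x : A) : quot_type := \pi_(Quotient.quot (quot_mem hI)) x.

Fact quot_piP x y : quot_pi x = quot_pi y <-> I (x - y).
Proof.
split=> [h|h].
  have: x - y \in quot_mem hI by rewrite Quotient.idealrBE; apply/eqP.
  by move/asboolP.
by apply/eqP; rewrite -Quotient.idealrBE; apply/asboolP.
Qed.

Fact quot_pi_surj (q : quot_type) : exists x, quot_pi x = q.
Proof. by exists (repr q); apply: reprK. Qed.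

Definition quot_repr (q : quot_type) : A := repr (q : Quotient.quot (quot_mem hI)).

Fact quot_reprK q : quot_pi (quot_repr q) = q.
Proof. exact: reprK. Qed.

Fact quot_piB : zmod_morphism quot_pi.
Proof. by move=> x y; rewrite /quot_pi Quotient.pi_add Quotient.pi_opp. Qed.

HB.instance Definition _ :=
  GRing.isZmodMorphism.Build A quot_type quot_pi quot_piB.

Definition quot_mul (p q : quot_type) := quot_pi (quot_repr p * quot_repr q).
Definition quot_proj n (p : quot_type) := quot_pi (cdga_proj A n (quot_repr p)).
Definition quot_d (p : quot_type) := quot_pi (cdga_d A (quot_repr p)).

Fact quot_repr_pi x : I (quot_repr (quot_pi x) - x).
Proof. by apply/quot_piP; rewrite quot_reprK. Qed.

Fact dgi_add x y : I x -> I y -> I (x + y).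
Proof.
move=> Ix Iy; rewrite -[y]opprK; apply: (dgi_sub hI) => //.
by rewrite -sub0r; apply: (dgi_sub hI) => //; apply: dgi_0.
Qed.

Fact quot_mulE x y : quot_mul (quot_pi x) (quot_pi y) = quot_pi (x * y).
Proof.
apply/quot_piP; set x' := quot_repr _; set y' := quot_repr _.
have -> : x' * y' - x * y = (x' - x) * y' + x * (y' - y).
  by rewrite mulrBl mulrBr addrA subrK.
apply: dgi_add; first by apply: (dgi_mulr hI); apply: quot_repr_pi.
by apply: (dgi_mull hI); apply: quot_repr_pi.
Qed.

Fact quot_projE n x : quot_proj n (quot_pi x) = quot_pi (cdga_proj A n x).
Proof.
by apply/quot_piP; rewrite -cdga_projB; apply: (dgi_proj hI); apply: quot_repr_pi.
Qed.

Fact quot_dE x : quot_d (quot_pi x) = quot_pi (cdga_d A x).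
Proof.
by apply/quot_piP; rewrite -cdga_dB; apply: (dgi_d hI); apply: quot_repr_pi.
Qed.

Fact quot_mulA : associative quot_mul.
Proof.
move=> x y z; rewrite -[x]quot_reprK -[y]quot_reprK -[z]quot_reprK.
by rewrite !quot_mulE mulrA.
Qed.

Fact quot_mul1r : left_id (quot_pi 1) quot_mul.
Proof. by move=> x; rewrite -[x]quot_reprK quot_mulE mul1r. Qed.

Fact quot_mulr1 : right_id (quot_pi 1) quot_mul.
Proof. by move=> x; rewrite -[x]quot_reprK quot_mulE mulr1. Qed.

Fact quot_mulDl : left_distributive quot_mul +%R.
Proof.
move=> x y z; rewrite -[x]quot_reprK -[y]quot_reprK -[z]quot_reprK.
by rewrite !quot_mulE -!raddfD quot_mulE mulrDl.
Qed.

Fact quot_mulDr : right_distributive quot_mul +%R.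
Proof.
move=> x y z; rewrite -[x]quot_reprK -[y]quot_reprK -[z]quot_reprK.
by rewrite !quot_mulE -!raddfD quot_mulE mulrDr.
Qed.

HB.instance Definition _ := GRing.Zmodule_isPzRing.Build quot_type
  quot_mulA quot_mul1r quot_mulr1 quot_mulDl quot_mulDr.

Fact quot_piM : monoid_morphism quot_pi.
Proof. by split=> [//|x y]; rewrite -quot_mulE. Qed.

HB.instance Definition _ :=
  GRing.isMonoidMorphism.Build A quot_type quot_pi quot_piM.

Definition quot_unit : {rmorphism K -> quot_type} := quot_pi \o cdga_unit A.

(* A homogeneous class has a homogeneous representative. *)
Fact quot_homog n q : quot_proj n q = q ->
  exists2 x, cdga_proj A n x = x & quot_pi x = q.
Proof.
move=> hq; exists (cdga_proj A n (quot_repr q)); first by rewrite cdga_proj_id.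
by rewrite -quot_projE quot_reprK.
Qed.

Definition quot_cdga : cdga K.
Proof.
refine (@Cdga K quot_type quot_unit quot_proj quot_d _ _ _ _ _ _ _ _ _ _ _).
- move=> n x y; rewrite -[x]quot_reprK -[y]quot_reprK -raddfD !quot_projE.
  by rewrite -raddfD cdga_projD.
- move=> m n x; rewrite -[x]quot_reprK !quot_projE cdga_proj_proj.
  by case: eqP => // _; rewrite raddf0.
- move=> q; rewrite -[q]quot_reprK; have [s us xE] := cdga_proj_sum (quot_repr q).
  exists s => //; rewrite {1}xE raddf_sum; apply: eq_bigr => n _.
  by rewrite quot_projE.
- by move=> c; rewrite /= quot_projE cdga_unit_deg.
- move=> m n x y /quot_homog[a ha <-] /quot_homog[b hb <-].
  by rewrite -rmorphM quot_projE cdga_mul_deg.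
- move=> m n x y /quot_homog[a ha <-] /quot_homog[b hb <-].
  rewrite -[RHS](_ : quot_pi ((-1) ^+ absz (m * n) * (b * a)) = _).
    by rewrite -rmorphM (cdga_mulC ha hb).
  by rewrite !rmorphM rmorphXn rmorphN rmorph1.
- move=> x y; rewrite -[x]quot_reprK -[y]quot_reprK -raddfD !quot_dE.
  by rewrite -raddfD cdga_dD.
- by move=> c; rewrite /= quot_dE cdga_d_unit raddf0.
- by move=> n x /quot_homog[a ha <-]; rewrite quot_dE quot_projE cdga_d_deg.
- move=> m x y /quot_homog[a ha <-]; rewrite -[y]quot_reprK.
  rewrite -rmorphM !quot_dE (cdga_dM _ ha) rmorphD !rmorphM.
  by rewrite rmorphXn rmorphN rmorph1.
- by move=> x; rewrite -[x]quot_reprK !quot_dE cdga_dd raddf0.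
Defined.

End QuotCdga.

Section DiscreteCdga.
Variables (K : fieldType) (R : pzRingType) (u : {rmorphism K -> R}).
Hypothesis mulRC : commutative (@GRing.mul R).

Definition disc_proj (n : int) (x : R) : R := if n == 0 then x else 0.

Definition disc_cdga : cdga K.
Proof.
refine (@Cdga K R u disc_proj (fun=> 0) _ _ _ _ _ _ _ _ _ _ _);
  rewrite /disc_proj => //.
- by move=> n x y; case: eqP => // _; rewrite addr0.
- by move=> m n x; case: (n =P 0) => [->|_] //; case: ifP; case: ifP.
- by move=> x; exists [:: 0]; rewrite // big_seq1 eqxx.
- move=> m n x y; case: (m =P 0) => [->|_] hx; last by rewrite -hx mul0r if_same.
  case: (n =P 0) => [->|_] hy; last by rewrite -hy mulr0 if_same.
  by rewrite addr0 eqxx.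
- move=> m n x y; case: (m =P 0) => [->|_] hx.
    by rewrite mul0r expr0 mul1r mulRC.
  by rewrite -hx mul0r mulr0 mulr0.
- by move=> x y; rewrite addr0.
- by move=> n x; rewrite if_same.
- by move=> m x y _; rewrite mul0r !mulr0 addr0.
Defined.

End DiscreteCdga.

Section Forms.
Variables (R : comNzRingType) (n : nat).

(* R[u_i, du_i | i < n], the free graded-commutative algebra: an element is
   sum_s w(s) du_s, with w(s) a polynomial in the u_i and
   du_s = du_{i_1} ... du_{i_k} for s = {i_1 < ... < i_k}. *)
Definition form := {ffun {set 'I_n} -> {mpoly R[n]}}.
HB.instance Definition _ := GRing.Zmodule.on form.

Definition inversions (s t : {set 'I_n}) : nat :=
  (\sum_(i in s) \sum_(j in t) (j < i)%N)%N.

(* du_s du_t = wedge_sign s t du_(s :|: t) *)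
Definition wedge_sign (s t : {set 'I_n}) : {mpoly R[n]} :=
  if [disjoint s & t] then (-1) ^+ inversions s t else 0.

Definition form_mul (x y : form) : form :=
  [ffun w => \sum_s \sum_(t | s :|: t == w) wedge_sign s t * (x s * y t)].

Definition form_poly (p : {mpoly R[n]}) : form :=
  [ffun s => if s == set0 then p else 0].

Definition form_u (i : 'I_n) : form := form_poly 'X_i.
Definition form_du (i : 'I_n) : form := [ffun s => if s == [set i] then 1 else 0].

Fact formP (x y : form) : (forall s, x s = y s) -> x = y.
Proof. by move=> h; apply/ffunP => s; apply: h. Qed.

Fact formE f s : ([ffun s => f s] : form) s = f s.
Proof. exact: ffunE. Qed.

Fact form_addE (x y : form) s : (x + y) s = x s + y s.
Proof. exact: ffunE. Qed.

Fact form_oppE (x : form) s : (- x) s = - x s.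
Proof. exact: ffunE. Qed.

Fact form_0E s : (0 : form) s = 0.
Proof. exact: ffunE. Qed.

Fact form_sumE (T : Type) (r : seq T) (P : pred T) (F : T -> form) s :
  (\sum_(i <- r | P i) F i) s = \sum_(i <- r | P i) F i s.
Proof. exact: sum_ffunE. Qed.

Fact inversionsUl (s t r : {set 'I_n}) : [disjoint s & t] ->
  inversions (s :|: t) r = (inversions s r + inversions t r)%N.
Proof.
move=> h; rewrite /inversions -bigU //=; apply: eq_bigl => i.
by rewrite !inE.
Qed.

Fact inversionsUr (s t r : {set 'I_n}) : [disjoint t & r] ->
  inversions s (t :|: r) = (inversions s t + inversions s r)%N.
Proof.
move=> h; rewrite /inversions -big_split /=; apply: eq_bigr => i _.
by rewrite -bigU //=; apply: eq_bigl => j; rewrite !inE.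
Qed.

Fact inversionsC (s t : {set 'I_n}) : [disjoint s & t] ->
  (inversions s t + inversions t s = #|s| * #|t|)%N.
Proof.
move=> h; rewrite /inversions [X in (_ + X)%N]exchange_big -big_split /=.
rewrite -sum_nat_const; apply: eq_bigr => i si; rewrite -big_split /=.
rewrite -sum1_card; apply: eq_bigr => j tj.
have: i != j by apply: contraTneq tj => <-; rewrite (disjointFr h si).
by rewrite neq_ltn; case: ltngtP.
Qed.

Fact inversions0s s : inversions set0 s = 0%N.
Proof. by rewrite /inversions big_set0. Qed.

Fact inversionss0 s : inversions s set0 = 0%N.
Proof. by rewrite /inversions big1 // => i _; rewrite big_set0. Qed.

Fact wedge_sign0s s : wedge_sign set0 s = 1.
Proof. by rewrite /wedge_sign -setI_eq0 set0I eqxx inversions0s expr0. Qed.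

Fact wedge_signs0 s : wedge_sign s set0 = 1.
Proof. by rewrite /wedge_sign -setI_eq0 setI0 eqxx inversionss0 expr0. Qed.

Fact wedge_signA s t r : wedge_sign s t * wedge_sign (s :|: t) r =
  wedge_sign t r * wedge_sign s (t :|: r).
Proof.
rewrite /wedge_sign -[[disjoint s :|: t & r]]setI_eq0 setIUl setU_eq0.
rewrite -[[disjoint s & t :|: r]]setI_eq0 setIUr setU_eq0 !setI_eq0.
case: (boolP [disjoint s & t]) => st; last by rewrite mul0r mulr0.
case: (boolP [disjoint t & r]) => tr; last by rewrite andbF mul0r mulr0.
case: (boolP [disjoint s & r]) => sr /=; last by rewrite !mulr0.
rewrite -!exprD inversionsUl // inversionsUr //; congr (_ ^+ _).
by rewrite addnA addnC.
Qed.

Fact wedge_signC s t :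
  wedge_sign s t = (-1) ^+ (#|s| * #|t|) * wedge_sign t s.
Proof.
rewrite /wedge_sign disjoint_sym; case: ifP => [ts|_]; last by rewrite mulr0.
rewrite -inversionsC 1?disjoint_sym // exprD -mulrA -exprMn.
by rewrite mulrNN mulr1 expr1n mulr1.
Qed.

Fact form_mulE x y w : form_mul x y w =
  \sum_s \sum_(t | s :|: t == w) wedge_sign s t * (x s * y t).
Proof. exact: formE. Qed.


Fact sum_if_eq (T : finType) (V : zmodType) (a : T) (G : T -> V) :
  \sum_v (if a == v then G v else 0) = G a.
Proof.
rewrite -big_mkcond /= (big_pred1 a) // => v; exact: eq_sym.
Qed.

Fact form_mul_if x y w : form_mul x y w =
  \sum_s \sum_t if s :|: t == w then wedge_sign s t * (x s * y t) else 0.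
Proof. by rewrite form_mulE; apply: eq_bigr => s _; rewrite big_mkcond. Qed.

Fact form_mulA : associative form_mul.
Proof.
move=> x y z; apply: formP => w; rewrite !form_mul_if.
transitivity (\sum_s \sum_t \sum_r if s :|: (t :|: r) == w then
   wedge_sign t r * wedge_sign s (t :|: r) * (x s * y t * z r) else 0).
  apply: eq_bigr => s _.
  transitivity (\sum_v \sum_t \sum_r if t :|: r == v then
      if s :|: v == w then
        wedge_sign t r * wedge_sign s v * (x s * y t * z r) else 0 else 0).
    apply: eq_bigr => v _; rewrite form_mul_if.
    case: ifP => _; last first.
      by rewrite big1 // => t _; rewrite big1 // => r _; rewrite if_same.
    rewrite !mulr_sumr; apply: eq_bigr => t _; rewrite !mulr_sumr.
    apply: eq_bigr => r _; case: ifP => _; last by rewrite !mulr0.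
    by rewrite -!mulrA [RHS]mulrCA; congr (_ * _); rewrite mulrCA.
  rewrite exchange_big /=; apply: eq_bigr => t _.
  rewrite exchange_big /=; apply: eq_bigr => r _.
  by rewrite sum_if_eq.
transitivity (\sum_v \sum_r \sum_s \sum_t if s :|: t == v then
   if v :|: r == w then
     wedge_sign s t * wedge_sign v r * (x s * y t * z r) else 0 else 0); last first.
  apply: eq_bigr => v _; apply: eq_bigr => r _; rewrite form_mul_if.
  case: ifP => _; last first.
    by rewrite big1 // => t _; rewrite big1 // => q _; rewrite if_same.
  rewrite !mulr_suml !mulr_sumr; apply: eq_bigr => s _.
  rewrite !mulr_suml !mulr_sumr; apply: eq_bigr => t _.
  case: ifP => _; last by rewrite mul0r mulr0.
  by rewrite -!mulrA mulrCA.
rewrite [RHS]exchange_big /=.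
under [RHS]eq_bigr => r _.
  rewrite exchange_big /=.
  under eq_bigr => s _.
    rewrite exchange_big /=.
    under eq_bigr => t _ do rewrite sum_if_eq wedge_signA -setUA.
    over.
  over.
rewrite [RHS]exchange_big /=; apply: eq_bigr => s _.
by rewrite [RHS]exchange_big.
Qed.

(* A form of degree 0 multiplies coefficientwise. *)
Fact form_poly_mul p x s : form_mul (form_poly p) x s = p * x s.
Proof.
rewrite form_mul_if (bigD1 set0) //= [X in _ + X]big1 ?addr0 => [|t /negPf t0]; last first.
  by rewrite big1 // => r _; rewrite formE t0 mul0r mulr0 if_same.
rewrite formE eqxx; under eq_bigr => t _ do rewrite set0U wedge_sign0s mul1r eq_sym.
by rewrite sum_if_eq.
Qed.

Fact form_mul_poly p x s : form_mul x (form_poly p) s = x s * p.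
Proof.
rewrite form_mul_if exchange_big (bigD1 set0) //= [X in _ + X]big1 ?addr0 => [|t /negPf t0]; last first.
  by rewrite big1 // => r _; rewrite formE t0 mulr0 mulr0 if_same.
rewrite formE eqxx; under eq_bigr => t _ do rewrite setU0 wedge_signs0 mul1r eq_sym.
by rewrite sum_if_eq.
Qed.

Fact form_mul1x : left_id (form_poly 1) form_mul.
Proof. by move=> x; apply: formP => s; rewrite form_poly_mul mul1r. Qed.

Fact form_mulx1 : right_id (form_poly 1) form_mul.
Proof. by move=> x; apply: formP => s; rewrite form_mul_poly mulr1. Qed.

Fact form_mulDl : left_distributive form_mul +%R.
Proof.
move=> x y z; apply: formP => w; rewrite form_addE !form_mulE -big_split.
apply: eq_bigr => s _; rewrite -big_split; apply: eq_bigr => t _ /=.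
by rewrite form_addE mulrDl mulrDr.
Qed.

Fact form_mulDr : right_distributive form_mul +%R.
Proof.
move=> x y z; apply: formP => w; rewrite form_addE !form_mulE -big_split.
apply: eq_bigr => s _; rewrite -big_split; apply: eq_bigr => t _ /=.
by rewrite form_addE mulrDr mulrDr.
Qed.

HB.instance Definition _ := GRing.Zmodule_isPzRing.Build form
  form_mulA form_mul1x form_mulx1 form_mulDl form_mulDr.

Fact form_mulrE (x y : form) w : (x * y) w =
  \sum_s \sum_(t | s :|: t == w) wedge_sign s t * (x s * y t).
Proof. exact: form_mulE. Qed.

Fact form_polyM p q : form_poly (p * q) = form_poly p * form_poly q.
Proof.
apply: formP => s; rewrite [RHS]form_poly_mul !formE.
by case: eqP; rewrite ?mulr0.
Qed.

Fact form_polyB p q : form_poly (p - q) = form_poly p - form_poly q.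
Proof.
apply: formP => s; rewrite form_addE form_oppE !formE.
by case: eqP; rewrite ?subr0.
Qed.

Definition form_proj (k : int) (x : form) : form :=
  [ffun s : {set 'I_n} => if #|s|%:Z == k then x s else 0].

(* (-1)^m on forms of degree m *)
Definition form_twist (x : form) : form := [ffun s : {set 'I_n} => (-1) ^+ #|s| * x s].

Definition form_partial (i : 'I_n) (x : form) : form := [ffun s => (x s)^`M(i)].

Definition form_d (x : form) : form := \sum_i form_du i * form_partial i x.

Fact form_projP k x : form_proj k x = x <-> (forall s : {set 'I_n}, #|s|%:Z != k -> x s = 0).
Proof.
split=> [<- s /negPf sk|h]; first by rewrite formE sk.
by apply: formP => s; rewrite formE; case: ifPn => // /h.
Qed.

Fact form_projD k x y : form_proj k (x + y) = form_proj k x + form_proj k y.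
Proof.
apply: formP => s; rewrite form_addE !formE ?form_addE.
by case: ifP; rewrite ?addr0.
Qed.

Fact form_proj_proj k l x :
  form_proj k (form_proj l x) = if k == l then form_proj l x else 0.
Proof.
apply: formP => s; rewrite !formE; case: (k =P l) => [<-|kl].
  by rewrite formE; case: eqP.
by rewrite form_0E; case: eqP => // ->; case: eqP.
Qed.

Fact form_proj_sum x :
  exists2 s : seq int, uniq s & x = \sum_(k <- s) form_proj k x.
Proof.
exists [seq k%:Z | k <- iota 0 n.+1].
  by rewrite map_inj_uniq ?iota_uniq // => k l [].
apply: formP => s; rewrite form_sumE big_map (bigD1_seq #|s|) ?iota_uniq //; last first.
  by rewrite mem_iota add0n ltnS (leq_trans (max_card _)) ?card_ord.
rewrite /= formE eqxx big1 ?addr0 // => k ks.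
by rewrite formE eqz_nat eq_sym (negPf ks).
Qed.

Fact form_proj_poly p : form_proj 0 (form_poly p) = form_poly p.
Proof.
by apply/form_projP => s s0; rewrite formE -cards_eq0 -eqz_nat (negPf s0).
Qed.

Fact form_proj_du i : form_proj 1 (form_du i) = form_du i.
Proof.
apply/form_projP => s s1; rewrite formE; case: eqP => // si.
by rewrite si cards1 in s1.
Qed.

Fact wedge_signN0 (s t : {set 'I_n}) : wedge_sign s t != 0 -> #|s :|: t| = (#|s| + #|t|)%N.
Proof.
rewrite /wedge_sign; case: ifP; last by rewrite eqxx.
by rewrite -setI_eq0 cardsU => /eqP -> _; rewrite cards0 subn0.
Qed.

Fact form_proj_mul k l x y : form_proj l y = y ->
  form_proj (k + l) (x * y) = form_proj k x * y.
Proof.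
move=> /form_projP hy; apply: formP => w; rewrite formE.
rewrite !form_mulrE.
transitivity (\sum_s \sum_(t | s :|: t == w)
  if #|w|%:Z == k + l then wedge_sign s t * (x s * y t) else 0).
  by case: ifP => // _; rewrite big1 // => s _; rewrite big1.
apply: eq_bigr => s _; apply: eq_bigr => t /eqP <-; rewrite formE.
have [->|/wedge_signN0 ->] := eqVneq (wedge_sign s t) 0.
  by rewrite !mul0r if_same.
have [tl|/hy ->] := eqVneq #|t|%:Z l; last by rewrite !mulr0 if_same.
rewrite PoszD tl (inj_eq (addIr l)).
by case: ifP => // _; rewrite mul0r mulr0.
Qed.

Fact form_mul_deg k l x y : form_proj k x = x -> form_proj l y = y ->
  form_proj (k + l) (x * y) = x * y.
Proof. by move=> hx hy; rewrite form_proj_mul // hx. Qed.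

Fact form_sign k (x : form) s : ((-1) ^+ k * x) s = (-1) ^+ k * x s.
Proof.
have -> : (-1) ^+ k = form_poly ((-1) ^+ k) :> form.
  elim: k => [|k IH]; first by rewrite !expr0.
  rewrite !exprS form_polyM IH; congr (_ * _).
  by apply: formP => r; rewrite form_oppE !formE; case: eqP; rewrite ?oppr0.
exact: form_poly_mul.
Qed.

Fact form_mulC k l x y : form_proj k x = x -> form_proj l y = y ->
  x * y = (-1) ^+ absz (k * l) * (y * x).
Proof.
move=> /form_projP hx /form_projP hy; apply: formP => w.
rewrite form_sign [LHS]form_mul_if [X in _ * X]form_mul_if.
rewrite [in RHS]exchange_big /= mulr_sumr.
apply: eq_bigr => s _; rewrite mulr_sumr; apply: eq_bigr => t _.
rewrite [t :|: s]setUC; case: ifP => _; last by rewrite mulr0.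
have [<-|/hx ->] := eqVneq #|s|%:Z k; last by rewrite mul0r !mulr0.
have [<-|/hy ->] := eqVneq #|t|%:Z l; last by rewrite mul0r !mulr0.
by rewrite wedge_signC abszM !absz_nat -mulrA [x s * _]mulrC.
Qed.

Fact form_twist_homog k x : form_proj k x = x ->
  form_twist x = (-1) ^+ absz k * x.
Proof.
move=> /form_projP hx; apply: formP => s; rewrite form_sign formE.
by have [<-|/hx ->] := eqVneq #|s|%:Z k; rewrite ?absz_nat ?mulr0.
Qed.

Fact form_twistD x y : form_twist (x + y) = form_twist x + form_twist y.
Proof. by apply: formP => s; rewrite form_addE !formE ?form_addE mulrDr. Qed.

Fact form_twistK : involutive form_twist.
Proof.
by move=> x; apply: formP => s; rewrite !formE mulrA -exprD addnn -mul2n exprM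
  sqrrN expr1n expr1n mul1r.
Qed.

Fact form_du_mul i x : x * form_du i = form_du i * form_twist x.
Proof.
have [s us ->] := form_proj_sum x; rewrite mulr_suml.
have -> : form_twist (\sum_(k <- s) form_proj k x) =
          \sum_(k <- s) form_twist (form_proj k x).
  elim/big_rec2: _ => [|k y z _ <-]; last by rewrite form_twistD.
  by apply: formP => r; rewrite formE ?form_0E mulr0.
rewrite mulr_sumr; apply: eq_bigr => k _.
have hk : form_proj k (form_proj k x) = form_proj k x.
  by rewrite form_proj_proj eqxx.
rewrite (form_mulC hk (form_proj_du i)) mulr1 (form_twist_homog hk).
by rewrite !mulrA; congr (_ * _); exact/esym/commr_sign.
Qed.

Fact form_partialD i x y :
  form_partial i (x + y) = form_partial i x + form_partial i y.
Proof. by apply: formP => s; rewrite form_addE !formE ?form_addE mderivD. Qed.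

Fact form_partialM i x y :
  form_partial i (x * y) = form_partial i x * y + x * form_partial i y.
Proof.
apply: formP => w; rewrite form_addE formE !form_mul_if -big_split.
rewrite raddf_sum; apply: eq_bigr => s _; rewrite -big_split raddf_sum.
apply: eq_bigr => t _ /=; case: ifP => _; last by rewrite mderiv0 addr0.
rewrite !formE -mulrDr -mderivM /wedge_sign; case: ifP => _; last first.
  by rewrite !mul0r mderiv0.
by rewrite -signr_odd; case: odd; rewrite ?expr1 ?expr0 ?mulN1r ?mul1r ?mderivN.
Qed.

Fact form_partial_du i j : form_partial i (form_du j) = 0.
Proof.
apply: formP => s; rewrite !formE ?form_0E; case: eqP => _; last exact: mderiv0.
by rewrite -mpolyC1 mderivC.
Qed.

Fact form_partialC i j x :
  form_partial i (form_partial j x) = form_partial j (form_partial i x).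
Proof. by apply: formP => s; rewrite !formE mderiv_comm. Qed.

Fact form_partial_du_mul i j x :
  form_partial i (form_du j * x) = form_du j * form_partial i x.
Proof. by rewrite form_partialM form_partial_du mul0r add0r. Qed.

Fact form_partial_proj i k x :
  form_partial i (form_proj k x) = form_proj k (form_partial i x).
Proof.
by apply: formP => s; rewrite !formE; case: ifP => // _; rewrite mderiv0.
Qed.

Fact form_du_duC i j : form_du i * form_du j = - (form_du j * form_du i).
Proof.
by rewrite (form_mulC (form_proj_du i) (form_proj_du j)) /= expr1 mulN1r.
Qed.

Fact form_du_du i : form_du i * form_du i = 0.
Proof.
apply: formP => w; rewrite form_mul_if big1 ?form_0E // => s _.
rewrite big1 // => t _; rewrite !formE; case: ifP => // _.
case: eqP => [->|_]; last by rewrite mul0r mulr0.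
case: eqP => [->|_]; last by rewrite !mulr0.
by rewrite /wedge_sign -setI_eq0 setIid -cards_eq0 cards1 mul0r.
Qed.

Fact form_dD x y : form_d (x + y) = form_d x + form_d y.
Proof.
rewrite /form_d -big_split; apply: eq_bigr => i _ /=.
by rewrite form_partialD mulrDr.
Qed.

Fact form_dM x y :
  form_d (x * y) = form_d x * y + form_twist x * form_d y.
Proof.
rewrite /form_d mulr_suml mulr_sumr -big_split; apply: eq_bigr => i _ /=.
rewrite form_partialM mulrDr mulrA; congr (_ + _).
by rewrite [in RHS]mulrA form_du_mul form_twistK mulrA.
Qed.

Fact form_d_deg k x : form_proj k x = x -> form_proj (k + 1) (form_d x) = form_d x.
Proof.
move=> hx; have pD := form_projD (k + 1).
have p0 : form_proj (k + 1) 0 = 0.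
  by apply: formP => s; rewrite formE ?form_0E if_same.
rewrite /form_d (big_morph _ pD p0); apply: eq_bigr => i _.
rewrite addrC form_mul_deg ?form_proj_du //.
by rewrite -form_partial_proj hx.
Qed.

Fact form_dd x : form_d (form_d x) = 0.
Proof.
have pD i := form_partialD i.
have p0 i : form_partial i 0 = 0.
  by apply: formP => s; rewrite formE ?form_0E mderiv0.
pose a i j := form_du i * form_du j * form_partial i (form_partial j x).
have aC i j : a i j = - a j i.
  by rewrite /a form_partialC form_du_duC mulNr.
have a0 i : a i i = 0 by rewrite /a form_du_du mul0r.
have -> : form_d (form_d x) = \sum_i \sum_j a i j.
  rewrite {1}/form_d; apply: eq_bigr => i _.
  rewrite /form_d (big_morph _ (pD i) (p0 i)) mulr_sumr; apply: eq_bigr => j _.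
  by rewrite form_partial_du_mul mulrA.
have split_ij i : \sum_j a i j =
    \sum_(j < n | (i < j)%N) a i j + \sum_(j < n | (j < i)%N) a i j.
  rewrite (bigID (fun j : 'I_n => (i < j)%N)) /=; congr (_ + _).
  rewrite (bigD1 i) ?ltnn //= a0 add0r; apply: eq_bigl => j.
  by rewrite -leqNgt [RHS]ltn_neqAle andbC.
under eq_bigr => i _ do rewrite split_ij.
rewrite big_split /= [X in _ + X](exchange_big_dep xpredT) //= -big_split.
rewrite big1 // => i _; rewrite /= -big_split big1 // => j _ /=.
by rewrite aC addNr.
Qed.

Fact form_d_poly_const c : form_d (form_poly c%:MP) = 0.
Proof.
rewrite /form_d big1 // => i _.
have -> : form_partial i (form_poly c%:MP) = 0; last by rewrite mulr0.
by apply: formP => s; rewrite !formE ?form_0E; case: eqP; rewrite ?mderivC ?mderiv0.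
Qed.

Fact form_poly_monoid : monoid_morphism form_poly.
Proof. by split=> // p q; rewrite form_polyM. Qed.

HB.instance Definition _ :=
  GRing.isZmodMorphism.Build {mpoly R[n]} form form_poly form_polyB.
HB.instance Definition _ :=
  GRing.isMonoidMorphism.Build {mpoly R[n]} form form_poly form_poly_monoid.

End Forms.

Section FormCdga.
Variables (K : fieldType) (R : comNzRingType) (iota : {rmorphism K -> R}) (n : nat).

Definition form_unit : {rmorphism K -> form R n} :=
  @form_poly R n \o (@mpolyC n R \o iota).

Definition form_cdga : cdga K.
Proof.
refine (@Cdga K (form R n) form_unit (@form_proj R n) (@form_d R n)
  _ _ _ _ _ _ _ _ _ _ _).
- exact: form_projD.
- exact: form_proj_proj.
- exact: form_proj_sum.
- by move=> c; apply: form_proj_poly.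
- exact: form_mul_deg.
- exact: form_mulC.
- exact: form_dD.
- by move=> c; apply: form_d_poly_const.
- exact: form_d_deg.
- by move=> m x y hx; rewrite form_dM (form_twist_homog hx) mulrA.
- exact: form_dd.
Defined.

End FormCdga.

Section Faces.
Variables (R : comNzRingType) (n : nat).
Local Notation form := (form R n).

(* Pullback to the face {u_i = 0, i \notin J}: u_i and du_i are sent to 0 for
   i \notin J. *)
Definition face_poly (J : {set 'I_n}) (p : {mpoly R[n]}) : {mpoly R[n]} :=
  p \mPo [tuple (if i \in J then 'X_i else 0) | i < n].

Definition face (J : {set 'I_n}) (x : form) : form :=
  [ffun s : {set 'I_n} => if s \subset J then face_poly J (x s) else 0].

(* The subalgebra R[u_i, du_i | i \in J]. *)
Definition face_form (J : {set 'I_n}) (x : form) : Prop := face J x = x.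

(* The ideal (sum_(i in J) u_i - 1, sum_(i in J) du_i) of
   R[u_i, du_i | i \in J]; the left ideal generated by these homogeneous
   elements is two-sided by graded commutativity. *)
Definition face_ideal (J : {set 'I_n}) (x : form) : Prop :=
  exists a b : form, [/\ face_form J a, face_form J b &
    x = a * (\sum_(i in J) form_u R i - 1) + b * \sum_(i in J) form_du R i].

Fact face_polyB J : zmod_morphism (face_poly J).
Proof. by move=> p q; rewrite /face_poly raddfB. Qed.

Fact face_polyM J : monoid_morphism (face_poly J).
Proof. by split=> [|p q]; rewrite /face_poly ?rmorph1 ?rmorphM. Qed.

HB.instance Definition _ J :=
  GRing.isZmodMorphism.Build {mpoly R[n]} {mpoly R[n]} (face_poly J) (face_polyB J).
HB.instance Definition _ J :=
  GRing.isMonoidMorphism.Build {mpoly R[n]} {mpoly R[n]} (face_poly J) (face_polyM J).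

Fact face_polyX J i : face_poly J 'X_i = if i \in J then 'X_i else 0.
Proof. by rewrite /face_poly comp_mpolyXU -tnth_nth tnth_mktuple. Qed.

Fact face_polyC J c : face_poly J c%:MP = c%:MP.
Proof. by rewrite /face_poly comp_mpolyC. Qed.

Fact mpoly_ring_ind (P : {mpoly R[n]} -> Prop) :
  (forall c, P c%:MP) -> (forall i, P 'X_i) ->
  (forall p q, P p -> P q -> P (p + q)) ->
  (forall p q, P p -> P q -> P (p * q)) -> forall p, P p.
Proof.
move=> PC PX PD PM; elim/mpolyind => [|c m p _ _ Pp]; first exact: (PC 0).
apply: (PD) => //; rewrite -mul_mpolyC; apply: (PM) => //.
rewrite mpolyXE_id; elim/big_ind: _ => [|f g hf hg|i _]; [exact: (PC 1)|exact: (PM)|].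
by elim: (m i) => [|k IH]; rewrite ?expr0 ?exprS; [exact: (PC 1)|apply: (PM)].
Qed.

Fact face_poly_face J p : face_poly J (face_poly J p) = face_poly J p.
Proof.
elim/mpoly_ring_ind: p => [c|i|p q hp hq|p q hp hq].
- by rewrite !face_polyC.
- by rewrite !face_polyX; case: ifP => h; rewrite ?raddf0 // face_polyX h.
- by rewrite !raddfD /= hp hq.
- by rewrite !rmorphM /= hp hq.
Qed.

Fact face_polyT p : face_poly setT p = p.
Proof.
elim/mpoly_ring_ind: p => [c|i|p q hp hq|p q hp hq].
- by rewrite face_polyC.
- by rewrite face_polyX inE.
- by rewrite raddfD /= hp hq.
- by rewrite rmorphM /= hp hq.
Qed.

Fact mnm_submm (m : 'X_{1..n}) : (m - m = 0)%MM.
Proof. by apply/mnmP => i; rewrite mnmBE mnm0E subnn. Qed.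

Fact mderiv_face_poly J i p :
  (face_poly J p)^`M(i) = if i \in J then face_poly J p^`M(i) else 0.
Proof.
elim/mpoly_ring_ind: p => [c|j|p q hp hq|p q hp hq].
- by rewrite face_polyC mderivC raddf0 if_same.
- rewrite face_polyX; case: (boolP (j \in J)) => jJ.
    case: (boolP (i \in J)) => iJ; rewrite mderivX -?mul_mpolyC.
      rewrite mnm1E; case: eqP => [->|_]; last by rewrite !mul0r raddf0.
      by rewrite mpolyC1 mul1r mnm_submm mpolyX0 rmorph1.
    by rewrite mnm1E; case: eqP iJ => [<-|_ _]; [rewrite jJ|rewrite mul0r].
  rewrite mderiv0 mderivX; case: ifP => // iJ.
  rewrite mnm1E; case: eqP => [ji|_]; first by rewrite ji iJ in jJ.
  by rewrite -mul_mpolyC mul0r raddf0.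
- rewrite raddfD /= !mderivD hp hq; case: ifP => _; last by rewrite addr0.
  by rewrite raddfD.
- rewrite rmorphM /= !mderivM hp hq; case: ifP => _.
    by rewrite raddfD /= !rmorphM.
  by rewrite mul0r mulr0 addr0.
Qed.

Fact face_faceE J x s :
  face J x s = if s \subset J then face_poly J (x s) else 0.
Proof. exact: formE. Qed.

Fact faceB J : zmod_morphism (face J).
Proof.
move=> x y; apply: formP => s; rewrite form_addE form_oppE !face_faceE.
rewrite form_addE form_oppE; case: ifP => _; last by rewrite subr0.
by rewrite raddfB.
Qed.

HB.instance Definition _ J :=
  GRing.isZmodMorphism.Build form form (face J) (faceB J).

Fact face_polyform J p : face J (form_poly p) = form_poly (face_poly J p).
Proof.
apply: formP => s; rewrite face_faceE !formE; case: eqP => [->|_].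
  by rewrite sub0set.
by rewrite raddf0 if_same.
Qed.

Fact face_poly_sign J s t : face_poly J (wedge_sign R s t) = wedge_sign R s t.
Proof.
by rewrite /wedge_sign; case: ifP => _; rewrite ?raddf0 // rmorphXn rmorphN1.
Qed.

Fact faceM J : monoid_morphism (face J).
Proof.
split=> [|x y]; first by rewrite -[1]/(form_poly 1) face_polyform rmorph1.
apply: formP => w; rewrite face_faceE !form_mul_if.
case: (boolP (w \subset J)) => wJ; last first.
  rewrite big1 // => s _; rewrite big1 // => t _; case: eqP => // st.
  rewrite -st subUset in wJ; rewrite !face_faceE.
  by case: ifP wJ => _; case: ifP => // _ _; rewrite ?mulr0 ?mul0r ?mulr0.
rewrite raddf_sum; apply: eq_bigr => s _; rewrite raddf_sum.
apply: eq_bigr => t _ /=; case: eqP => [st|_]; last exact: raddf0.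
move: wJ; rewrite -st subUset => /andP[sJ tJ].
by rewrite !face_faceE sJ tJ !rmorphM /= face_poly_sign.
Qed.

HB.instance Definition _ J :=
  GRing.isMonoidMorphism.Build form form (face J) (faceM J).

Fact face_face J x : face J (face J x) = face J x.
Proof.
apply: formP => s; rewrite !face_faceE.
by case: (s \subset J); rewrite // face_poly_face.
Qed.

Fact face_formP J x : face_form J (face J x).
Proof. exact: face_face. Qed.

Fact face_setT x : face setT x = x.
Proof. by apply: formP => s; rewrite face_faceE subsetT face_polyT. Qed.

Fact face_formT x : face_form setT x.
Proof. exact: face_setT. Qed.

Fact face_u J i : face J (form_u R i) = if i \in J then form_u R i else 0.
Proof.
by rewrite /form_u face_polyform face_polyX; case: ifP => // _; rewrite raddf0.
Qed.

Fact face_du J i : face J (form_du R i) = if i \in J then form_du R i else 0.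
Proof.
apply: formP => s; rewrite face_faceE formE; case: (s =P [set i]) => [->|si].
  by rewrite sub1set rmorph1; case: ifP => _; rewrite formE ?eqxx.
rewrite raddf0 if_same; case: ifP => _; rewrite formE //.
by move/eqP/negPf: si => ->.
Qed.

Fact face_partial J i x :
  form_partial i (face J x) = if i \in J then face J (form_partial i x) else 0.
Proof.
apply: formP => s; rewrite formE face_faceE.
case: (boolP (s \subset J)) => sJ; last first.
  by rewrite mderiv0; case: ifP => _; rewrite ?face_faceE ?(negPf sJ) ?form_0E.
rewrite mderiv_face_poly; case: ifP => _; last by rewrite form_0E.
by rewrite face_faceE sJ formE.
Qed.

Fact face_d J x : face J (form_d x) = form_d (face J x).
Proof.
rewrite /form_d raddf_sum; apply: eq_bigr => i _ /=.
rewrite rmorphM /= face_du face_partial; case: ifP => _ //.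
by rewrite mul0r mulr0.
Qed.

Fact face_proj J k x : face J (form_proj k x) = form_proj k (face J x).
Proof.
apply: formP => s; rewrite face_faceE !formE.
by case: ifP => _; case: ifP => // _; rewrite ?raddf0 ?if_same.
Qed.

Fact face_twist J x : face J (form_twist x) = form_twist (face J x).
Proof.
apply: formP => s; rewrite face_faceE [LHS]/= !formE; case: ifP => _; last by rewrite mulr0.
by rewrite rmorphM rmorphXn rmorphN1.
Qed.

Section FaceIdeal.
Variable J : {set 'I_n}.
Local Notation usum := (\sum_(i in J) form_u R i - 1).
Local Notation dusum := (\sum_(i in J) form_du R i).

Fact face_usum : face J usum = usum.
Proof.
rewrite rmorphB rmorph1 raddf_sum; congr (_ - _).
by apply: eq_bigr => i iJ; rewrite /= face_u iJ.
Qed.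

Fact face_dusum : face J dusum = dusum.
Proof. by rewrite raddf_sum; apply: eq_bigr => i iJ; rewrite /= face_du iJ. Qed.

Fact usum_poly : usum = form_poly (\sum_(i in J) 'X_i - 1) :> form.
Proof. by rewrite rmorphB rmorph1 raddf_sum. Qed.

Fact usumC x : usum * x = x * usum :> form.
Proof.
by rewrite usum_poly; apply: formP => s; rewrite [LHS]form_poly_mul
  [RHS]form_mul_poly mulrC.
Qed.

Fact dusumC x : dusum * x = form_twist x * dusum.
Proof.
rewrite mulr_suml mulr_sumr; apply: eq_bigr => i _.
by rewrite form_du_mul form_twistK.
Qed.

Fact d_usum : form_d usum = dusum.
Proof.
rewrite usum_poly /form_d [RHS]big_mkcond /=; apply: eq_bigr => i _.
have -> : form_partial i (form_poly (\sum_(i in J) 'X_i - 1)) =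
          if i \in J then 1 else 0 :> form.
  transitivity (form_poly ((\sum_(i in J) 'X_i - 1)^`M(i)) : form).
    by apply: formP => s; rewrite !formE; case: eqP; rewrite ?mderiv0.
  rewrite mderivB -mpolyC1 mderivC subr0 (raddf_sum (mderiv i)).
  have -> : \sum_(j in J) ('X_j)^`M(i) = (if i \in J then 1 else 0) :> {mpoly R[n]}.
    case: ifP => iJ; last first.
      rewrite big1 // => j jJ; rewrite mderivX mnm1E; case: eqP => [ji|_].
        by rewrite -ji jJ in iJ.
      by rewrite scale0r.
    rewrite (bigD1 i) //= big1 ?addr0 => [|j /andP[_ /negPf ji]].
      by rewrite mderivX mnm1E eqxx scale1r mnm_submm mpolyX0.
    by rewrite mderivX mnm1E ji scale0r.
  by case: ifP; rewrite ?rmorph1 ?raddf0.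
by case: ifP; rewrite ?mulr1 ?mulr0.
Qed.

Fact d_dusum : form_d dusum = 0.
Proof. by rewrite -d_usum form_dd. Qed.

Fact face_ideal0 : face_ideal J 0.
Proof. by exists 0, 0; split; rewrite ?/face_form ?raddf0 // !mul0r addr0. Qed.

Fact face_idealB x y : face_ideal J x -> face_ideal J y -> face_ideal J (x - y).
Proof.
move=> [a [b [ha hb ->]]] [a' [b' [ha' hb' ->]]]; exists (a - a'), (b - b').
split; rewrite /face_form ?raddfB /= ?ha ?ha' ?hb ?hb' //.
by rewrite !mulrBl opprD addrACA.
Qed.

Fact face_idealD x y : face_ideal J x -> face_ideal J y -> face_ideal J (x + y).
Proof.
move=> hx hy; rewrite -[y]opprK; apply: face_idealB => //.
by rewrite -sub0r; apply: face_idealB => //; apply: face_ideal0.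
Qed.

Fact face_ideal_mull a x : face_form J a -> face_ideal J x -> face_ideal J (a * x).
Proof.
move=> ha [b [c [hb hc ->]]]; exists (a * b), (a * c).
by split; rewrite /face_form ?rmorphM /= ?ha ?hb ?hc // mulrDr !mulrA.
Qed.

Fact face_ideal_mulr a x : face_form J a -> face_ideal J x -> face_ideal J (x * a).
Proof.
move=> ha [b [c [hb hc ->]]]; exists (b * a), (c * form_twist a).
split; rewrite /face_form ?rmorphM /= ?face_twist ?ha ?hb ?hc //.
by rewrite mulrDl -!mulrA usumC dusumC.
Qed.

Fact face_ideal_proj k x : face_ideal J x -> face_ideal J (form_proj k x).
Proof.
move=> [b [c [hb hc ->]]]; exists (form_proj k b), (form_proj (k - 1) c).
split; rewrite /face_form ?face_proj ?hb ?hc // form_projD; congr (_ + _).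
  rewrite -[k in LHS]addr0 form_proj_mul // usum_poly; exact: form_proj_poly.
rewrite -[k in LHS](subrK 1) form_proj_mul //.
have pD := @form_projD R n 1.
have p0 : form_proj 1 0 = 0 :> form.
  by apply: formP => s; rewrite formE ?form_0E if_same.
by rewrite (big_morph _ pD p0); apply: eq_bigr => i _; rewrite form_proj_du.
Qed.

Fact face_ideal_d x : face_ideal J x -> face_ideal J (form_d x).
Proof.
move=> [b [c [hb hc ->]]]; exists (form_d b), (form_twist b + form_d c).
split; rewrite /face_form ?raddfD /= ?face_twist ?face_d ?hb ?hc //.
by rewrite form_dD !form_dM d_usum d_dusum mulr0 addr0 mulrDl addrA.
Qed.

End FaceIdeal.

End Faces.

Section OmegaQuotient.
Variables (K : fieldType) (R : comNzRingType) (iota : {rmorphism K -> R}) (n : nat).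

Fact omega_dg_ideal : @dg_ideal K (form_cdga iota n) (@face_ideal R n setT).
Proof.
split.
- exact: face_ideal0.
- exact: face_idealB.
- by move=> a x; apply: face_ideal_mulr; apply: face_formT.
- by move=> a x; apply: face_ideal_mull; apply: face_formT.
- by move=> k x; apply: face_ideal_proj.
- by move=> x; apply: face_ideal_d.
Qed.

(* Polynomial differential forms with coefficients in R on the simplex with
   vertices 'I_n, i.e. the tensor product over K of R and
   K[u_i, du_i]/(sum_i u_i - 1, sum_i du_i). *)
Definition Omega : cdga K := quot_cdga omega_dg_ideal.

Definition Omega_class (x : form R n) : Omega := quot_pi omega_dg_ideal x.

End OmegaQuotient.

Section Ravioli.
Variables (K : fieldType) (N : nat).

(* C(z_1, ..., z_N): all the algebras O(U_<) are subalgebras of it, and the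
   canonical maps between them are inclusions. *)
Definition ratfun : fieldType := {fraction {mpoly K[N]}}.

Definition ratfun_const : {rmorphism K -> ratfun} :=
  @tofrac {mpoly K[N]} \o @mpolyC N K.

Definition incomparable (prec : rel 'I_N) (i j : 'I_N) : bool :=
  [&& i != j, ~~ prec i j & ~~ prec j i].

Definition zdiff (i j : 'I_N) : ratfun := tofrac ('X_i - 'X_j : {mpoly K[N]}).

Definition OU_denominator (prec : rel 'I_N) (e : 'I_N -> 'I_N -> nat) : ratfun :=
  \prod_i \prod_(j | incomparable prec i j) zdiff i j ^+ e i j.

(* O(U_<) for a strict partial order <: the localization of C[z_1, ..., z_N] at
   the differences z_i - z_j of incomparable i != j. *)
Definition OU (prec : rel 'I_N) : {pred ratfun} := fun x =>
  `[< exists (p : {mpoly K[N]}) (e : 'I_N -> 'I_N -> nat),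
        x = tofrac p / OU_denominator prec e >].

(* sigma(1) < sigma(2) < ... < sigma(N) *)
Definition order_of_perm (sigma : 'S_N) : rel 'I_N :=
  fun i j => ((sigma^-1)%g i < (sigma^-1)%g j)%N.

Definition meet_order (S : {set 'S_N}) : rel 'I_N :=
  fun i j => [forall sigma in S, order_of_perm sigma i j].

Definition B_alg : {pred ratfun} := OU (fun _ _ => false).

Fact zdiff_neq0 i j : i != j -> zdiff i j != 0.
Proof.
move=> ij; rewrite /zdiff tofrac_eq0 subr_eq0; apply: contra ij => /eqP h.
have := congr1 (fun p => p@_U_(i)%MM) h; rewrite /= !mcoeffX eqxx.
case: (U_(j)%MM =P U_(i)%MM) => [/(congr1 (fun m : 'X_{1..N} => m i))|_].
  by rewrite !mnm1E eqxx eq_sym; case: eqP.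
by move/eqP; rewrite oner_eq0.
Qed.

Fact OU_denominator_neq0 prec e : OU_denominator prec e != 0.
Proof.
apply/prodf_neq0 => i _; apply/prodf_neq0 => j /and3P[ij _ _].
by rewrite expf_neq0 // zdiff_neq0.
Qed.

Fact OU_denominatorD prec e e' :
  OU_denominator prec (fun i j => e i j + e' i j)%N =
  OU_denominator prec e * OU_denominator prec e'.
Proof.
rewrite -big_split; apply: eq_bigr => i _; rewrite -big_split.
by apply: eq_bigr => j _; rewrite exprD.
Qed.

Fact OU_denominator_poly prec e : exists q, OU_denominator prec e = tofrac q.
Proof.
exists (\prod_i \prod_(j | incomparable prec i j) ('X_i - 'X_j) ^+ e i j).
rewrite rmorph_prod; apply: eq_bigr => i _; rewrite rmorph_prod.
by apply: eq_bigr => j _; rewrite rmorphXn.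
Qed.

Fact OU_poly prec p : tofrac p \in OU prec.
Proof.
apply/asboolP; exists p, (fun _ _ => 0%N); rewrite /OU_denominator.
by rewrite big1 ?divr1 // => i _; rewrite big1.
Qed.

Fact OU_subring prec : subring_closed (OU prec).
Proof.
split.
- by rewrite -(rmorph1 (@tofrac {mpoly K[N]})); apply: OU_poly.
- move=> x y /asboolP[p [e ->]] /asboolP[q [f ->]]; apply/asboolP.
  have [pe he] := OU_denominator_poly prec e.
  have [pf hf] := OU_denominator_poly prec f.
  exists (p * pf - q * pe), (fun i j => e i j + f i j)%N.
  rewrite OU_denominatorD rmorphB !rmorphM /= -he -hf.
  by rewrite -[X in _ + X = _]mulNr addf_div ?OU_denominator_neq0 // mulNr.
- move=> x y /asboolP[p [e ->]] /asboolP[q [f ->]]; apply/asboolP.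
  exists (p * q), (fun i j => e i j + f i j)%N.
  by rewrite OU_denominatorD rmorphM /= invfM mulrACA.
Qed.

HB.instance Definition _ prec :=
  GRing.isSubringClosed.Build ratfun (OU prec) (OU_subring prec).

Fact meet_orderS (S T : {set 'S_N}) i j :
  S \subset T -> meet_order T i j -> meet_order S i j.
Proof.
move=> ST /forall_inP h; apply/forall_inP => sigma sS.
by apply: h; apply: (subsetP ST).
Qed.

Fact OU_refine (prec prec' : rel 'I_N) : (forall i j, prec i j -> prec' i j) ->
  {subset OU prec' <= OU prec}.
Proof.
move=> h x /asboolP[p [e ->]]; apply/asboolP.
exists p, (fun i j => if incomparable prec' i j then e i j else 0%N).
congr (_ / _); apply: eq_bigr => i _.
rewrite big_mkcond [RHS]big_mkcond /=; apply: eq_bigr => j _.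
case: (boolP (incomparable prec' i j)) => [/and3P[ij h1 h2]|_]; last first.
  by rewrite expr0 if_same.
rewrite /incomparable ij /=.
by rewrite (contra (h i j) h1) (contra (h j i) h2).
Qed.

Definition form_over (O : {pred ratfun}) n (x : form ratfun n) : Prop :=
  forall s, x s \is a mpolyOver n O.

Section FormOver.
Variables (O : subringClosed ratfun) (n : nat).
Implicit Types x y : form ratfun n.

Fact form_overB x y : form_over O x -> form_over O y -> form_over O (x - y).
Proof. by move=> hx hy s; rewrite form_addE form_oppE rpredB. Qed.

Fact form_over_sum (I : finType) (F : I -> form ratfun n) :
  (forall i, form_over O (F i)) -> form_over O (\sum_i F i).
Proof. by move=> h s; rewrite form_sumE rpred_sum // => i _; apply: h. Qed.

Fact form_overM x y : form_over O x -> form_over O y -> form_over O (x * y).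
Proof.
move=> hx hy w; rewrite form_mulrE; apply: rpred_sum => s _.
apply: rpred_sum => t _; rewrite rpredM ?rpredM //.
by rewrite /wedge_sign; case: ifP => _; rewrite ?rpred0 ?rpredX ?rpredN ?rpred1.
Qed.

Fact form_over_poly p : p \is a mpolyOver n O -> form_over O (form_poly p).
Proof. by move=> hp s; rewrite formE; case: ifP => _; rewrite ?rpred0. Qed.

Fact form_over_du i : form_over O (form_du ratfun i : form ratfun n).
Proof.
by move=> s; rewrite formE; case: ifP => _; [exact: rpred1|exact: rpred0].
Qed.

Fact form_over_proj k x : form_over O x -> form_over O (form_proj k x).
Proof. by move=> hx s; rewrite formE; case: ifP => _; rewrite ?rpred0. Qed.

Fact form_over_d x : form_over O x -> form_over O (form_d x).
Proof.
move=> hx; apply: form_over_sum => i; apply: form_overM; first exact: form_over_du.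
move=> s; rewrite formE; apply/mpolyOverP => m; rewrite mcoeff_mderiv.
by rewrite rpredMn //; apply/mpolyOverP.
Qed.

End FormOver.

(* The simplex with vertex set S_N; sigma is its vertex number
   enum_rank sigma. *)
Definition nperm : nat := #|{: 'S_N}|.

Definition vertices (S : {set 'S_N}) : {set 'I_nperm} := enum_rank @: S.

Definition Omega_SN : cdga K := Omega ratfun_const nperm.

(* The restriction of omega to {u_sigma = 0, sigma \notin S} lies in
   O(U_(meet S)) (x) Omega_S, for x a form representing omega. *)
Definition face_condition (x : form ratfun nperm) (S : {set 'S_N}) : Prop :=
  exists eta : form ratfun nperm,
    [/\ face_form (vertices S) eta, form_over (OU (meet_order S)) eta &
        face_ideal (vertices S) (face (vertices S) x - eta)].

(* omega lies in B_N (x) Omega_{S_N} and satisfies all face conditions.  The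
   condition on a face S depends on x only modulo the ideal, hence on omega. *)
Definition A_mem (omega : Omega_SN) : Prop :=
  exists x : form ratfun nperm,
    [/\ Omega_class ratfun_const x = omega, form_over B_alg x &
        forall S : {set 'S_N}, S != set0 -> face_condition x S].

Fact A_dg_subalgebra : dg_subalgebra A_mem.
Proof.
have overC (O : subringClosed ratfun) c :
    (forall p, tofrac p \in O) -> form_over O (form_unit ratfun_const nperm c).
  move=> hO; apply: form_over_poly; rewrite mpolyOverC; exact: hO.
split.
- move=> c; exists (form_unit ratfun_const nperm c); split => //.
    by apply: overC; apply: OU_poly.
  move=> S _; exists (form_unit ratfun_const nperm c); split.
  + by rewrite /face_form /= face_polyform face_polyC.
  + by apply: overC; apply: OU_poly.
  + by rewrite /= face_polyform face_polyC subrr; apply: face_ideal0.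
- move=> _ _ [x [<- Bx hx]] [y [<- By hy]]; exists (x - y); split.
  + exact: raddfB.
  + exact: form_overB.
  + move=> S S0; have [a [a1 a2 a3]] := hx S S0; have [b [b1 b2 b3]] := hy S S0.
    exists (a - b); split.
    * by rewrite /face_form raddfB /= a1 b1.
    * exact: form_overB.
    * rewrite raddfB /=.
      have -> : face (vertices S) x - face (vertices S) y - (a - b) =
        (face (vertices S) x - a) - (face (vertices S) y - b).
        by rewrite !opprD addrACA.
      exact: face_idealB.
- move=> _ _ [x [<- Bx hx]] [y [<- By hy]]; exists (x * y); split.
  + exact: (rmorphM (quot_pi _)).
  + exact: form_overM.
  + move=> S S0; have [a [a1 a2 a3]] := hx S S0; have [b [b1 b2 b3]] := hy S S0.
    exists (a * b); split.
    * by rewrite /face_form rmorphM /= a1 b1.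
    * exact: form_overM.
    * rewrite rmorphM /=.
      have -> : face (vertices S) x * face (vertices S) y - a * b =
        (face (vertices S) x - a) * face (vertices S) y +
        a * (face (vertices S) y - b).
        by rewrite mulrBl mulrBr addrA subrK.
      exact: face_idealD (face_ideal_mulr (face_formP _ _) a3)
                         (face_ideal_mull a1 b3).
- move=> k _ [x [<- Bx hx]]; exists (form_proj k x); split.
  + exact/esym/(quot_projE (omega_dg_ideal ratfun_const nperm)).
  + exact: form_over_proj.
  + move=> S S0; have [a [a1 a2 a3]] := hx S S0; exists (form_proj k a); split.
    * by rewrite /face_form face_proj a1.
    * exact: form_over_proj.
    * have := face_ideal_proj k a3.
      rewrite -[form_proj _ _]/(cdga_proj (form_cdga ratfun_const nperm) k _).
      by rewrite cdga_projB /= face_proj.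
- move=> _ [x [<- Bx hx]]; exists (form_d x); split.
  + exact/esym/(quot_dE (omega_dg_ideal ratfun_const nperm)).
  + exact: form_over_d.
  + move=> S S0; have [a [a1 a2 a3]] := hx S S0; exists (form_d a); split.
    * by rewrite /face_form face_d a1.
    * exact: form_over_d.
    * have := face_ideal_d a3.
      rewrite -[form_d _]/(cdga_d (form_cdga ratfun_const nperm) _).
      by rewrite cdga_dB /= face_d.
Qed.

Definition A_alg : cdga K := sub_cdga A_dg_subalgebra.

Section Cech.
Variable le : rel 'S_N.

(* The indices sigma_0 < ... < sigma_n of the Cech nerve of the cover
   {U_sigma}, for the total order le on S_N. *)
Definition is_chain n (tau : {ffun 'I_n.+1 -> 'S_N}) : bool :=
  [forall i : 'I_n.+1, forall j : 'I_n.+1, (i < j)%N ==>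
     le (tau i) (tau j) && (tau i != tau j)].

Definition chain n := {tau : {ffun 'I_n.+1 -> 'S_N} | is_chain tau}.

Definition chain_set n (tau : chain n) : {set 'S_N} := [set val tau i | i in 'I_n.+1].

Definition chain_const n (c : K) : {ffun chain n -> ratfun} := [ffun=> ratfun_const c].

Fact chain_constB n : zmod_morphism (@chain_const n).
Proof. by move=> c d; apply/ffunP => tau; rewrite !ffunE rmorphB. Qed.

Fact chain_constM n : monoid_morphism (@chain_const n).
Proof.
by split=> [|c d]; apply/ffunP => tau; rewrite !ffunE ?rmorph1 ?rmorphM.
Qed.

HB.instance Definition _ n := GRing.isZmodMorphism.Build
  K {ffun chain n -> ratfun} (@chain_const n) (@chain_constB n).
HB.instance Definition _ n := GRing.isMonoidMorphism.Build
  K {ffun chain n -> ratfun} (@chain_const n) (@chain_constM n).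

Fact chain_mulC n : commutative (@GRing.mul {ffun chain n -> ratfun}).
Proof. by move=> f g; apply/ffunP => tau; rewrite !ffunE mulrC. Qed.

Definition chain_cdga n : cdga K := disc_cdga (@chain_const n) (@chain_mulC n).

Definition cech_mem n (f : chain_cdga n) : Prop :=
  forall tau : chain n,
    (f : {ffun chain n -> ratfun}) tau \in OU (meet_order (chain_set tau)).

Fact cech_dg_subalgebra n : dg_subalgebra (@cech_mem n).
Proof.
split.
- by move=> c tau; rewrite ffunE; apply: OU_poly.
- by move=> f g hf hg tau; rewrite !ffunE rpredB.
- by move=> f g hf hg tau; rewrite ffunE rpredM.
- move=> k f hf tau; rewrite /= /disc_proj.
  by case: ifP => _; rewrite ?ffunE ?rpred0.
- by move=> f hf tau; rewrite ffunE rpred0.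
Qed.

(* The product over sigma_0 < ... < sigma_n of
   O(U_sigma_0 \cap ... \cap U_sigma_n), in degree 0. *)
Definition cech_obj n : cdga K := sub_cdga (@cech_dg_subalgebra n).

Fact chain_face_proof m n (t : dinj m n) (tau : chain n) :
  is_chain [ffun i => val tau (t i)].
Proof.
apply/forallP => i; apply/forallP => j; apply/implyP => ij; rewrite !ffunE.
have /forallP/(_ (t i))/forallP/(_ (t j))/implyP := valP tau.
by apply; apply: dinj_mono.
Qed.

Definition chain_face m n (t : dinj m n) (tau : chain n) : chain m :=
  Sub [ffun i => val tau (t i)] (chain_face_proof t tau).

Definition cech_pullback m n (t : dinj m n) (f : chain_cdga m) : chain_cdga n :=
  [ffun tau => (f : {ffun chain m -> ratfun}) (chain_face t tau)].

Fact cech_pullbackP m n (t : dinj m n) f : cech_mem f -> cech_mem (cech_pullback t f).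
Proof.
move=> hf tau; rewrite ffunE.
have := hf (chain_face t tau); apply: OU_refine => i j; apply: meet_orderS.
apply/subsetP => s /imsetP[k _ ->]; rewrite ffunE; exact: imset_f.
Qed.

Definition cech_map_fun m n (t : dinj m n) (f : cech_obj m) : cech_obj n :=
  sub_in (cech_dg_subalgebra n) (cech_pullbackP t (sub_valP f)).

Fact cech_map_zmod m n (t : dinj m n) : zmod_morphism (cech_map_fun t).
Proof. by move=> f g; apply: val_inj; apply/ffunP => tau; rewrite !ffunE. Qed.

Fact cech_map_monoid m n (t : dinj m n) : monoid_morphism (cech_map_fun t).
Proof.
by split=> [|f g]; apply: val_inj; apply/ffunP => tau; rewrite !ffunE.
Qed.

HB.instance Definition _ m n t := GRing.isZmodMorphism.Build
  (cech_obj m) (cech_obj n) (cech_map_fun t) (@cech_map_zmod m n t).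
HB.instance Definition _ m n t := GRing.isMonoidMorphism.Build
  (cech_obj m) (cech_obj n) (cech_map_fun t) (@cech_map_monoid m n t).

Definition cech_map m n (t : dinj m n) : cdga_hom (cech_obj m) (cech_obj n).
Proof.
refine (@CdgaHom K (cech_obj m) (cech_obj n) (cech_map_fun t) _ _ _).
- by move=> c; apply: val_inj; apply/ffunP => tau; rewrite !ffunE.
- move=> k f; apply: val_inj; apply/ffunP => tau; rewrite /= /disc_proj.
  by case: ifP => _; rewrite !ffunE.
- by move=> f; apply: val_inj; apply/ffunP => tau; rewrite !ffunE.
Defined.

Definition cech : semicosimplicial K.
Proof.
refine (@SemiCosimplicial K cech_obj cech_map _ _).
- move=> n f; apply: val_inj; apply/ffunP => tau; rewrite !ffunE.
  by congr (val f _); apply: val_inj; apply/ffunP => i; rewrite ffunE.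
- move=> m n p g h f; apply: val_inj; apply/ffunP => tau; rewrite !ffunE.
  by congr (val f _); apply: val_inj; apply/ffunP => i; rewrite !ffunE.
Defined.

(* G is a model of RGamma(RavConf_N, O): a homotopy limit of the
   semicosimplicial algebra Gamma(Cech(U), O), for the affine (hence Leray)
   cover U = {U_sigma} of RavConf_N.  In RavConf_N the intersection of the
   U_sigma, sigma \in S, is U_(meet S); the structure sheaf of the scheme enters
   only through the algebras O(U_(meet S)) and the inclusions between them. *)
Definition is_RGamma_RavConf (G : cdga K) : Prop := is_holim cech G.

End Cech.

End Ravioli.

(* Main.v *)
(* For a set S of permutations write O(S) for O(U_(meet S)), and St(S) for the
   forms satisfying the face conditions for all nonempty T containing S, i.e.
   forms on the closed star of the face S.  Both are covariant in S.
   - O(S) -> St(S) is a quasi-isomorphism for nonempty S: every face containing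
     S is preserved by the contraction of the simplex to a vertex of S.
   - A_N is St(set0), the limit of St over nonempty sets.  As u_sigma vanishes on
     the faces not containing sigma, it maps St(sigma |: S) to St(S); with this
     partition of unity the Cech complex of St is exact, so A_N computes the
     derived limit.
   - Adjoining free contractible generators, by descending induction on the size
     of S, replaces St by a functor Y with Y(S) -> lim_(T > S) Y(T) surjective.
     The Cech complex of Y is exact as well, and descending induction on the
     degree shows that cocycles of St and Y are quasi-isomorphic; in degree 0
     this gives A_N -> lim Y.
   - The products of the Y(S) over chains form an injectively fibrant
     semicosimplicial algebra: they vanish in high degree, so that lifts can be
     built by descending induction, one matching map at a time. *)
Require Import Defs.
From HB Require Import structures.
From mathcomp Require Import all_boot all_order all_algebra all_fingroup.
From mathcomp Require Import complex reals.
From mathcomp Require Import generic_quotient mpoly boolp zify.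

Set Implicit Arguments.
Unset Strict Implicit.
Unset Printing Implicit Defensive.

Import GRing.Theory.
Local Open Scope ring_scope.

(** * Graded algebras *)

(** Two obstacles shape the proof. A lift into a semicosimplicial algebra must respect maps that all
    raise the degree, so the component at S is constrained by those at larger sets; it exists when
    the value at S maps onto the limit over larger sets. St fails this in general, since that limit
    forgets the condition on the face S itself; hence Y. But adjoining generators destroys the
    partition of unity, so exactness for Y needs an argument of its own, resting on surjectivity
    alone. Cofibrations are known only by their lifting property, without any cell structure, so
    lifts against arbitrary surjections have to come from a retract argument. Division by weights,
    the essential use of characteristic 0, serves both there and in the Poincare lemma. Forms on the
    simplex are classes modulo an inhomogeneous ideal. The contraction acts on representatives and
    must preserve this ideal, which is why a vertex is first moved to the origin. The empty set is
    kept among the indices: its value augments the Cech complex, so that the limit is reached as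
    cocycles of lowest degree, by elementary diagram chases. *)

Section CdgaBasics.
Variables (K : fieldType) (A : cdga K).
Implicit Types x y : A.

HB.instance Definition _ n :=
  GRing.isZmodMorphism.Build A A (cdga_proj A n) (@cdga_projB K A n).
HB.instance Definition _ :=
  GRing.isZmodMorphism.Build A A (cdga_d A) (@cdga_dB K A).

(** The list only bounds the degrees and may be too long, so that bounds can be computed through
    sums, products and [cdga_d]. They give the finite decompositions required of products and free
    extensions. *)
Definition supported x (s : seq int) : Prop :=
  forall n, n \notin s -> cdga_proj A n x = 0.

Lemma cdga_proj_ext x y :
  (forall n, cdga_proj A n x = cdga_proj A n y) -> x = y.
Proof.
move=> h; apply/eqP; rewrite -subr_eq0; apply/eqP.
have [s _ ->] := cdga_proj_sum (x - y).
by rewrite big1 // => n _; rewrite raddfB /= h subrr.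
Qed.

Lemma proj_big_proj n x s : uniq s ->
  cdga_proj A n (\sum_(m <- s) cdga_proj A m x) =
  if n \in s then cdga_proj A n x else 0.
Proof.
move=> us; rewrite raddf_sum /=; case: ifP => ns.
  rewrite (bigD1_seq n) //= cdga_proj_id big1 ?addr0 // => m mn.
  by rewrite cdga_proj_proj eq_sym (negPf mn).
rewrite big1_seq // => m /andP[_ ms]; rewrite cdga_proj_proj.
by case: eqP => // nm; rewrite nm ms in ns.
Qed.

Lemma supported_sum x s : uniq s -> supported x s ->
  x = \sum_(n <- s) cdga_proj A n x.
Proof.
move=> us xs; apply: cdga_proj_ext => n; rewrite proj_big_proj //.
by case: (boolP (n \in s)) => // /xs.
Qed.

Lemma supported_ex x : exists s, supported x s.
Proof.
have [s us xE] := cdga_proj_sum x; exists s => n ns.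
by rewrite xE proj_big_proj // (negPf ns).
Qed.

Lemma homog_ind (P : A -> Prop) :
  P 0 -> (forall x y, P x -> P y -> P (x + y)) ->
  (forall n x, cdga_proj A n x = x -> P x) -> forall x, P x.
Proof.
move=> P0 PD Ph x; have [s _ ->] := cdga_proj_sum x.
by apply: big_ind => // n _; apply: (Ph n); rewrite cdga_proj_id.
Qed.

Lemma supportedD x y s t : supported x s -> supported y t ->
  supported (x + y) (s ++ t).
Proof.
move=> xs yt n; rewrite mem_cat negb_or => /andP[/xs hx /yt hy].
by rewrite raddfD /= hx hy addr0.
Qed.

Lemma supportedN x s : supported x s -> supported (- x) s.
Proof. by move=> xs n /xs hx; rewrite raddfN /= hx oppr0. Qed.

Lemma supportedM x y s t : supported x s -> supported y t ->
  supported (x * y) [seq m + n | m <- s, n <- t].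
Proof.
move=> xs yt.
have us := undup_uniq s; have ut := undup_uniq t.
have -> : x = \sum_(m <- undup s) cdga_proj A m x.
  by apply: supported_sum => // m; rewrite mem_undup => /xs.
have -> : y = \sum_(m <- undup t) cdga_proj A m y.
  by apply: supported_sum => // m; rewrite mem_undup => /yt.
move=> n nst; rewrite mulr_suml raddf_sum big1_seq //= => a.
rewrite mem_undup => /= as_; rewrite mulr_sumr raddf_sum big1_seq //= => b.
rewrite mem_undup => /= bt.
rewrite -(cdga_mul_deg (cdga_proj_id a x) (cdga_proj_id b y)) cdga_proj_proj.
case: eqP => // nE; case/negP: nst; rewrite nE.
by apply/allpairsP; exists (a, b).
Qed.

Lemma supported_proj x s n : supported x s -> supported (cdga_proj A n x) s.
Proof. by move=> xs m /xs hm; rewrite cdga_proj_proj; case: eqP => [<-|]. Qed.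

Lemma cdga_proj_d n x : cdga_proj A (n + 1) (cdga_d A x) = cdga_d A (cdga_proj A n x).
Proof.
elim/homog_ind: x => [|x y hx hy|m x xm].
- by rewrite !raddf0.
- by rewrite !raddfD /= hx hy.
- have [->|/negPf nm] := eqVneq n m; first by rewrite xm (cdga_d_deg xm).
  rewrite -(cdga_d_deg xm) cdga_proj_proj (inj_eq (addIr 1)) nm.
  by rewrite -xm cdga_proj_proj nm raddf0.
Qed.

Lemma supported_d x s : supported x s -> supported (cdga_d A x) [seq n + 1 | n <- s].
Proof.
move=> xs n ns; rewrite -(subrK 1 n) cdga_proj_d xs ?raddf0 //.
by apply: contra ns => h; apply/mapP; exists (n - 1); rewrite ?subrK.
Qed.

Lemma cdga_dZ c x : cdga_d A (cdga_unit A c * x) = cdga_unit A c * cdga_d A x.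
Proof.
rewrite (cdga_dM _ (cdga_unit_deg A c)) cdga_d_unit mul0r add0r.
by rewrite expr0 mul1r.
Qed.

Lemma cdga_proj1 : cdga_proj A 0 1 = 1.
Proof. by rewrite -(rmorph1 (cdga_unit A)) cdga_unit_deg. Qed.

Lemma sign_comm n x : (-1) ^+ n * x = x * (-1) ^+ n.
Proof. exact/esym/commr_sign. Qed.

(** The grading involution absorbs the sign of the Leibniz rule, so that [cdga_dMt] holds for all
    elements and not only for homogeneous ones. *)
Fact twist_subproof x : {y | forall n, cdga_proj A n y = (-1) ^+ absz n * cdga_proj A n x}.
Proof.
apply: cid; have [s us xE] := cdga_proj_sum x.
exists (\sum_(m <- s) (-1) ^+ absz m * cdga_proj A m x) => n.
have signP k z m : cdga_proj A m ((-1) ^+ k * z) = (-1) ^+ k * cdga_proj A m z.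
  by rewrite -signr_odd; case: odd; rewrite ?expr1 ?expr0 ?mulN1r ?mul1r ?raddfN.
rewrite {2}xE proj_big_proj // raddf_sum /=; case: ifP => ns.
  rewrite (bigD1_seq n) //= signP cdga_proj_id big1 ?addr0 // => m mn.
  by rewrite signP cdga_proj_proj eq_sym (negPf mn) mulr0.
rewrite mulr0 big1_seq // => m /andP[_ ms]; rewrite signP cdga_proj_proj.
by case: eqP => [nm|_]; rewrite ?mulr0 //; rewrite nm ms in ns.
Qed.

Definition twist x : A := sval (twist_subproof x).

Lemma proj_twist n x : cdga_proj A n (twist x) = (-1) ^+ absz n * cdga_proj A n x.
Proof. exact: (svalP (twist_subproof x)). Qed.

Lemma proj_sign n k x : cdga_proj A n ((-1) ^+ k * x) = (-1) ^+ k * cdga_proj A n x.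
Proof.
by rewrite -signr_odd; case: odd; rewrite ?expr1 ?expr0 ?mulN1r ?mul1r ?raddfN.
Qed.

Lemma d_sign k x : cdga_d A ((-1) ^+ k * x) = (-1) ^+ k * cdga_d A x.
Proof.
by rewrite -signr_odd; case: odd; rewrite ?expr1 ?expr0 ?mulN1r ?mul1r ?raddfN.
Qed.

Lemma twist_homog n x : cdga_proj A n x = x -> twist x = (-1) ^+ absz n * x.
Proof.
move=> xn; apply: cdga_proj_ext => m; rewrite proj_twist proj_sign -xn.
by rewrite cdga_proj_proj; case: eqP => [->|]; rewrite ?mulr0.
Qed.

Lemma twistD x y : twist (x + y) = twist x + twist y.
Proof.
by apply: cdga_proj_ext => n; rewrite raddfD /= !proj_twist raddfD mulrDr.
Qed.

Lemma twist0 : twist 0 = 0.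
Proof. by apply: cdga_proj_ext => n; rewrite proj_twist !raddf0 mulr0. Qed.

Lemma twist1 : twist 1 = 1.
Proof. by rewrite (twist_homog cdga_proj1) expr0 mul1r. Qed.

Lemma sign_absD (m n : int) : (-1) ^+ absz (m + n) = (-1) ^+ absz m * (-1) ^+ absz n :> A.
Proof.
rewrite -exprD -signr_odd -[RHS]signr_odd; congr (_ ^+ _); congr nat_of_bool.
by rewrite oddD; case: m n => [m|m] [n|n]; lia.
Qed.

Lemma twistM x y : twist (x * y) = twist x * twist y.
Proof.
elim/homog_ind: x => [|x x' hx hx'|m x xm].
- by rewrite mul0r twist0 mul0r.
- by rewrite mulrDl !twistD mulrDl hx hx'.
elim/homog_ind: y => [|y y' hy hy'|n y yn].
- by rewrite mulr0 twist0 mulr0.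
- by rewrite mulrDr !twistD mulrDr hy hy'.
rewrite (twist_homog xm) (twist_homog yn) (twist_homog (cdga_mul_deg xm yn)).
by rewrite sign_absD -!mulrA; congr (_ * _); rewrite !mulrA (sign_comm _ x).
Qed.

Lemma twist_d x : twist (cdga_d A x) = - cdga_d A (twist x).
Proof.
elim/homog_ind: x => [|x x' hx hx'|m x xm].
- by rewrite raddf0 !twist0 raddf0 oppr0.
- by rewrite raddfD !twistD hx hx' raddfD opprD.
- rewrite (twist_homog (cdga_d_deg xm)) (twist_homog xm) d_sign sign_absD.
  by rewrite expr1 mulrN1 mulNr.
Qed.

Lemma cdga_dMt x y : cdga_d A (x * y) = cdga_d A x * y + twist x * cdga_d A y.
Proof.
elim/homog_ind: x => [|x x' hx hx'|m x xm].
- by rewrite mul0r raddf0 twist0 !mul0r addr0.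
- by rewrite mulrDl !raddfD twistD /= hx hx' !mulrDl addrACA.
- by rewrite (cdga_dM _ xm) (twist_homog xm) mulrA.
Qed.

End CdgaBasics.

Section Homs.
Variable K : fieldType.

Definition mk_hom (A B : cdga K) (f : A -> B) (fB : zmod_morphism f)
    (fM : monoid_morphism f)
    (fu : forall c, f (cdga_unit A c) = cdga_unit B c)
    (fp : forall n x, f (cdga_proj A n x) = cdga_proj B n (f x))
    (fd : forall x, f (cdga_d A x) = cdga_d B (f x)) : cdga_hom A B :=
  let fr : {rmorphism A -> B} :=
    HB.pack_for {rmorphism A -> B} f (GRing.isZmodMorphism.Build A B f fB)
      (GRing.isMonoidMorphism.Build A B f fM) in
  @CdgaHom K A B fr fu fp fd.

Definition hom_id (A : cdga K) : cdga_hom A A :=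
  @CdgaHom K A A idfun (fun=> erefl) (fun _ _ => erefl) (fun=> erefl).

Definition hom_comp (A B C : cdga K) (g : cdga_hom B C) (f : cdga_hom A B) :
  cdga_hom A C.
Proof.
refine (@CdgaHom K A C (g \o f) _ _ _) => [c|n x|x] /=.
- by rewrite !cdga_hom_unit.
- by rewrite !cdga_hom_proj.
- by rewrite !cdga_hom_d.
Defined.

End Homs.

(** * Finite products and subalgebras *)

Section Product.
Variables (K : fieldType) (I : finType) (X : I -> cdga K).

Definition dprod := forall i, X i.
Implicit Types x y : dprod.

HB.instance Definition _ := gen_eqMixin dprod.
HB.instance Definition _ := gen_choiceMixin dprod.

Fact dprod_ext x y : (forall i, x i = y i) -> x = y.
Proof. exact: functional_extensionality_dep. Qed.

Definition dprod_add x y : dprod := fun i => x i + y i.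
Definition dprod_opp x : dprod := fun i => - x i.
Definition dprod_zero : dprod := fun i => 0.
Definition dprod_one : dprod := fun i => 1.
Definition dprod_mul x y : dprod := fun i => x i * y i.

Fact dprod_addA : associative dprod_add.
Proof. by move=> x y z; apply: dprod_ext => i; apply: addrA. Qed.
Fact dprod_addC : commutative dprod_add.
Proof. by move=> x y; apply: dprod_ext => i; apply: addrC. Qed.
Fact dprod_add0 : left_id dprod_zero dprod_add.
Proof. by move=> x; apply: dprod_ext => i; apply: add0r. Qed.
Fact dprod_addN : left_inverse dprod_zero dprod_opp dprod_add.
Proof. by move=> x; apply: dprod_ext => i; apply: addNr. Qed.
HB.instance Definition _ := GRing.isZmodule.Build dprod
  dprod_addA dprod_addC dprod_add0 dprod_addN.

Fact dprod_mulA : associative dprod_mul.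
Proof. by move=> x y z; apply: dprod_ext => i; apply: mulrA. Qed.
Fact dprod_mul1 : left_id dprod_one dprod_mul.
Proof. by move=> x; apply: dprod_ext => i; apply: mul1r. Qed.
Fact dprod_mulr1 : right_id dprod_one dprod_mul.
Proof. by move=> x; apply: dprod_ext => i; apply: mulr1. Qed.
Fact dprod_mulDl : left_distributive dprod_mul +%R.
Proof. by move=> x y z; apply: dprod_ext => i; apply: mulrDl. Qed.
Fact dprod_mulDr : right_distributive dprod_mul +%R.
Proof. by move=> x y z; apply: dprod_ext => i; apply: mulrDr. Qed.
HB.instance Definition _ := GRing.Zmodule_isPzRing.Build dprod
  dprod_mulA dprod_mul1 dprod_mulr1 dprod_mulDl dprod_mulDr.

Definition dprod_unit (c : K) : dprod := fun i => cdga_unit (X i) c.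
Fact dprod_unitB : zmod_morphism dprod_unit.
Proof. by move=> a b; apply: dprod_ext => i; apply: rmorphB. Qed.
Fact dprod_unitM : monoid_morphism dprod_unit.
Proof.
split=> [|a b]; apply: dprod_ext => i; first exact: rmorph1.
exact: rmorphM.
Qed.
HB.instance Definition _ := GRing.isZmodMorphism.Build K dprod dprod_unit dprod_unitB.
HB.instance Definition _ := GRing.isMonoidMorphism.Build K dprod dprod_unit dprod_unitM.

Definition dprod_proj n x : dprod := fun i => cdga_proj (X i) n (x i).
Definition dprod_d x : dprod := fun i => cdga_d (X i) (x i).

Fact dprod_sumE (T : Type) (r : seq T) (F : T -> dprod) i :
  (\sum_(j <- r) F j) i = \sum_(j <- r) F j i.
Proof. by elim: r => [|j r IH]; rewrite ?big_nil // !big_cons -IH. Qed.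

Fact dprod_signE k x i : ((-1) ^+ k * x) i = (-1) ^+ k * x i.
Proof.
by rewrite -signr_odd -[in RHS]signr_odd; case: odd; rewrite ?expr1 ?expr0 ?mulN1r ?mul1r.
Qed.

Definition prod_cdga : cdga K.
Proof.
refine (@Cdga K dprod dprod_unit dprod_proj dprod_d _ _ _ _ _ _ _ _ _ _ _).
- by move=> n x y; apply: dprod_ext => i; apply: cdga_projD.
- move=> m n x; apply: dprod_ext => i; rewrite /dprod_proj cdga_proj_proj.
  by case: eqP.
(* Finiteness of [I] matters here: the lists of degrees of the components are merged into one. *)
- move=> x; pose s i := sval (cid (supported_ex (x i))).
  exists (undup (flatten [seq s i | i <- enum I])); first exact: undup_uniq.
  apply: dprod_ext => i; rewrite dprod_sumE /dprod_proj.
  apply: supported_sum; first exact: undup_uniq.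
  move=> n; rewrite mem_undup => ns.
  apply: (svalP (cid (supported_ex (x i)))); apply: contra ns => ns.
  by apply/flattenP; exists (s i) => //; apply: map_f; rewrite mem_enum.
- by move=> c; apply: dprod_ext => i; apply: cdga_unit_deg.
- move=> m n x y hx hy; apply: dprod_ext => i.
  by apply: cdga_mul_deg; [have := congr1 (@^~ i) hx|have := congr1 (@^~ i) hy].
- move=> m n x y hx hy; apply: dprod_ext => i; rewrite dprod_signE.
  by apply: cdga_mulC; [have := congr1 (@^~ i) hx|have := congr1 (@^~ i) hy].
- by move=> x y; apply: dprod_ext => i; apply: cdga_dD.
- by move=> c; apply: dprod_ext => i; apply: cdga_d_unit.
- move=> n x hx; apply: dprod_ext => i.
  by apply: cdga_d_deg; have := congr1 (@^~ i) hx.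
- move=> m x y hx; apply: dprod_ext => i.
  rewrite [RHS](_ : _ = cdga_d (X i) (x i) * y i + ((-1) ^+ absz m * (x * dprod_d y)) i) //.
  by rewrite dprod_signE; apply: cdga_dM; have := congr1 (@^~ i) hx.
- by move=> x; apply: dprod_ext => i; apply: cdga_dd.
Defined.

Definition prod_pr i : cdga_hom prod_cdga (X i).
Proof.
by apply: (@mk_hom K prod_cdga (X i) (fun x => x i)).
Defined.

Definition prod_pair (B : cdga K) (f : forall i, cdga_hom B (X i)) :
  cdga_hom B prod_cdga.
Proof.
apply: (@mk_hom K B prod_cdga (fun b i => f i b)).
- by move=> x y; apply: dprod_ext => i; apply: rmorphB.
- split=> [|x y]; apply: dprod_ext => i; first exact: rmorph1.
  exact: rmorphM.
- by move=> c; apply: dprod_ext => i; apply: cdga_hom_unit.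
- by move=> n x; apply: dprod_ext => i; apply: cdga_hom_proj.
- by move=> x; apply: dprod_ext => i; apply: cdga_hom_d.
Defined.

End Product.

Section SubHoms.
Variables (K : fieldType) (A : cdga K) (P : A -> Prop) (hP : dg_subalgebra P).

Definition sub_incl : cdga_hom (sub_cdga hP) A.
Proof. by apply: (@mk_hom K (sub_cdga hP) A (@sub_val K A P hP)). Defined.

Lemma sub_val_inj : injective sub_incl.
Proof. exact: val_inj. Qed.

Definition sub_lift (B : cdga K) (f : cdga_hom B A) (fP : forall b, P (f b)) :
  cdga_hom B (sub_cdga hP).
Proof.
apply: (@mk_hom K B (sub_cdga hP) (fun b => sub_in hP (fP b))).
- by move=> x y; apply: val_inj; apply: rmorphB.
- split=> [|x y]; apply: val_inj; first exact: rmorph1.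
  exact: rmorphM.
- by move=> c; apply: val_inj; apply: cdga_hom_unit.
- by move=> n x; apply: val_inj; apply: cdga_hom_proj.
- by move=> x; apply: val_inj; apply: cdga_hom_d.
Defined.

End SubHoms.

(** * Free extensions and trivial cofibrations *)

Section FreeExtension.
Local Open Scope quotient_scope.
Variables (K : fieldType) (A : cdga K) (G : Type) (deg : G -> int).

Inductive fterm : Type :=
| FBase of A
| FGen of G
| FAdd of fterm & fterm
| FOpp of fterm
| FMul of fterm & fterm
| FProj of int & fterm
| FD of fterm.

Definition assignment (C : cdga K) (g : G -> C) : Prop :=
  forall x, cdga_proj C (deg x) (g x) = g x.

Fixpoint feval (C : cdga K) (f : A -> C) (g : G -> C) (t : fterm) : C :=
  match t with
  | FBase a => f a
  | FGen x => g x
  | FAdd t u => feval f g t + feval f g u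
  | FOpp t => - feval f g t
  | FMul t u => feval f g t * feval f g u
  | FProj n t => cdga_proj C n (feval f g t)
  | FD t => cdga_d C (feval f g t)
  end.

(* Two terms are identified when they agree in every cdga under A; this makes
   the quotient satisfy all (conditional) equations of cdga's at once. *)
Definition fequiv_prop (t u : fterm) : Prop :=
  forall (C : cdga K) (f : cdga_hom A C) (g : G -> C), assignment g ->
    feval f g t = feval f g u.

Definition fequiv (t u : fterm) : bool := `[< fequiv_prop t u >].

Fact fequiv_refl : reflexive fequiv.
Proof. by move=> t; apply/asboolP. Qed.
Fact fequiv_sym : ssrbool.symmetric fequiv.
Proof. by move=> t u; apply/asboolP/asboolP => h C f g hg; rewrite h. Qed.
Fact fequiv_trans : transitive fequiv.
Proof.
by move=> t u v /asboolP h /asboolP k; apply/asboolP => C f g hg; rewrite h ?k.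
Qed.

HB.instance Definition _ := gen_eqMixin fterm.
HB.instance Definition _ := gen_choiceMixin fterm.

Canonical fequiv_rel := EquivRel fequiv fequiv_refl fequiv_sym fequiv_trans.

Definition free_ext := {eq_quot fequiv_rel}.
HB.instance Definition _ := Choice.on free_ext.
HB.instance Definition _ := EqQuotient.on free_ext.

Definition fpi (t : fterm) : free_ext := (\pi_free_ext t)%qT.
Definition frepr (x : free_ext) : fterm := repr x.

Fact frepr_K x : fpi (frepr x) = x.
Proof. exact: reprK. Qed.

Fact fpiP t u : fpi t = fpi u <-> fequiv_prop t u.
Proof.
split=> [/eqP|h]; first by rewrite /fpi eqmodE => /asboolP.
by apply/eqP; rewrite /fpi eqmodE; apply/asboolP.
Qed.

Fact frepr_pi t : fequiv_prop (frepr (fpi t)) t.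
Proof. by apply/fpiP; rewrite frepr_K. Qed.

Definition fadd x y := fpi (FAdd (frepr x) (frepr y)).
Definition fopp x := fpi (FOpp (frepr x)).
Definition fmul x y := fpi (FMul (frepr x) (frepr y)).
Definition fproj n x := fpi (FProj n (frepr x)).
Definition fd x := fpi (FD (frepr x)).
Definition fbase a := fpi (FBase a).
Definition fgen x := fpi (FGen x).

Fact faddE t u : fadd (fpi t) (fpi u) = fpi (FAdd t u).
Proof. by apply/fpiP => C f g hg /=; rewrite !(frepr_pi _ f hg). Qed.
Fact foppE t : fopp (fpi t) = fpi (FOpp t).
Proof. by apply/fpiP => C f g hg /=; rewrite !(frepr_pi _ f hg). Qed.
Fact fmulE t u : fmul (fpi t) (fpi u) = fpi (FMul t u).
Proof. by apply/fpiP => C f g hg /=; rewrite !(frepr_pi _ f hg). Qed.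
Fact fprojE n t : fproj n (fpi t) = fpi (FProj n t).
Proof. by apply/fpiP => C f g hg /=; rewrite !(frepr_pi _ f hg). Qed.
Fact fdE t : fd (fpi t) = fpi (FD t).
Proof. by apply/fpiP => C f g hg /=; rewrite !(frepr_pi _ f hg). Qed.

Definition fopE := (faddE, foppE, fmulE, fprojE, fdE).

Fact faddA : associative fadd.
Proof.
move=> x y z; rewrite -[x]frepr_K -[y]frepr_K -[z]frepr_K !fopE.
by apply/fpiP => C f g hg /=; rewrite addrA.
Qed.
Fact faddC : commutative fadd.
Proof.
move=> x y; rewrite -[x]frepr_K -[y]frepr_K !fopE.
by apply/fpiP => C f g hg /=; rewrite addrC.
Qed.
Fact fadd0 : left_id (fbase 0) fadd.
Proof.
move=> x; rewrite -[x]frepr_K !fopE.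
by apply/fpiP => C f g hg /=; rewrite rmorph0 add0r.
Qed.
Fact faddN : left_inverse (fbase 0) fopp fadd.
Proof.
move=> x; rewrite -[x]frepr_K !fopE.
by apply/fpiP => C f g hg /=; rewrite rmorph0 addNr.
Qed.
HB.instance Definition _ := GRing.isZmodule.Build free_ext faddA faddC fadd0 faddN.

Fact fmulA : associative fmul.
Proof.
move=> x y z; rewrite -[x]frepr_K -[y]frepr_K -[z]frepr_K !fopE.
by apply/fpiP => C f g hg /=; rewrite mulrA.
Qed.
Fact fmul1 : left_id (fbase 1) fmul.
Proof.
move=> x; rewrite -[x]frepr_K !fopE.
by apply/fpiP => C f g hg /=; rewrite rmorph1 mul1r.
Qed.
Fact fmulr1 : right_id (fbase 1) fmul.
Proof.
move=> x; rewrite -[x]frepr_K !fopE.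
by apply/fpiP => C f g hg /=; rewrite rmorph1 mulr1.
Qed.
Fact fmulDl : left_distributive fmul fadd.
Proof.
move=> x y z; rewrite -[x]frepr_K -[y]frepr_K -[z]frepr_K !fopE.
by apply/fpiP => C f g hg /=; rewrite mulrDl.
Qed.
Fact fmulDr : right_distributive fmul fadd.
Proof.
move=> x y z; rewrite -[x]frepr_K -[y]frepr_K -[z]frepr_K !fopE.
by apply/fpiP => C f g hg /=; rewrite mulrDr.
Qed.
HB.instance Definition _ := GRing.Zmodule_isPzRing.Build free_ext
  fmulA fmul1 fmulr1 fmulDl fmulDr.

Fact fpi_add t u : fpi t + fpi u = fpi (FAdd t u).
Proof. exact: faddE. Qed.
Fact fpi_opp t : - fpi t = fpi (FOpp t).
Proof. exact: foppE. Qed.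
Fact fpi_mul t u : fpi t * fpi u = fpi (FMul t u).
Proof. exact: fmulE. Qed.

Fact fbaseB : zmod_morphism fbase.
Proof.
move=> a b; rewrite /fbase fpi_opp fpi_add; apply/fpiP => C f g hg /=.
exact: rmorphB.
Qed.
Fact fbaseM : monoid_morphism fbase.
Proof.
split=> // a b; rewrite /fbase fpi_mul; apply/fpiP => C f g hg /=.
exact: rmorphM.
Qed.
HB.instance Definition _ := GRing.isZmodMorphism.Build A free_ext fbase fbaseB.
HB.instance Definition _ := GRing.isMonoidMorphism.Build A free_ext fbase fbaseM.

Definition funit : {rmorphism K -> free_ext} := fbase \o cdga_unit A.

Fixpoint fsign (k : nat) (t : fterm) : fterm :=
  if k is k'.+1 then FOpp (fsign k' t) else t.

Fact fsignE k t : (-1) ^+ k * fpi t = fpi (fsign k t).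
Proof.
elim: k => [|k IH]; first by rewrite expr0 mul1r.
by rewrite exprS -mulrA IH mulN1r fpi_opp.
Qed.

Fact feval_sign (C : cdga K) (f : A -> C) (g : G -> C) k t :
  feval f g (fsign k t) = (-1) ^+ k * feval f g t.
Proof.
elim: k => [|k IH] /=; first by rewrite expr0 mul1r.
by rewrite IH exprS -mulrA mulN1r.
Qed.

(** Degrees are bounded from the syntax alone, because equality in the quotient is tested in all
    targets and a single list has to serve for each of them. *)
Fixpoint fsupp (t : fterm) : seq int :=
  match t with
  | FBase a => sval (cid (supported_ex a))
  | FGen x => [:: deg x]
  | FAdd t u => fsupp t ++ fsupp u
  | FOpp t => fsupp t
  | FMul t u => [seq m + n | m <- fsupp t, n <- fsupp u]
  | FProj n t => fsupp t
  | FD t => [seq n + 1 | n <- fsupp t]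
  end.

Fact supported_feval (C : cdga K) (f : cdga_hom A C) (g : G -> C) t :
  assignment g -> supported (feval f g t) (fsupp t).
Proof.
move=> hg; elim: t => [a|x|t ht u hu|t ht|t ht u hu|n t ht|t ht] /=.
- case: cid => s hs /= n ns; rewrite -cdga_hom_proj hs ?rmorph0 //.
- move=> n; rewrite inE => nx; rewrite -hg cdga_proj_proj.
  by rewrite (negPf nx).
- exact: supportedD.
- exact: supportedN.
- exact: supportedM.
- exact: supported_proj.
- exact: supported_d.
Qed.

Fact fpi_sum (s : seq int) (F : int -> fterm) :
  \sum_(n <- s) fpi (F n) = fpi (foldr (fun n t => FAdd (F n) t) (FBase 0) s).
Proof.
by elim: s => [|n s IH]; rewrite ?big_nil // big_cons IH fpi_add.
Qed.

Fact feval_sum (C : cdga K) (f : cdga_hom A C) (g : G -> C) s (F : int -> fterm) :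
  feval f g (foldr (fun n t => FAdd (F n) t) (FBase 0) s) =
  \sum_(n <- s) feval f g (F n).
Proof.
by elim: s => [|n s IH] /=; rewrite ?big_nil ?rmorph0 // big_cons IH.
Qed.

(** An [assignment] constrains nothing but degrees, so the differential of a generator is free as
    well: this is [A] with a free graded commutative algebra on pairs x, dx adjoined. Each axiom
    holds because it holds after evaluation in every target. *)
Definition free_cdga : cdga K.
Proof.
refine (@Cdga K free_ext funit fproj fd _ _ _ _ _ _ _ _ _ _ _).
- move=> n x y; rewrite -[x]frepr_K -[y]frepr_K fpi_add !fprojE fpi_add.
  by apply/fpiP => C f g hg /=; rewrite cdga_projD.
- move=> m n x; rewrite -[x]frepr_K !fopE; case: eqP => [->|mn]; apply/fpiP => C f g hg /=.
    by rewrite cdga_proj_id.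
  by rewrite rmorph0 cdga_proj_proj; case: eqP => // nm; case: mn.
- move=> x; exists (undup (fsupp (frepr x))); first exact: undup_uniq.
  rewrite -{1 3}[x]frepr_K; under eq_bigr => n _ do rewrite fprojE.
  rewrite fpi_sum; apply/fpiP => C f g hg /=; rewrite feval_sum /=.
  apply: supported_sum; first exact: undup_uniq.
  by move=> n; rewrite mem_undup; apply: supported_feval.
- by move=> c; rewrite /= fopE; apply/fpiP => C f g hg /=; rewrite -cdga_hom_proj cdga_unit_deg.
- move=> m n x y; rewrite -[x]frepr_K -[y]frepr_K fpi_mul !fopE => /fpiP hx /fpiP hy.
  by apply/fpiP => C f g hg; apply: cdga_mul_deg; [exact: hx|exact: hy].
- move=> m n x y; rewrite -[x]frepr_K -[y]frepr_K !fpi_mul !fopE => /fpiP hx /fpiP hy.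
  rewrite fsignE; apply/fpiP => C f g hg; rewrite feval_sign.
  by apply: cdga_mulC; [exact: hx|exact: hy].
- move=> x y; rewrite -[x]frepr_K -[y]frepr_K fpi_add !fdE fpi_add.
  by apply/fpiP => C f g hg /=; rewrite cdga_dD.
- move=> c; rewrite /= fopE; apply/fpiP => C f g hg /=.
  by rewrite -cdga_hom_d cdga_d_unit.
- move=> n x; rewrite -[x]frepr_K !fopE => /fpiP hx.
  by apply/fpiP => C f g hg; apply: cdga_d_deg; exact: hx.
- move=> m x y; rewrite -[x]frepr_K -[y]frepr_K fprojE => /fpiP hx.
  rewrite fpi_mul !fdE !fpi_mul fsignE fpi_add; apply/fpiP => C f g hg /=; rewrite feval_sign.
  by apply: cdga_dM; exact: hx.
- move=> x; rewrite -[x]frepr_K !fopE.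
  by apply/fpiP => C f g hg /=; rewrite rmorph0 cdga_dd.
Defined.

Definition free_base : cdga_hom A free_cdga.
Proof.
apply: (@mk_hom K A free_cdga fbase fbaseB fbaseM) => // [n x|x].
- by rewrite /= fopE; apply/fpiP => C f g hg /=; rewrite cdga_hom_proj.
- by rewrite /= fopE; apply/fpiP => C f g hg /=; rewrite cdga_hom_d.
Defined.

Definition free_gen (x : G) : free_cdga := fgen x.

Lemma free_gen_deg : assignment free_gen.
Proof.
move=> x; rewrite /free_gen /= fopE.
by apply/fpiP => C f g hg /=; rewrite hg.
Qed.

Section Universal.
Variables (C : cdga K) (f : cdga_hom A C) (g : G -> C) (hg : assignment g).

Definition fext (x : free_ext) : C := feval f g (frepr x).

Fact fextE t : fext (fpi t) = feval f g t.
Proof. exact: frepr_pi. Qed.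

Definition free_extend : cdga_hom free_cdga C.
Proof.
apply: (@mk_hom K free_cdga C fext).
- move=> x y; rewrite -[x]frepr_K -[y]frepr_K.
  by rewrite fpi_opp fpi_add !fextE.
- split=> [|x y]; first by rewrite fextE /= rmorph1.
  by rewrite -[x]frepr_K -[y]frepr_K fpi_mul !fextE.
- by move=> c; rewrite fextE /= cdga_hom_unit.
- by move=> n x; rewrite -[x]frepr_K [cdga_proj _ _ _]fprojE !fextE.
- by move=> x; rewrite -[x]frepr_K [cdga_d _ _]fdE !fextE.
Defined.

Lemma free_extend_base a : free_extend (free_base a) = f a.
Proof. exact: fextE. Qed.

Lemma free_extend_gen x : free_extend (free_gen x) = g x.
Proof. exact: fextE. Qed.

End Universal.

Lemma free_ind (P : free_cdga -> Prop) :
  (forall a, P (free_base a)) -> (forall x, P (free_gen x)) ->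
  (forall x y, P x -> P y -> P (x + y)) -> (forall x, P x -> P (- x)) ->
  (forall x y, P x -> P y -> P (x * y)) ->
  (forall n x, P x -> P (cdga_proj free_cdga n x)) ->
  (forall x, P x -> P (cdga_d free_cdga x)) -> forall x, P x.
Proof.
move=> Pb Pg PD PN PM Pp Pd x; rewrite -[x]frepr_K.
elim: (frepr x) => [a|y|t ht u hu|t ht|t ht u hu|n t ht|t ht].
- exact: Pb.
- exact: Pg.
- by rewrite -fpi_add; apply: PD.
- by rewrite -fpi_opp; apply: PN.
- by rewrite -fpi_mul; apply: PM.
- by rewrite -fprojE; apply: (Pp n (fpi t)).
- by rewrite -fdE; apply: (Pd (fpi t)).
Qed.

Lemma free_hom_ext (C : cdga K) (f f' : cdga_hom free_cdga C) :
  (forall a, f (free_base a) = f' (free_base a)) ->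
  (forall x, f (free_gen x) = f' (free_gen x)) -> f =1 f'.
Proof.
move=> hb hgen; elim/free_ind => // [x y hx hy|x hx|x y hx hy|n x hx|x hx].
- by rewrite !rmorphD hx hy.
- by rewrite !rmorphN hx.
- by rewrite !rmorphM hx hy.
- by rewrite !cdga_hom_proj hx.
- by rewrite !cdga_hom_d hx.
Qed.

Lemma free_base_inj : injective free_base.
Proof.
have h0 : assignment (fun=> 0 : A) by move=> x; rewrite cdga_proj0.
by move=> a b /(congr1 (free_extend (hom_id A) h0)); rewrite !free_extend_base.
Qed.

End FreeExtension.

(* The triple (a, b, c) stands for a + eps b + eta c, where eps and eta have
   degrees 1 and 0, d eta = eps, and all products of eps and eta vanish.  A
   section of the projection to A is thus a pair of derivations h, w of degrees
   -1 and 0 with w = d h + h d. *)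
Section DerivationExtension.
Variables (K : fieldType) (A : cdga K).

Definition dext := (A * A * A)%type.
HB.instance Definition _ := GRing.Zmodule.on dext.
Implicit Types x y : dext.

Definition mk_dext (a b c : A) : dext := (a, b, c).

Definition dext_mul x y : dext := mk_dext
  (x.1.1 * y.1.1) (x.1.2 * y.1.1 + twist x.1.1 * y.1.2)
  (x.2 * y.1.1 + x.1.1 * y.2).

Definition dext_one : dext := mk_dext 1 0 0.

Fact dext_eq x y : x.1.1 = y.1.1 -> x.1.2 = y.1.2 -> x.2 = y.2 -> x = y.
Proof. by move: x y => [[a b] c] [[a' b'] c'] /= -> -> ->. Qed.

Fact dext_mulA : associative dext_mul.
Proof.
move=> [[a b] c] [[a' b'] c'] [[a'' b''] c'']; apply: dext_eq; rewrite /= ?mulrA //.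
  by rewrite mulrDr mulrDl twistM !mulrA addrA.
by rewrite mulrDr mulrDl !mulrA addrA.
Qed.
Fact dext_mul1 : left_id dext_one dext_mul.
Proof.
by move=> x; apply: dext_eq; rewrite /= ?twist1 ?mul1r ?mul0r ?add0r.
Qed.
Fact dext_mulr1 : right_id dext_one dext_mul.
Proof. by move=> x; apply: dext_eq; rewrite /= ?mulr1 ?mulr0 ?addr0. Qed.
Fact dext_mulDl : left_distributive dext_mul +%R.
Proof.
move=> x y z; apply: dext_eq; rewrite /= ?twistD ?mulrDl //; exact: addrACA.
Qed.
Fact dext_mulDr : right_distributive dext_mul +%R.
Proof.
move=> x y z; apply: dext_eq; rewrite /= ?mulrDr //; exact: addrACA.
Qed.
HB.instance Definition _ := GRing.Zmodule_isPzRing.Build dext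
  dext_mulA dext_mul1 dext_mulr1 dext_mulDl dext_mulDr.

Definition dext_base (a : A) : dext := mk_dext a 0 0.
Fact dext_baseB : zmod_morphism dext_base.
Proof. by move=> a b; apply: dext_eq; rewrite /= ?subr0. Qed.
Fact dext_baseM : monoid_morphism dext_base.
Proof.
by split=> // a b; apply: dext_eq; rewrite /= ?mul0r ?mulr0 ?addr0.
Qed.
HB.instance Definition _ := GRing.isZmodMorphism.Build A dext dext_base dext_baseB.
HB.instance Definition _ := GRing.isMonoidMorphism.Build A dext dext_base dext_baseM.

Definition dext_unit : {rmorphism K -> dext} := dext_base \o cdga_unit A.

Definition dext_proj (n : int) x : dext := mk_dext
  (cdga_proj A n x.1.1) (cdga_proj A (n - 1) x.1.2) (cdga_proj A n x.2).

(** With eps and eta written on the left, d (eps b) = - eps db since eps is odd, and d (eta c) = eps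
    c + eta dc. The [twist] in [dext_mul] likewise comes from moving a factor past eps. *)
Definition dext_d x : dext := mk_dext
  (cdga_d A x.1.1) (x.2 - cdga_d A x.1.2) (cdga_d A x.2).

Fact dext_sumE (s : seq int) (F : int -> dext) :
  [/\ (\sum_(n <- s) F n).1.1 = \sum_(n <- s) (F n).1.1,
      (\sum_(n <- s) F n).1.2 = \sum_(n <- s) (F n).1.2 &
      (\sum_(n <- s) F n).2 = \sum_(n <- s) (F n).2].
Proof.
by elim: s => [|n s [IH1 IH2 IH3]]; rewrite ?big_nil // !big_cons /= IH1 IH2 IH3.
Qed.

Fact dext_signE k x : (-1) ^+ k * x =
  mk_dext ((-1) ^+ k * x.1.1) ((-1) ^+ k * x.1.2) ((-1) ^+ k * x.2).
Proof.
rewrite -signr_odd -(signr_odd A); case: odd; rewrite ?expr0 ?expr1 ?mul1r ?mulN1r.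
  by [].
by move: x => [[]].
Qed.

Fact dext_projP n x : dext_proj n x = x -> [/\ cdga_proj A n x.1.1 = x.1.1,
  cdga_proj A (n - 1) x.1.2 = x.1.2 & cdga_proj A n x.2 = x.2].
Proof. by move: x => [[a b] c] [-> -> ->]. Qed.

Lemma sign_abs1 (n : int) : (-1) ^+ absz (n - 1) = - (-1) ^+ absz n :> A.
Proof. by rewrite sign_absD expr1 mulrN1. Qed.

Lemma sign_absMB (m n : int) : (-1) ^+ absz (m * (n - 1)) = (-1) ^+ absz (m * n) * (-1) ^+ absz m :> A.
Proof.
by rewrite mulrBr mulr1 sign_absD abszN.
Qed.

Lemma sign_sqr (n : nat) (a : A) : (-1) ^+ n * ((-1) ^+ n * a) = a.
Proof. by rewrite mulrA -exprD addnn -mul2n exprM sqrrN expr1n expr1n mul1r. Qed.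

Lemma twistK (a : A) : twist (twist a) = a.
Proof. by apply: cdga_proj_ext => n; rewrite !proj_twist sign_sqr. Qed.

Definition dext_cdga : cdga K.
Proof.
refine (@Cdga K dext dext_unit dext_proj dext_d _ _ _ _ _ _ _ _ _ _ _).
- by move=> n x y; apply: dext_eq; rewrite /= cdga_projD.
- move=> m n x; apply: dext_eq; rewrite /= cdga_proj_proj ?(inj_eq (addIr _)); by case: eqP.
- move=> x; have [s1 h1] := supported_ex x.1.1; have [s2 h2] := supported_ex x.1.2.
  have [s3 h3] := supported_ex x.2.
  pose s := undup (s1 ++ [seq n + 1 | n <- s2] ++ s3); exists s; first exact: undup_uniq.
  have [e1 e2 e3] := dext_sumE s (dext_proj^~ x).
  apply: dext_eq; rewrite ?e1 ?e2 ?e3 /=.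
  + apply: supported_sum; first exact: undup_uniq.
    move=> n; rewrite mem_undup !mem_cat => h; apply: h1; apply: contra h => ->; done.
  + rewrite -(big_map (fun n => n - 1) xpredT (fun n => cdga_proj A n x.1.2)).
    apply: supported_sum; first by rewrite map_inj_uniq ?undup_uniq //; apply: addIr.
    move=> n h; apply: h2; apply: contra h => h.
    apply/mapP; exists (n + 1); rewrite ?addrK // mem_undup !mem_cat.
    by rewrite (map_f (fun n : int => n + 1) h) orbT.
  + apply: supported_sum; first exact: undup_uniq.
    move=> n; rewrite mem_undup !mem_cat => h; apply: h3; apply: contra h => ->.
    by rewrite !orbT.
- by move=> c; apply: dext_eq; rewrite /= ?cdga_unit_deg ?cdga_proj0.
- move=> m n x y /dext_projP[x1 x2 x3] /dext_projP[y1 y2 y3].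
  apply: dext_eq; rewrite /= ?cdga_projD ?(cdga_mul_deg x1 y1) //.
    congr (_ + _).
      by rewrite [m + n - 1]addrAC (cdga_mul_deg x2 y1).
    rewrite -addrA cdga_mul_deg //.
    by rewrite (twist_homog x1) proj_sign x1.
  by congr (_ + _); apply: cdga_mul_deg.
- move=> m n x y /dext_projP[x1 x2 x3] /dext_projP[y1 y2 y3].
  rewrite dext_signE; apply: dext_eq; rewrite /=.
  + exact: cdga_mulC.
  + rewrite (twist_homog x1) (twist_homog y1) addrC mulrDr; congr (_ + _).
      rewrite -mulrA (cdga_mulC x1 y2) sign_absMB -[_ * _ * (_ * _)]mulrA.
      by rewrite mulrA sign_comm -mulrA sign_sqr.
    rewrite (cdga_mulC x2 y1) mulrC sign_absMB [n * m]mulrC.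
    by rewrite !mulrA.
  + by rewrite addrC mulrDr; congr (_ + _); apply: cdga_mulC.
- by move=> x y; apply: dext_eq; rewrite /= cdga_dD // opprD addrACA.
- move=> c; apply: dext_eq; rewrite /= ?cdga_d_unit ?raddf0 ?subr0 ?addr0 //.
- move=> n x /dext_projP[x1 x2 x3]; apply: dext_eq; rewrite /=.
  + exact: cdga_d_deg.
  + rewrite raddfB /= addrK x3; congr (_ - _).
    by rewrite -[n in LHS](subrK 1) cdga_d_deg.
  + exact: cdga_d_deg.
- move=> m x y /dext_projP[x1 x2 x3]; rewrite dext_signE; apply: dext_eq; rewrite /=.
  + exact: cdga_dM.
  + have hb z : (-1) ^+ absz m * (x.1.2 * z) = - (twist x.1.2 * z).
      by rewrite (twist_homog x2) sign_abs1 !mulNr opprK mulrA.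
    have ha z : (-1) ^+ absz m * (twist x.1.1 * z) = x.1.1 * z.
      by rewrite (twist_homog x1) -mulrA sign_sqr.
    rewrite mulrDr hb ha raddfD /= !cdga_dMt twistK twist_d mulrBl mulrBr mulNr.
    rewrite !opprD -!addrA; congr (_ + _).
    rewrite [LHS]addrCA; congr (_ + _).
    by rewrite [LHS]addrCA [RHS]addrCA; congr (_ + _); rewrite addrCA.
  + by rewrite raddfD /= !(cdga_dM _ x3, cdga_dM _ x1) mulrDr addrACA.
- move=> x; apply: dext_eq; rewrite /= ?cdga_dd //.
  by rewrite raddfB /= cdga_dd subr0 subrr.
Defined.

Definition dext_pr : cdga_hom dext_cdga A.
Proof. by apply: (@mk_hom K dext_cdga A (fun x => x.1.1)). Defined.

Definition dext_incl : cdga_hom A dext_cdga.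
Proof.
apply: (@mk_hom K A dext_cdga dext_base dext_baseB dext_baseM) => // [n x|x].
- by apply: dext_eq => /=; rewrite ?cdga_proj0.
- by apply: dext_eq => /=; rewrite ?cdga_d0 ?subr0.
Defined.

End DerivationExtension.

Section CharZero.
Variables (K : fieldType) (K0 : [pchar K] =i pred0) (A : cdga K).
Implicit Types x y : A.

Lemma natmul_unit x k : x *+ k = cdga_unit A k%:R * x.
Proof. by rewrite rmorph_nat mulr_natl. Qed.

Lemma unit_natK x k : (0 < k)%N -> cdga_unit A k%:R^-1 * (x *+ k) = x.
Proof.
move=> k0; rewrite natmul_unit mulrA -rmorphM mulVf ?rmorph1 ?mul1r //.
by move/pcharf0P: K0 => ->; rewrite -lt0n.
Qed.

Lemma mulrn_inj0 x k : (0 < k)%N -> x *+ k = 0 -> x = 0.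
Proof. by move=> k0 xk; rewrite -(unit_natK x k0) xk mulr0. Qed.

(** Subtracting [w] of the sum from n times the sum removes the last term and multiplies the i-th
    one by n - i. Induction kills these multiples, and characteristic 0 allows division by n - i. *)
Lemma eigen_indep (w : A -> A) (wB : forall x y, w (x - y) = w x - w y) n (g : nat -> A) :
  (forall i, w (g i) = g i *+ i) -> \sum_(i < n) g i = 0 ->
  forall i, (i < n)%N -> g i = 0.
Proof.
have w0 : w 0 = 0 by have := wB 0 0; rewrite !subrr.
have wN x : w (- x) = - w x by rewrite -[- x]add0r wB w0 sub0r.
have wD x y : w (x + y) = w x + w y by rewrite -{1}[y]opprK wB wN opprK.
have wMn x k : w (x *+ k) = w x *+ k.
  by elim: k => [|k IH]; rewrite ?mulr0n // !mulrS wD IH.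
elim: n g => [//|n IHn] g wg; rewrite big_ord_recr /= => S0.
have gn i : (i < n)%N -> g i = 0.
  move=> lin; pose g' j := g j *+ n - g j *+ j.
  have/(_ i lin) : forall j, (j < n)%N -> g' j = 0.
    apply: IHn => [j|]; first by rewrite /g' wB !wMn wg mulrnBl mulrnAC.
    have wS : w (\sum_(j < n) g j + g n) = \sum_(j < n) g j *+ j + g n *+ n.
      rewrite wD wg (big_morph w wD w0); congr (_ + _).
      by apply: eq_bigr => j _; rewrite wg.
    rewrite big_split /= sumrN sumrMnl.
    have -> : \sum_(j < n) g j = - g n by apply/eqP; rewrite -addr_eq0 S0.
    by move: wS; rewrite S0 w0 => wS; rewrite mulNrn -opprD addrC -wS oppr0.
  rewrite /g' -mulrnBr 1?ltnW // => /mulrn_inj0; apply; by rewrite subn_gt0.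
move=> i; rewrite ltnS leq_eqVlt => /orP[/eqP ->|/gn //].
by move: S0; rewrite big1 ?add0r // => j _; apply: gn.
Qed.

End CharZero.

(** * Acyclicity of contractible generators *)

Section FreeAcyclic.
Variables (K : fieldType) (K0 : [pchar K] =i pred0).
Variables (A : cdga K) (G : Type) (deg : G -> int).
Local Notation E := (free_cdga A deg).
Local Notation base := (free_base A deg).
Local Notation gen := (@free_gen K A G deg).

Fact euler_assignment :
  @assignment K G deg (dext_cdga E) (fun x => mk_dext (gen x) 0 (gen x)).
Proof.
move=> x; apply: dext_eq; [|exact: (cdga_proj0 E)|]; exact: (@free_gen_deg K A G deg x).
Qed.

(* The derivations killing A with h x_g = 0, h (d x_g) = x_g, so that
   w = d h + h d is the number operator counting the x_g and d x_g. *)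
Definition euler_hom : cdga_hom E (dext_cdga E) :=
  free_extend (hom_comp (dext_incl E) base) euler_assignment.

Definition euler_h (e : E) : E := (euler_hom e).1.2.
Definition euler_w (e : E) : E := (euler_hom e).2.

Fact euler_hom1 e : (euler_hom e).1.1 = e.
Proof.
apply: (free_hom_ext (f := hom_comp (dext_pr E) euler_hom) (f' := hom_id E)) => [a|x].
  by rewrite [LHS](congr1 (dext_pr E) (free_extend_base _ euler_assignment a)).
by rewrite [LHS](congr1 (dext_pr E) (free_extend_gen _ euler_assignment x)).
Qed.

Fact euler_homE e : euler_hom e = mk_dext e (euler_h e) (euler_w e).
Proof. by apply: dext_eq; rewrite //= euler_hom1. Qed.

Fact euler_wB x y : euler_w (x - y) = euler_w x - euler_w y.
Proof. by rewrite /euler_w rmorphB. Qed.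

Fact euler_wM x y : euler_w (x * y) = euler_w x * y + x * euler_w y.
Proof. by rewrite {1}/euler_w rmorphM !euler_homE. Qed.

Fact euler_w_proj n x : euler_w (cdga_proj E n x) = cdga_proj E n (euler_w x).
Proof. by rewrite /euler_w cdga_hom_proj. Qed.

Fact euler_w_d x : euler_w (cdga_d E x) = cdga_d E (euler_w x).
Proof. by rewrite /euler_w cdga_hom_d. Qed.

Fact euler_h_d x : euler_h (cdga_d E x) = euler_w x - cdga_d E (euler_h x).
Proof. by rewrite /euler_h cdga_hom_d. Qed.

Fact euler_w_base a : euler_w (base a) = 0.
Proof. by rewrite /euler_w free_extend_base. Qed.

Fact euler_w_gen x : euler_w (gen x) = gen x.
Proof. by rewrite /euler_w free_extend_gen. Qed.

(** The weight 0 part is required to come from [A], since [euler_w] gives no contraction there. The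
    sequence [f] is total and vanishes from [n] on, so that decompositions of different lengths can
    be subtracted termwise. *)
Definition euler_sum (e : E) : Prop := exists (n : nat) (f : nat -> E) (a : A),
  [/\ e = \sum_(i < n) f i, f 0%N = base a, forall i, (n <= i)%N -> f i = 0 &
      forall i, euler_w (f i) = f i *+ i].

Fact sum_pad (f : nat -> E) n m : (forall i, (n <= i)%N -> f i = 0) ->
  \sum_(i < n) f i = \sum_(i < n + m) f i.
Proof.
move=> f0; rewrite big_split_ord /= [X in _ + X]big1 ?addr0 // => i _.
by rewrite f0 // leq_addr.
Qed.

Fact euler_sumB x y : euler_sum x -> euler_sum y -> euler_sum (x - y).
Proof.
move=> [n [f [a [-> fa f0 fw]]]] [m [g [b [-> gb g0 gw]]]].
exists (n + m)%N, (fun i => f i - g i), (a - b); split.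
- by rewrite (sum_pad m f0) (sum_pad n g0) addnC -sumrB.
- by rewrite fa gb rmorphB.
- move=> i hi; rewrite f0 ?g0 ?subr0 //; lia.
- by move=> i; rewrite euler_wB fw gw mulrnBl.
Qed.

Fact euler_sum_base a : euler_sum (base a).
Proof.
exists 1%N, (fun i => if i == 0%N then base a else 0), a; split => //.
- by rewrite big_ord1.
- by case.
- case=> [|i] /=; first exact: euler_w_base.
  by rewrite mul0rn -(rmorph0 base) euler_w_base rmorph0.
Qed.

Fact euler_sum0 : euler_sum 0.
Proof. by rewrite -(rmorph0 base); apply: euler_sum_base. Qed.

Fact euler_sumN x : euler_sum x -> euler_sum (- x).
Proof. by rewrite -sub0r; apply: euler_sumB; apply: euler_sum0. Qed.

Fact euler_sumD x y : euler_sum x -> euler_sum y -> euler_sum (x + y).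
Proof.
by move=> hx hy; rewrite -[y]opprK; apply: euler_sumB => //; apply: euler_sumN.
Qed.

Fact euler_w0 : euler_w 0 = 0.
Proof. by rewrite -(rmorph0 base) euler_w_base rmorph0. Qed.

Fact euler_sum_eigen k x : euler_w x = x *+ k.+1 -> euler_sum x.
Proof.
move=> wx; exists k.+2, (fun i => if i == k.+1 then x else 0), 0; split.
- rewrite big_ord_recr /= eqxx big1 ?add0r // => i _.
  by case: eqP => // ik; have := ltn_ord i; rewrite ik ltnn.
- by rewrite rmorph0.
- by move=> i; case: eqP => // ->; rewrite ltnn.
- by move=> i; case: eqP => [->|_]; rewrite ?euler_w0 ?mul0rn.
Qed.

Fact euler_sum_big n (F : 'I_n -> E) :
  (forall i, euler_sum (F i)) -> euler_sum (\sum_(i < n) F i).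
Proof.
by move=> h; apply: big_ind => //; [exact: euler_sum0|exact: euler_sumD].
Qed.

Fact euler_sum_all e : euler_sum e.
Proof.
elim/free_ind: e => [a|x|x y|x|x y|k x|x].
- exact: euler_sum_base.
- by apply: (@euler_sum_eigen 0); rewrite euler_w_gen.
- exact: euler_sumD.
- exact: euler_sumN.
- move=> [n [f [a [-> fa f0 fw]]]] [m [g [b [-> gb g0 gw]]]].
  rewrite mulr_suml; apply: euler_sum_big => i.
  rewrite mulr_sumr; apply: euler_sum_big => j.
  have: euler_w (f i * g j) = f i * g j *+ (i + j).
    by rewrite euler_wM fw gw mulrnDr mulrnAl mulrnAr.
  (* Weight 0 arises only as 0 + 0, where both factors come from [A]. *)
  case: i j => [[|i] hi] [[|j] hj] /=; try exact: euler_sum_eigen.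
  by rewrite fa gb -rmorphM => _; apply: euler_sum_base.
- move=> [n [f [a [-> fa f0 fw]]]]; exists n, (fun i => cdga_proj E k (f i)), (cdga_proj A k a).
  split=> [|||i].
  + by rewrite raddf_sum.
  + by rewrite fa cdga_hom_proj.
  + by move=> i /f0 ->; rewrite raddf0.
  + by rewrite euler_w_proj fw raddfMn.
- move=> [n [f [a [-> fa f0 fw]]]]; exists n, (fun i => cdga_d E (f i)), (cdga_d A a).
  split=> [|||i].
  + by rewrite raddf_sum.
  + by rewrite fa cdga_hom_d.
  + by move=> i /f0 ->; rewrite raddf0.
  + by rewrite euler_w_d fw raddfMn.
Qed.

(** Sending all generators to 0 retracts [base], which gives injectivity on cohomology. For
    surjectivity, d h + h d is multiplication by i on weight i, so h / i contracts the part of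
    positive weight and only [A] remains. *)
Lemma free_base_quasi_iso : quasi_iso base.
Proof.
split=> [a da [y hy]|e de].
  have h0 : assignment deg (fun=> 0 : A) by move=> x; rewrite cdga_proj0.
  exists (free_extend (hom_id A) h0 y).
  by rewrite -cdga_hom_d -hy free_extend_base.
have [n [f [a [eE fa f0 fw]]]] := euler_sum_all e.
(* As [euler_w] commutes with the differential, independence of the weights makes each component of
   a cocycle a cocycle. *)
have df i : cdga_d E (f i) = 0.
  have [hn|/f0 ->] := ltnP i n; last by rewrite raddf0.
  apply: (eigen_indep K0 euler_wB (g := fun j => cdga_d E (f j))) hn => [j|].
    by rewrite euler_w_d fw raddfMn.
  by rewrite -raddf_sum -eE.
exists a; split.
  by apply: (@free_base_inj _ A G deg); rewrite cdga_hom_d -fa df rmorph0.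
exists (- \sum_(i < n | (0 < i)%N) (cdga_unit E i%:R^-1 * euler_h (f i))).
have {}eE : e = base a + \sum_(i < n | (0 < i)%N) f i.
  case: n eE f0 => [|n] eE f0.
    by rewrite eE !big_ord0 addr0 -fa f0.
  rewrite eE big_ord_recl fa; congr (_ + _).
  by rewrite [RHS]big_mkcond [RHS]big_ord_recl /= add0r.
rewrite eE opprD addrA subrr add0r cdga_dN (raddf_sum (cdga_d E)); congr (- _).
apply: eq_bigr => i i0; rewrite [RHS]cdga_dZ.
have := euler_h_d (f i); rewrite df fw.
have -> : euler_h 0 = 0 by rewrite /euler_h rmorph0.
by move/esym/eqP; rewrite subr_eq0 => /eqP <-; rewrite unit_natK.
Qed.

End FreeAcyclic.

(** * Lifting trivial cofibrations against surjections *)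

Section TrivialCofibrations.
Variables (K : fieldType) (K0 : [pchar K] =i pred0).

Lemma quasi_iso_cancel (A E B : cdga K) (k : cdga_hom A E) (q : cdga_hom E B)
    (i : cdga_hom A B) :
  (forall a, q (k a) = i a) -> quasi_iso k -> quasi_iso i -> quasi_iso q.
Proof.
move=> qk [k1 k2] [i1 i2]; split=> [e de [b qe]|b db].
  have [a [da [z az]]] := k2 e de.
  have [|a' aE] := i1 a da.
    exists (b + q z); rewrite -qk raddfD /= -qe -cdga_hom_d -az rmorphB.
    by rewrite addrC subrK.
  exists (k a' - z); rewrite raddfB /= -cdga_hom_d -aE -az.
  by rewrite opprB addrC subrK.
have [a [da [z az]]] := i2 b db.
exists (k a); split; first by rewrite -cdga_hom_d da rmorph0.
by exists z; rewrite qk.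
Qed.

(* Retract argument: factor i through the free extension of A by contractible
   generators indexed by the homogeneous elements of B. *)
Lemma trivial_cofibration_lift (A B X Y : cdga K) (i : cdga_hom A B)
    (p : cdga_hom X Y) (u : cdga_hom A X) (v : cdga_hom B Y) :
  cofibration i -> quasi_iso i -> fibration p -> (forall a, p (u a) = v (i a)) ->
  exists g : cdga_hom B X, (forall a, g (i a) = u a) /\ (forall b, p (g b) = v b).
Proof.
move=> cof_i qi_i fib_p comm.
pose G := {nb : int * B | cdga_proj B nb.1 nb.2 = nb.2}.
pose deg (x : G) := (sval x).1.
have hq : @assignment K G deg B (fun x => (sval x).2) by case.
pose q := free_extend i hq.
have qb a : q (free_base A deg a) = i a by exact: free_extend_base.
have qi_q : quasi_iso q.
  exact: quasi_iso_cancel qb (free_base_quasi_iso K0 A deg) qi_i.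
have fib_q : fibration q.
  move=> b; have [s _ ->] := cdga_proj_sum b.
  apply: (big_ind (fun b => exists x, q x = b)) => [|_ _ [x <-] [y <-]|n _].
  - by exists 0; rewrite rmorph0.
  - by exists (x + y); rewrite rmorphD.
  - pose x : G := exist _ (n, cdga_proj B n b) (cdga_proj_id n b).
    by exists (free_gen A deg x); rewrite free_extend_gen.
(* [cofibration] tests only surjective quasi-isomorphisms, so [i] is lifted against [q] and not
   against [p]: [h] is a section of [q] under [A]. The map into [X] can then be chosen freely on
   generators. *)
have [h [hi qh]] := cof_i _ _ q fib_q qi_q (free_base A deg) (hom_id B) qb.
have lift x : {y : X | cdga_proj X (deg x) y = y /\ p y = v (sval x).2}.
  apply: cid; have [y py] := fib_p (v (sval x).2).
  exists (cdga_proj X (deg x) y); split; first exact: cdga_proj_id.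
  by rewrite cdga_hom_proj py -cdga_hom_proj hq.
have hl : @assignment K G deg X (fun x => sval (lift x)).
  by move=> x; have [] := svalP (lift x).
pose t := free_extend u hl.
have pt e : p (t e) = v (q e).
  apply: (free_hom_ext (f := hom_comp p t) (f' := hom_comp v q)) => [a|x].
    rewrite [LHS](congr1 p (free_extend_base u hl a)) comm.
    by rewrite [RHS](congr1 v (free_extend_base i hq a)).
  rewrite [LHS](congr1 p (free_extend_gen u hl x)).
  rewrite [RHS](congr1 v (free_extend_gen i hq x)).
  by have [] := svalP (lift x).
exists (hom_comp t h); split=> [a|b].
  by rewrite [LHS](congr1 t (hi a)); exact: free_extend_base.
by rewrite [LHS]pt [LHS](congr1 v (qh b)).
Qed.

End TrivialCofibrations.

(** * Functors on finite sets and their fibrant replacement *)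

Section SetFunctors.
Variables (K : fieldType) (V : finType).

Record set_functor := SetFunctor {
  sf_obj :> {set V} -> cdga K;
  sf_map : forall S T : {set V}, S \subset T -> cdga_hom (sf_obj S) (sf_obj T);
  sf_map_id : forall (S : {set V}) (h : S \subset S) x, sf_map h x = x;
  sf_map_comp : forall (S T U : {set V}) (h : S \subset T) (k : T \subset U)
    (l : S \subset U) x, sf_map k (sf_map h x) = sf_map l x
}.

Record sf_hom (X Y : set_functor) := SfHom {
  sf_hom_fun :> forall S, cdga_hom (X S) (Y S);
  sf_hom_natural : forall (S T : {set V}) (h : S \subset T) x,
    sf_hom_fun T (sf_map X h x) = sf_map Y h (sf_hom_fun S x)
}.

Section Strict.
Variables (X : {set V} -> cdga K)
  (m : forall S T : {set V}, S \proper T -> cdga_hom (X S) (X T)).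
Hypothesis m_comp : forall (S T U : {set V}) (h : S \proper T) (k : T \proper U)
  (l : S \proper U) x, m k (m h x) = m l x.

Definition cast_hom (S T : {set V}) (e : S = T) : cdga_hom (X S) (X T) :=
  match e in _ = T return cdga_hom (X S) (X T) with erefl => hom_id (X S) end.

Fact sub_neq_proper (S T : {set V}) : S \subset T -> S <> T -> S \proper T.
Proof. by move=> ST /eqP; rewrite properEneq ST andbT. Qed.

(** The transition maps constructed below for proper inclusions pass through matching objects and
    have no specialisation to S = T, so identities are grafted in by a cast. *)
Definition strict_map (S T : {set V}) (h : S \subset T) : cdga_hom (X S) (X T) :=
  match S =P T with
  | ReflectT e => cast_hom e
  | ReflectF ne => m (sub_neq_proper h ne)
  end.

Fact strict_map_id (S : {set V}) (h : S \subset S) x : strict_map h x = x.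
Proof.
rewrite /strict_map; case: eqP => [e|]; last by case.
by rewrite (eq_axiomK e).
Qed.

Fact strict_mapE (S T : {set V}) (h : S \subset T) (h' : S \proper T) x :
  strict_map h x = m h' x.
Proof.
rewrite /strict_map; case: eqP => [e|ne].
  by exfalso; move: h'; rewrite e properxx.
by congr (m _ x); apply: bool_irrelevance.
Qed.

Fact strict_map_comp (S T U : {set V}) (h : S \subset T) (k : T \subset U)
    (l : S \subset U) x : strict_map k (strict_map h x) = strict_map l x.
Proof.
have [ST|ST] := eqVneq S T.
  by subst T; rewrite strict_map_id; congr (strict_map _ x); apply: bool_irrelevance.
have [TU|TU] := eqVneq T U.
  by subst U; rewrite strict_map_id; congr (strict_map _ x); apply: bool_irrelevance.
have h' : S \proper T by rewrite properEneq ST h.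
have k' : T \proper U by rewrite properEneq TU k.
by rewrite (strict_mapE _ h') (strict_mapE _ k') (strict_mapE _ (proper_trans h' k')).
Qed.

Definition strict_functor : set_functor :=
  @SetFunctor X strict_map strict_map_id strict_map_comp.

End Strict.

Section Matching.
Variables (X : set_functor) (S : {set V}).

Definition above := {T : {set V} | S \proper T}.

Definition matching_mem (f : prod_cdga (fun T : above => X (val T))) : Prop :=
  forall (T U : above) (h : val T \subset val U), sf_map X h (f T) = f U.

Fact matching_dg_subalgebra : dg_subalgebra matching_mem.
Proof.
split.
- by move=> c T U h; apply: cdga_hom_unit.
- by move=> f g hf hg T U h; rewrite rmorphB hf hg.
- by move=> f g hf hg T U h; rewrite rmorphM hf hg.
- by move=> n f hf T U h; rewrite cdga_hom_proj hf.
- by move=> f hf T U h; rewrite cdga_hom_d hf.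
Qed.

(* The limit of X over the proper supersets of S. *)
Definition matching : cdga K := sub_cdga matching_dg_subalgebra.

Definition matching_pr (T : {set V}) (h : S \proper T) : cdga_hom matching (X T) :=
  hom_comp (prod_pr (fun T : above => X (val T)) (Sub T h))
           (sub_incl matching_dg_subalgebra).

Lemma matching_prE (T : above) (f : matching) :
  matching_pr (valP T) f = (\val f : prod_cdga _) T.
Proof.
case: T => T h; move: (valP _) => /= h'.
by rewrite (bool_irrelevance h' h).
Qed.

Lemma matching_ext (f g : matching) :
  (forall (T : {set V}) (h : S \proper T), matching_pr h f = matching_pr h g) -> f = g.
Proof.
move=> fg; apply: val_inj; apply: dprod_ext => T.
by rewrite -!matching_prE fg.
Qed.

Lemma matching_pr_map (T U : {set V}) (h : S \proper T) (k : S \proper U) (l : T \subset U) f :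
  sf_map X l (matching_pr h f) = matching_pr k f.
Proof. exact: ((sub_valP f : matching_mem _) (Sub T h) (Sub U k) l). Qed.

Section Pair.
Variables (B : cdga K) (r : forall T : {set V}, S \proper T -> cdga_hom B (X T)).
Hypothesis r_map : forall (T U : {set V}) (h : S \proper T) (k : S \proper U)
  (l : T \subset U) b, sf_map X l (r h b) = r k b.

Fact matching_pair_subproof b :
  matching_mem (prod_pair (fun T : above => r (valP T)) b).
Proof. by move=> T U l; apply: r_map. Qed.

Definition matching_pair : cdga_hom B matching :=
  sub_lift matching_dg_subalgebra matching_pair_subproof.

Lemma matching_pairE (T : {set V}) (h : S \proper T) b : matching_pr h (matching_pair b) = r h b.
Proof. by rewrite /= ; congr (r _ b); apply: bool_irrelevance. Qed.
End Pair.

Lemma matching_build (f : forall T : {set V}, S \proper T -> X T) :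
  (forall (T U : {set V}) (h : S \proper T) (k : S \proper U) (l : T \subset U),
     sf_map X l (f T h) = f U k) ->
  exists g : matching, forall (T : {set V}) (h : S \proper T), matching_pr h g = f T h.
Proof.
move=> fC; have hf : matching_mem (fun T : above => f (val T) (valP T)).
  by move=> T U l; apply: fC.
exists (sub_in matching_dg_subalgebra hf) => T h /=.
by congr (f _ _); apply: bool_irrelevance.
Qed.

Definition matching_map : cdga_hom (X S) matching :=
  matching_pair (r := fun T h => sf_map X (proper_sub h))
    (fun T U h k l b => sf_map_comp (proper_sub h) l (proper_sub k) b).

Lemma matching_mapE (T : {set V}) (h : S \proper T) x :
  matching_pr h (matching_map x) = sf_map X (proper_sub h) x.
Proof. exact: matching_pairE. Qed.

End Matching.

Definition reedy_at (X : set_functor) S : Prop := fibration (matching_map X S).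

(** * Making matching maps surjective on one layer of sets *)

Section Stage.
Hypothesis K0 : [pchar K] =i pred0.
Variables (X : set_functor) (Q : pred {set V}).

(** One contractible generator for each homogeneous element of the matching object, to which
    [stage_ev] sends it; this forces surjectivity at the sets in [Q]. Elsewhere the type is empty
    and the value stays that of [X] up to isomorphism. *)
Definition stage_gen S :=
  {nb : int * matching X S | Q S /\ cdga_proj (matching X S) nb.1 nb.2 = nb.2}.
Definition stage_deg S (x : stage_gen S) : int := (sval x).1.
Definition stage_obj S : cdga K := free_cdga (X S) (@stage_deg S).
Definition stage_base S : cdga_hom (X S) (stage_obj S) := free_base (X S) (@stage_deg S).

Fact stage_assignment S :
  @assignment K _ (@stage_deg S) (matching X S) (fun x => (sval x).2).
Proof. by case=> [[n b] []]. Qed.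

Definition stage_ev S : cdga_hom (stage_obj S) (matching X S) :=
  free_extend (matching_map X S) (@stage_assignment S).

Fact stage_ev_base S x : stage_ev S (stage_base S x) = matching_map X S x.
Proof. exact: free_extend_base. Qed.

(** New generators over [S] land in the image of [X T], never on new generators over [T]. Composites
    are therefore governed by matching families of [X], which makes functoriality strict. *)
Definition stage_smap (S T : {set V}) (h : S \proper T) : cdga_hom (stage_obj S) (stage_obj T) :=
  hom_comp (stage_base T) (hom_comp (matching_pr X h) (stage_ev S)).

Fact stage_smap_comp (S T U : {set V}) (h : S \proper T) (k : T \proper U)
  (l : S \proper U) x : stage_smap k (stage_smap h x) = stage_smap l x.
Proof.
rewrite [LHS](congr1 (fun y => stage_base U (matching_pr X k y)) (stage_ev_base _)).
by rewrite matching_mapE (matching_pr_map h l).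
Qed.

Definition stage : set_functor := strict_functor stage_smap_comp.

Fact stage_base_natural (S T : {set V}) (h : S \subset T) x :
  stage_base T (sf_map X h x) = sf_map stage h (stage_base S x).
Proof.
have [ST|ST] := eqVneq S T.
  by subst T; rewrite !sf_map_id.
have h' : S \proper T by rewrite properEneq ST h.
rewrite [RHS](strict_mapE _ h h') [RHS](congr1 (fun y => stage_base T (matching_pr X h' y)) (stage_ev_base x)).
by rewrite matching_mapE; congr (stage_base T (sf_map X _ x)); apply: bool_irrelevance.
Qed.

Definition stage_unit : sf_hom X stage :=
  @SfHom X stage stage_base stage_base_natural.

Fact stage_unit_quasi_iso S : quasi_iso (stage_unit S).
Proof. exact: free_base_quasi_iso. Qed.

Fact stage_base_surj T : ~~ Q T -> forall e, exists x, stage_base T x = e.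
Proof.
move=> nQ; elim/free_ind => [a|x|e e' [x <-] [y <-]|e [x <-]|e e' [x <-] [y <-]|n e [x <-]|e [x <-]].
- by exists a.
- by have [Qx _] := svalP x; case/negP: nQ.
- by exists (x + y); rewrite rmorphD.
- by exists (- x); rewrite rmorphN.
- by exists (x * y); rewrite rmorphM.
- by exists (cdga_proj _ n x); rewrite cdga_hom_proj.
- by exists (cdga_d _ x); rewrite cdga_hom_d.
Qed.

Fact stage_base_inj T : injective (stage_base T).
Proof. exact: free_base_inj. Qed.

(** Strictly above [S] the base maps are isomorphisms, so the matching object at [S] is still that
    of [X]. It is covered by the generators at [S] or by the surjectivity already present. *)
Lemma stage_reedy (S : {set V}) : (forall T : {set V}, S \proper T -> ~~ Q T) ->
  Q S \/ reedy_at X S -> reedy_at stage S.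
Proof.
move=> nQ QS e.
have [x xE] : exists x : matching X S, forall (T : {set V}) (h : S \proper T),
    stage_base T (matching_pr X h x) = matching_pr stage h e.
  pose y (T : {set V}) (h : S \proper T) := sval (cid (stage_base_surj (nQ T h) (matching_pr stage h e))).
  have yE (T : {set V}) (h : S \proper T) : stage_base T (y T h) = matching_pr stage h e.
    exact: (svalP (cid (stage_base_surj (nQ T h) (matching_pr stage h e)))).
  have [|x xE] := @matching_build X S y.
    move=> T U h k l; apply: stage_base_inj; rewrite stage_base_natural !yE.
    exact: (matching_pr_map h k l e).
  by exists x => T h; rewrite xE yE.
suff [z zE] : exists z, stage_ev S z = x.
  exists z; apply: matching_ext => T h; rewrite matching_mapE.
  by rewrite [LHS](strict_mapE _ _ h) -xE -zE.
case: QS => [QS|rS]; last by have [z <-] := rS x; exists (stage_base S z); rewrite stage_ev_base.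
have [s _ ->] := cdga_proj_sum x.
apply: (big_ind (fun b => exists z, stage_ev S z = b)) => [|_ _ [z <-] [y <-]|n _].
- by exists 0; rewrite rmorph0.
- by exists (z + y); rewrite rmorphD.
- pose g : stage_gen S := exist _ (n, cdga_proj _ n x) (conj QS (cdga_proj_id n x)).
  by exists (free_gen (X S) (@stage_deg S) g); rewrite [LHS]free_extend_gen.
Qed.

End Stage.

Lemma quasi_iso_comp (A B C : cdga K) (g : cdga_hom B C) (f : cdga_hom A B) :
  quasi_iso f -> quasi_iso g -> quasi_iso (hom_comp g f).
Proof.
move=> [f1 f2] [g1 g2]; split=> [a da [c gfa]|c dc].
  apply: f1 => //; apply: g1; last by exists c.
  by rewrite -cdga_hom_d da rmorph0.
have [b [db [z zE]]] := g2 c dc; have [a [da [y yE]]] := f2 b db.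
exists a; split=> //; exists (g y + z).
by rewrite raddfD /= -cdga_hom_d -yE -zE rmorphB addrA subrK.
Qed.

Lemma hom_id_quasi_iso (A : cdga K) : quasi_iso (hom_id A).
Proof.
split=> [a da [b ab]|a da]; first by exists b.
by exists a; split=> //; exists 0; rewrite subrr raddf0.
Qed.

Fact sf_hom_comp_natural X Y Z (g : sf_hom Y Z) (f : sf_hom X Y) (S T : {set V})
    (h : S \subset T) x :
  hom_comp (g T) (f T) (sf_map X h x) = sf_map Z h (hom_comp (g S) (f S) x).
Proof. by rewrite /= !sf_hom_natural. Qed.

Definition sf_hom_comp X Y Z (g : sf_hom Y Z) (f : sf_hom X Y) : sf_hom X Z :=
  @SfHom X Z (fun S => hom_comp (g S) (f S)) (sf_hom_comp_natural g f).

Definition sf_hom_id X : sf_hom X X :=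
  @SfHom X X (fun S => hom_id (X S)) (fun _ _ _ _ => erefl).

(** Matching objects see strictly larger sets only. Hence generators at the sets of size #|V| - k
    leave the matching objects of these sets and of all larger ones unchanged up to isomorphism, and
    surjectivity gained earlier is not lost. *)
Lemma reedy_replacement (K0 : [pchar K] =i pred0) (X : set_functor) :
  exists (Y : set_functor) (f : sf_hom X Y),
    (forall S, quasi_iso (f S)) /\ (forall S, reedy_at Y S).
Proof.
suff /(_ #|V|.+1) [Y [f [qf rY]]] : forall k, exists (Y : set_functor) (f : sf_hom X Y),
    (forall S, quasi_iso (f S)) /\ (forall S : {set V}, (#|V| < #|S| + k)%N -> reedy_at Y S).
  by exists Y, f; split=> // S; apply: rY; rewrite addnS ltnS leq_addl.
elim=> [|k [Y [f [qf rY]]]].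
  exists X, (sf_hom_id X); split=> [S|S]; first exact: hom_id_quasi_iso.
  by rewrite addn0 ltnNge max_card.
pose Q (S : {set V}) := (#|S| + k == #|V|)%N.
exists (stage Y Q), (sf_hom_comp (stage_unit Y Q) f); split=> S.
  by apply: quasi_iso_comp => //; apply: stage_unit_quasi_iso.
rewrite addnS ltnS => hS; apply: stage_reedy => [T /proper_card ST|].
  by rewrite /Q; lia.
by have [QS|nQ] := boolP (Q S); [left|right; apply: rY; rewrite /Q in nQ; lia].
Qed.

End SetFunctors.

(** * Cech complexes *)

Section Positions.
Variable V : finType.
Implicit Types (i j : V) (S T : {set V}).

(** The signs of the set-indexed complex follow the enumeration of [V], independently of the order
    [le] that indexes the Cech nerve. *)
Definition pos i j : nat := (enum_rank i < enum_rank j)%N.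

Definition npos i T : nat := (\sum_(j in T) pos j i)%N.

Lemma posC i j : i != j -> (pos i j + pos j i = 1)%N.
Proof.
move=> ij; rewrite /pos.
have : (enum_rank i : nat) != enum_rank j.
  by rewrite val_eqE (inj_eq enum_rank_inj).
by case: ltngtP.
Qed.

Lemma npos_D1 i j T : j \in T -> npos i T = (pos j i + npos i (T :\ j))%N.
Proof. by move=> jT; rewrite /npos (big_setD1 j). Qed.

Lemma nposU1 i T : npos i (i |: T) = npos i T.
Proof.
have pii : pos i i = 0%N by rewrite /pos ltnn.
have [iT|iT] := boolP (i \in T); first by rewrite (setUidPr _) ?sub1set.
by rewrite /npos big_setU1 //= pii.
Qed.

Lemma setU1_D1 i j T : i != j -> (i |: T) :\ j = i |: (T :\ j).
Proof.
move=> ij; apply/setP => k; rewrite !inE.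
by case: (k =P i) => [->|]; rewrite ?ij.
Qed.

End Positions.

Section Cochains.
Variables (K : fieldType) (K0 : [pchar K] =i pred0) (V : finType).
Local Notation set_functor := (set_functor K V).
Implicit Types X Y : set_functor.

Definition cochain X : cdga K := prod_cdga (fun S : {set V} => X S).

Section Differential.
Variable X : set_functor.
Implicit Types f g : cochain X.
Implicit Types S T U W : {set V}.

(** The default value 0 for non-inclusions keeps inclusion proofs out of the sums that define
    [delta]. *)
Definition res f (S T : {set V}) : X T :=
  match decP (@idP (S \subset T)) with
  | left h => sf_map X h (f S)
  | right _ => 0
  end.

Lemma resE f S T (h : S \subset T) : res f S T = sf_map X h (f S).
Proof.
by rewrite /res; case: decP => // h'; congr (sf_map X _ _); apply: bool_irrelevance.
Qed.

Lemma res_id f S : res f S S = f S.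
Proof. by rewrite (resE f (subxx S)) sf_map_id. Qed.

Lemma res_map f (S T U : {set V}) (h : T \subset U) :
  S \subset T -> sf_map X h (res f S T) = res f S U.
Proof.
move=> ST; rewrite (resE f ST) (resE f (subset_trans ST h)).
exact: sf_map_comp.
Qed.

Lemma resB f g S T : res (f - g) S T = res f S T - res g S T.
Proof. by rewrite /res; case: decP => h; rewrite ?subr0 // -rmorphB. Qed.

Lemma resD f g S T : res (f + g) S T = res f S T + res g S T.
Proof. by rewrite /res; case: decP => h; rewrite ?addr0 // -rmorphD. Qed.

Lemma res_d f S T : res (cdga_d _ f) S T = cdga_d (X T) (res f S T).
Proof. by rewrite /res; case: decP => h; rewrite ?cdga_d0 // -cdga_hom_d. Qed.

Lemma res0 f S T : f S = 0 -> res f S T = 0.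
Proof. by move=> fS; rewrite /res; case: decP => h; rewrite // fS rmorph0. Qed.

Definition delta f : cochain X :=
  fun T => \sum_(i in T) (-1) ^+ npos i T * res f (T :\ i) T.

Lemma deltaE f T : delta f T = \sum_(i in T) (-1) ^+ npos i T * res f (T :\ i) T.
Proof. by []. Qed.

Lemma cochain_ext f g : (forall S, f S = g S) -> f = g.
Proof. exact: dprod_ext. Qed.

Lemma deltaB f g : delta (f - g) = delta f - delta g.
Proof.
apply: cochain_ext => T; rewrite [RHS](_ : _ = delta f T - delta g T) // !deltaE -sumrB.
by apply: eq_bigr => i _; rewrite resB mulrBr.
Qed.

Lemma delta0 : delta 0 = 0.
Proof. by rewrite -{1}(subrr (0 : cochain X)) deltaB subrr. Qed.

Lemma deltaN f : delta (- f) = - delta f.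
Proof. by rewrite -sub0r deltaB delta0 sub0r. Qed.

Lemma deltaD f g : delta (f + g) = delta f + delta g.
Proof.
apply: cochain_ext => T; rewrite [RHS](_ : _ = delta f T + delta g T) // !deltaE -big_split.
by apply: eq_bigr => i _; rewrite resD mulrDr.
Qed.

Lemma delta_d f : delta (cdga_d _ f) = cdga_d _ (delta f).
Proof.
apply: cochain_ext => T; rewrite [RHS](_ : _ = cdga_d (X T) (delta f T)) // !deltaE.
by rewrite raddf_sum; apply: eq_bigr => i _; rewrite res_d; apply: esym; apply: d_sign.
Qed.

Lemma res_delta f T U : T \subset U ->
  res (delta f) T U = \sum_(i in T) (-1) ^+ npos i T * res f (T :\ i) U.
Proof.
move=> TU; rewrite (resE _ TU) deltaE rmorph_sum; apply: eq_bigr => i iT.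
by rewrite rmorphM rmorphXn rmorphN1 (res_map _ _ (subD1set T i)).
Qed.

(** Removing two elements in either order gives opposite signs. The double sum is thus its own
    opposite, and characteristic 0 allows division by 2. *)
Lemma delta_delta f : delta (delta f) = 0.
Proof.
apply: cochain_ext => T.
pose a i j : X T := if [&& i \in T, j \in T & i != j]
  then (-1) ^+ (npos i T + npos j (T :\ i)) * res f (T :\ i :\ j) T else 0.
have aC i j : a i j = - a j i.
  rewrite /a [in RHS]andbCA [j == i]eq_sym.
  case: and3P => [[iT jT ij]|_]; last by rewrite oppr0.
  rewrite !setDDl [[set j] :|: [set i]]setUC -mulNr; congr (_ * _).
  rewrite (npos_D1 i jT) (npos_D1 j iT) -[- (_ ^+ _)]mulN1r -exprS.
  rewrite -signr_odd -[RHS]signr_odd; congr (_ ^+ _); congr nat_of_bool.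
  have := posC ij; lia.
have -> : delta (delta f) T = \sum_i \sum_j a i j.
  rewrite deltaE big_mkcond; apply: eq_bigr => i _.
  case: ifP => [iT|iT]; last by rewrite big1 // => j _; rewrite /a iT.
  rewrite res_delta ?subD1set // mulr_sumr big_mkcond; apply: eq_bigr => j _.
  rewrite /a iT /= !inE [j == i]eq_sym andbC.
  by case: ifP => _; rewrite // mulrA exprD.
apply: (mulrn_inj0 K0 (k := 2)) => //; rewrite mulr2n.
rewrite [X in X + _]exchange_big -big_split big1 // => i _.
rewrite -big_split big1 // => j _ /=.
by rewrite aC addNr.
Qed.

(** Sets of size n are the simplices of dimension n - 1, so size 0 is the augmentation. *)
Definition sized n f : Prop := forall S : {set V}, #|S| != n -> f S = 0.

Lemma sizedB n f g : sized n f -> sized n g -> sized n (f - g).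
Proof.
move=> hf hg S Sn; rewrite [LHS](_ : _ = f S - g S) //.
by rewrite hf // hg // subr0.
Qed.

Lemma sizedD n f g : sized n f -> sized n g -> sized n (f + g).
Proof.
move=> hf hg S Sn; rewrite [LHS](_ : _ = f S + g S) //.
by rewrite hf // hg // addr0.
Qed.

Lemma sized_d n f : sized n f -> sized n (cdga_d _ f).
Proof.
by move=> hf S Sn; rewrite [LHS](_ : _ = cdga_d (X S) (f S)) // hf // cdga_d0.
Qed.

Lemma sized_delta n f : sized n f -> sized n.+1 (delta f).
Proof.
move=> hf T Tn; rewrite deltaE big1 // => i iT; rewrite res0 ?mulr0 //.
by apply: hf; rewrite (cardsD1 i T) iT in Tn.
Qed.

Lemma sized_large n f : (#|V| < n)%N -> sized n f -> f = 0.
Proof.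
move=> Vn hf; apply: cochain_ext => S; apply: hf.
by rewrite neq_ltn (leq_ltn_trans (max_card _) Vn).
Qed.

Lemma cocycle_cone f i (T W : {set V}) : delta f = 0 -> i \notin T -> i |: T \subset W ->
  \sum_(j in T) (-1) ^+ (npos j T + npos i (i |: (T :\ j))) *
    res f (i |: (T :\ j)) W = res f T W.
Proof.
move=> df iT UW; have : res (delta f) (i |: T) W = 0 by rewrite df res0.
rewrite res_delta // big_setU1 //= setU1K // nposU1.
move/eqP; rewrite addr_eq0 => /eqP h.
rewrite -[RHS](signrMK (npos i T)) h mulrN -mulNr mulr_sumr.
apply: eq_bigr => j jT.
have ij : i != j by apply: contraNneq iT => ->.
rewrite setU1_D1 // mulrA; congr (_ * _).
have iU : i \in i |: T by rewrite setU11.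
rewrite (npos_D1 j iU) setU1K // -[- (_ ^+ _)]mulN1r -mulrA -exprD -exprS.
rewrite (npos_D1 i jT) nposU1.
rewrite -signr_odd -[RHS]signr_odd; congr (_ ^+ _); congr nat_of_bool.
have := posC ij; lia.
Qed.

(** Size 0 is left out: there the cocycles are the elements at the empty set that vanish at every
    vertex, and they are dealt with in [kernel_acyclic]. *)
Definition rows_exact : Prop := forall n f, sized n.+1 f -> delta f = 0 ->
  exists2 g, sized n g & delta g = f.

End Differential.

(** * Exactness from a partition of unity *)

Section PartitionOfUnity.
Variables (X : set_functor) (W : cdga K) (emb : forall S, cdga_hom (X S) W).
Hypothesis emb_inj : forall S, injective (emb S).
Hypothesis emb_map : forall (S T : {set V}) (h : S \subset T) x,
  emb T (sf_map X h x) = emb S x.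
Variables (u : V -> W) (u_sum : \sum_i u i = 1).
Hypothesis u_emb : forall i (S : {set V}) x, exists y, emb S y = u i * emb (i |: S) x.

Lemma emb_res (f : cochain X) (S T : {set V}) : S \subset T ->
  emb T (res f S T) = emb S (f S).
Proof. by move=> h; rewrite (resE f h) emb_map. Qed.

(** The classical homotopy, a signed sum of u_i f(i |: S) over i outside S. Products are formed in
    the ambient [W], because f(i |: S) need not come from X S; multiplication by u_i brings it back
    by [u_emb], as extension by zero does for sheaves. *)
Lemma partition_of_unity_exact : rows_exact X.
Proof.
move=> n f fn df.
pose e (i : V) (S : {set V}) : X S := sval (cid (@u_emb i S (f (i |: S)))).
have eE i S : emb S (e i S) = u i * emb (i |: S) (f (i |: S)).
  exact: (svalP (cid (@u_emb i S (f (i |: S))))).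
pose g : cochain X := fun S =>
  if #|S| == n then \sum_(i | i \notin S) (-1) ^+ npos i S * e i S else 0.
have gn : sized n g by move=> S /negPf Sn; rewrite /g Sn.
exists g => //; apply: cochain_ext => T.
have [Tn|Tn] := eqVneq #|T| n.+1; last first.
  by rewrite (fn _ Tn); apply: (sized_delta gn).
apply: emb_inj; rewrite deltaE rmorph_sum /=.
(* In [delta g] the term that removes j and puts it back contributes u_j f(T); the others cone T
   without j by some i outside T. *)
have step j : j \in T -> emb T ((-1) ^+ npos j T * res g (T :\ j) T) =
    u j * emb T (f T) + \sum_(i | i \notin T) (-1) ^+ (npos j T + npos i (T :\ j)) *
      (u i * emb _ (f (i |: (T :\ j)))).
  move=> jT; have Tj : #|T :\ j| == n by apply/eqP; have := cardsD1 j T; rewrite jT Tn; lia.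
  rewrite rmorphM rmorphXn rmorphN1 emb_res ?subD1set // /g Tj rmorph_sum /=.
  rewrite (bigD1 j) ?inE ?eqxx //= rmorphM rmorphXn rmorphN1 eE mulrDr setD1K //.
  rewrite {1}(npos_D1 j jT) /pos ltnn add0n signrMK; congr (_ + _).
  rewrite mulr_sumr; apply: eq_big => [i|i].
    by rewrite !inE negb_and negbK; case: (i =P j) => [->|] /=; rewrite ?jT ?andbF ?andbT.
  by move=> _; rewrite rmorphM rmorphXn rmorphN1 eE mulrA exprD.
rewrite (eq_bigr _ step) big_split /= exchange_big /=.
(* f(T) becomes the sum of all u_i f(T). Indices in T match the terms u_j f(T) just isolated; each
   index outside T is an instance of [cocycle_cone]. *)
rewrite -[RHS]mul1r -[X in _ = X * _]u_sum mulr_suml [RHS](bigID (fun i => i \in T)) /=.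
congr (_ + _); apply: eq_bigr => i iT.
transitivity (u i * \sum_(j in T) (-1) ^+ (npos j T + npos i (i |: (T :\ j))) *
    emb _ (f (i |: (T :\ j)))).
  rewrite mulr_sumr; apply: eq_bigr => j jT; rewrite nposU1 [LHS]mulrA sign_comm.
  by rewrite -mulrA.
congr (_ * _); have h := subxx (i |: T).
rewrite -(emb_res f (subsetUr [set i] T)) -(cocycle_cone df iT h) rmorph_sum /=.
apply: eq_bigr => j jT; rewrite rmorphM rmorphXn rmorphN1 emb_res //.
by rewrite setUS ?subD1set.
Qed.

End PartitionOfUnity.

End Cochains.

(** * Exactness from surjective matching maps *)

Section ReedyExact.
Variables (K : fieldType) (K0 : [pchar K] =i pred0) (V : finType).
Variables (X : set_functor K V).
Hypothesis X_reedy : forall S, reedy_at X S.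
Implicit Types (S T U : {set V}) (f g : cochain X).

Definition up_closed (Q : pred {set V}) : Prop :=
  forall S T, S \subset T -> Q S -> Q T.

(** Everything strictly above a largest set S outside [Q] lies in [Q], so the given values form an
    element of the matching object at S; surjectivity of the matching map supplies a value at S, and
    [Q] grows by one set. *)
Lemma reedy_extend (Q : pred {set V}) (a : cochain X) : up_closed Q ->
  (forall S T (h : S \subset T), Q S -> sf_map X h (a S) = a T) ->
  exists b : cochain X, (forall S T (h : S \subset T), sf_map X h (b S) = b T) /\
    (forall S, Q S -> b S = a S).
Proof.
have [n] := ubnP #|[set S | ~~ Q S]|; elim: n Q a => [//|n IHn] Q a Qn Qup aQ.
have [/eqP Q0|[S0]] := set_0Vmem [set S | ~~ Q S].
  have Qall S : Q S.
    have: S \notin [set S | ~~ Q S] by rewrite (eqP Q0) inE.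
    by rewrite inE negbK.
  by exists a; split=> // S T h; apply: aQ.
rewrite inE => S0Q.
case: (@arg_maxnP _ S0 (fun S => ~~ Q S) (fun S => #|S|) S0Q) => S SQ Smax.
have aboveQ T : S \proper T -> Q T.
  move=> /proper_card ST; apply: contraTT ST => /Smax.
  by rewrite -leqNgt.
have [m mE] : exists m : matching X S, forall T (h : S \proper T), matching_pr X h m = a T.
  apply: (@matching_build _ _ X S (fun T _ => a T)) => T U h k l.
  exact: aQ (aboveQ _ h).
have [x xE] := X_reedy m.
pose a' : cochain X := dfwith (a : forall S, X S) x.
have a'S : a' S = x by apply: dfwith_in.
have a'T T : S != T -> a' T = a T by move=> ST; apply: dfwith_out.
pose Q' T := Q T || (T == S).
have QS T : Q T -> S != T by apply: contraTneq => <-.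
have [|||b [bC bQ]] := IHn Q' a'.
- rewrite ltnS in Qn; apply: leq_trans Qn; apply: proper_card.
  apply/properP; split.
    by apply/subsetP => T; rewrite !inE /Q' negb_or => /andP[].
  by exists S; rewrite !inE // /Q' eqxx orbT.
- move=> T U TU; rewrite /Q'; case/orP => [QT|/eqP TS].
    by rewrite (Qup _ _ TU QT).
  have [->|US] := eqVneq U S; first by rewrite orbT.
  by rewrite aboveQ // properEneq eq_sym US -TS TU.
- move=> T U h; rewrite /Q'; case/orP => [QT|/eqP TS].
    rewrite !a'T; [exact: aQ|exact: (QS _ (Qup _ _ h QT))|exact: QS].
  subst T; rewrite a'S; have [US|US] := eqVneq S U.
    by subst U; rewrite sf_map_id a'S.
  have SU : S \proper U by rewrite properEneq US h.
  rewrite a'T // -(mE U SU) -xE matching_mapE.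
  by congr (sf_map X _ x); apply: bool_irrelevance.
exists b; split=> // T QT; rewrite bQ ?a'T //; first exact: QS.
by rewrite /Q' QT.
Qed.

(** The restrictions of z - delta y to the members T' of an up-closed family are killed by adding
    one minimal set S at a time. Once restricted to a fixed nonempty S, cochains on the subsets of S
    form the complex of a full simplex with constant coefficients X S, which coning with a point s
    of S contracts. *)
Lemma reedy_rows_exact : rows_exact X.
Proof.
move=> n z zn dz.
suff claim k (Q : pred {set V}) : (#|Q| < k)%N -> up_closed Q ->
    exists y : cochain X, sized n y /\
      forall T T', Q T' -> T \subset T' -> res (z - delta y) T T' = 0.
  have [||y [yn yz]] := claim #|{: {set V}}|.+1 xpredT; rewrite ?ltnS ?max_card //.
  exists y => //; apply/eqP; rewrite eq_sym -subr_eq0; apply/eqP.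
  by apply: cochain_ext => T; rewrite -[LHS]res_id yz.
elim: k Q => [//|k IHk] Q Qk Qup.
have [S0 S0Q|Q0] := pickP Q; last first.
  by exists 0; split=> [S|T T'] //; rewrite Q0.
case: (@arg_minnP _ S0 Q (fun S => #|S|) S0Q) => S SQ Smin.
pose Q0 T := Q T && (T != S).
have aboveS T : S \subset T -> S != T -> Q0 T.
  by move=> h ST; rewrite /Q0 (Qup _ _ h SQ) eq_sym.
have [||y [yn yQ]] := IHk Q0.
- rewrite ltnS in Qk; apply: leq_trans Qk; apply: proper_card.
  apply/properP; split; first by apply/subsetP => T; rewrite !unfold_in /Q0 => /andP[].
  by exists S; rewrite !unfold_in /Q0 ?eqxx ?andbF.
- move=> T U TU /andP[QT TS]; rewrite /Q0 (Qup _ _ TU QT).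
  apply: contraNneq TS => US; rewrite US in TU.
  by rewrite eqEcard TU Smin.
pose w : cochain X := z - delta y.
have wn : sized n.+1 w by apply: sizedB => //; apply: sized_delta.
have dw : delta w = 0 by rewrite deltaB dz delta_delta // subrr.
have wQ T T' : Q0 T' -> T \subset T' -> res w T T' = 0 by apply: yQ.
(* The correction has to settle S without disturbing the larger sets already settled. *)
suff [y' [y'n [y'Q y'S]]] : exists y' : cochain X, sized n y' /\
    (forall T T', Q0 T' -> T \subset T' -> res y' T T' = 0) /\
    (forall T, T \subset S -> res (delta y') T S = res w T S).
  exists (y + y'); split; first exact: sizedD.
  move=> T T' QT' TT'; rewrite deltaD opprD addrA -/w resB.
  have [T'S|T'S] := eqVneq T' S.
    by subst T'; rewrite y'S // subrr.
  have Q0T' : Q0 T' by rewrite /Q0 QT' T'S.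
  rewrite wQ // res_delta // big1 ?subr0 // => i _; rewrite y'Q ?mulr0 //.
  exact: subset_trans (subD1set _ _) TT'.
have [S_0|[s sS]] := set_0Vmem S.
  exists 0; split=> [T|] //; split=> [T T' _ _|T]; first by rewrite res0.
  rewrite S_0 subset0 => /eqP ->.
  rewrite res_delta ?sub0set // big_set0 res0 // wn // cards0 //.
(* The cone primitive of w restricted to S. It dies on the sets strictly above S because w does; it
   can therefore be extended by 0 over them and then lifted down to a value at T itself. *)
pose b T : X S := if [&& T \subset S, #|T| == n & s \notin T]
  then (-1) ^+ npos s T * res w (s |: T) S else 0.
have bmap T T' (h : S \subset T') : Q0 T' -> sf_map X h (b T) = 0.
  move=> QT'; rewrite /b; case: ifP => [/and3P[TS _ _]|_]; last by rewrite rmorph0.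
  have sTS : s |: T \subset S by rewrite subUset sub1set sS.
  rewrite rmorphM rmorphXn rmorphN1 res_map // wQ ?mulr0 //.
  exact: subset_trans sTS h.
have lift T : {c : cochain X | [/\ forall S T (h : S \subset T), sf_map X h (c S) = c T,
    c S = b T & forall T', Q0 T' -> c T' = 0]}.
  apply: cid; pose a : cochain X := dfwith (fun S => 0 : X S) (b T).
  have aS : a S = b T by apply: dfwith_in.
  have aT T' : S != T' -> a T' = 0 by move=> h; apply: (@dfwith_out _ _ (fun S => 0 : X S)).
  have [//||c [cC cQ]] := @reedy_extend Q a.
    move=> T1 T2 h QT1; have [T1S|T1S] := eqVneq S T1.
      subst T1; rewrite aS; have [T2S|T2S] := eqVneq S T2.
        by subst T2; rewrite sf_map_id aS.
      by rewrite aT // bmap // aboveS.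
    rewrite (aT T1) // rmorph0 aT //; apply: contraNneq T1S => T2S; subst T2.
    by rewrite eq_sym eqEcard h Smin.
  exists c; split=> // [|T' /andP[QT' T'S]]; first by rewrite cQ.
  by rewrite cQ // aT // eq_sym.
pose y' : cochain X := fun T =>
  if [&& T \subset S, #|T| == n & s \notin T] then sval (lift T) T else 0.
have y'n : sized n y' by move=> T /negPf Tn; rewrite /y' Tn /= andbF.
have res_y' T T' : T \subset T' ->
    res y' T T' = if [&& T \subset S, #|T| == n & s \notin T] then sval (lift T) T' else 0.
  move=> h; rewrite (resE _ h) /y'; case: ifP => _; last by rewrite rmorph0.
  by have [cC _ _] := svalP (lift T); rewrite cC.
have y'S T : T \subset S -> res y' T S = b T.
  move=> TS; rewrite res_y' //; have [_ cS _] := svalP (lift T).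
  by rewrite cS /b; case: [&& _, _ & _].
exists y'; split=> //; split=> [T T' QT' TT'|T TS].
  rewrite res_y' //; case: ifP => // _.
  by have [_ _ c0] := svalP (lift T); rewrite c0.
have [Tn|Tn] := eqVneq #|T| n.+1; last first.
  by rewrite (res0 _ (wn _ Tn)) res0 //; apply: sized_delta Tn.
have Dn i : i \in T -> #|T :\ i| == n.
  by move=> iT; apply/eqP; have := cardsD1 i T; rewrite iT Tn; lia.
have DS i : T :\ i \subset S by exact: subset_trans (subD1set _ _) TS.
rewrite res_delta //.
(* [b] vanishes on sets containing s, so for s in T only the term removing s survives; otherwise the
   identity is [cocycle_cone]. *)
have [sT|sT] := boolP (s \in T).
  rewrite (bigD1 s) //= big1 ?addr0 => [|i /andP[iT si]]; last first.
    by rewrite y'S // /b !inE [s == i]eq_sym si sT !andbF mulr0.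
  rewrite y'S // /b DS Dn // !inE eqxx /= setD1K //.
  by rewrite {1}(npos_D1 s sT) /pos ltnn add0n signrMK.
rewrite -(cocycle_cone dw sT); last by rewrite subUset sub1set sS.
apply: eq_bigr => i iT.
rewrite y'S // /b DS Dn //= !inE (negPf sT) andbF /=.
by rewrite nposU1 mulrA exprD.
Qed.

End ReedyExact.

(** * Comparison of cocycles and of limits *)

Section LimitComparison.
Variables (K : fieldType) (K0 : [pchar K] =i pred0) (V : finType).
Variables (X Y : set_functor K V) (F : sf_hom X Y).
Hypothesis F_qi : forall S, quasi_iso (F S).
Hypotheses (X_exact : rows_exact X) (Y_exact : rows_exact Y).
Implicit Types (S T U : {set V}).

Definition cochain_map : cdga_hom (cochain X) (cochain Y) :=
  prod_pair (fun S => hom_comp (F S) (prod_pr (fun S : {set V} => X S) S)).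
Local Notation j := cochain_map.

Lemma cochain_mapE x S : j x S = F S (x S).
Proof. by []. Qed.

Lemma cochain_map_res x S T : res (j x) S T = F T (res x S T).
Proof.
rewrite /res; case: decP => h; last by rewrite rmorph0.
by rewrite sf_hom_natural.
Qed.

Lemma cochain_map_delta x : j (delta x) = delta (j x).
Proof.
apply: cochain_ext => T; rewrite cochain_mapE !deltaE rmorph_sum.
by apply: eq_bigr => i _; rewrite rmorphM rmorphXn rmorphN1 cochain_map_res.
Qed.

Lemma cochain_map_sized n x : sized n x -> sized n (j x).
Proof. by move=> xn S Sn; rewrite cochain_mapE xn // rmorph0. Qed.

Lemma cochain_lift (Z : set_functor K V) n (P : forall S, Z S -> Prop) :
  (forall S, exists x, P S x) -> (forall S, #|S| != n -> P S 0) ->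
  exists x : cochain Z, sized n x /\ forall S, P S (x S).
Proof.
move=> hP P0; pose x : cochain Z := fun S =>
  if #|S| == n then sval (cid (hP S)) else 0.
exists x; split=> S; first by move=> /negPf Sn; rewrite /x Sn.
by rewrite /x; case: ifPn => [_|/P0 //]; apply: (svalP (cid (hP S))).
Qed.

Local Notation dX := (cdga_d (cochain X)).
Local Notation dY := (cdga_d (cochain Y)).

Lemma level_inj n x : sized n x -> dX x = 0 -> (exists y, j x = dY y) ->
  exists2 x', sized n x' & x = dX x'.
Proof.
move=> xn dx [y jx].
have [S|S Sn|x' [x'n x'E]] := @cochain_lift X n (fun S a => x S = cdga_d (X S) a).
- have [qi _] := F_qi S; apply: qi; first exact: (congr1 (fun f : cochain X => f S) dx).
  by exists (y S); apply: (congr1 (fun f : cochain Y => f S) jx).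
- by rewrite xn // cdga_d0.
- by exists x' => //; apply: cochain_ext.
Qed.

Lemma level_surj n y : sized n y -> dY y = 0 ->
  exists x, [/\ sized n x, dX x = 0 & exists2 z, sized n z & j x - y = dY z].
Proof.
move=> yn dy.
have [S|S Sn|x [xn xE]] := @cochain_lift X n (fun S a => cdga_d (X S) a = 0 /\
    exists z, F S a - y S = cdga_d (Y S) z).
- have [_ qi] := F_qi S; apply: qi; exact: (congr1 (fun f : cochain Y => f S) dy).
- split; first by rewrite cdga_d0.
  by exists 0; rewrite rmorph0 yn // subrr cdga_d0.
have [S|S Sn|z [zn zE]] := @cochain_lift Y n (fun S a => F S (x S) - y S = cdga_d (Y S) a).
- by have [_ []] := xE S => z hz; exists z.
- by rewrite xn // yn // rmorph0 subrr cdga_d0.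
exists x; split=> //.
  by apply: cochain_ext => S; have [] := xE S.
by exists z => //; apply: cochain_ext.
Qed.

(** Cocycles of a fixed size form a complex but not a subalgebra, so [quasi_iso] does not apply and
    its two clauses are spelled out. *)
Definition cocycles_qi n : Prop :=
  (forall x, sized n x -> delta x = 0 -> dX x = 0 ->
     (exists y, [/\ sized n y, delta y = 0 & j x = dY y]) ->
     exists x', [/\ sized n x', delta x' = 0 & x = dX x']) /\
  (forall y, sized n y -> delta y = 0 -> dY y = 0 ->
     exists x, [/\ sized n x, delta x = 0, dX x = 0 &
       exists z, [/\ sized n z, delta z = 0 & j x - y = dY z]]).

(** Write C^n for cochains of size n and Z^n for the cocycles among them. By exactness of the rows,
    0 -> Z^n -> C^n -> Z^(n+1) -> 0 is exact; on C^n the map is a quasi-isomorphism componentwise.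
    What follows is the five lemma on elements. *)
Lemma cocycles_qi_step n : cocycles_qi n.+1 -> cocycles_qi n.
Proof.
move=> [inj_qi surj_qi]; split=> [x xn dlx dx [y [yn dly jx]]|y yn dly dy].
  have [|f1 f1n xE] := level_inj xn dx; first by exists y.
  (* Changing [f1] by a cocycle [c] of the internal differential makes [j f2] equal to [y] up to a
     boundary. Then [delta f2] bounds in [Y], as [inj_qi] demands. *)
  have [||c [cn dc [h hn hE]]] := @level_surj n (j f1 - y).
  - by apply: sizedB => //; apply: cochain_map_sized.
  - by rewrite cdga_dB -cdga_hom_d -xE jx subrr.
  pose f2 := f1 - c.
  have f2n : sized n f2 by apply: sizedB.
  have df2 : dX f2 = x by rewrite cdga_dB dc subr0.
  have jf2 : j f2 = y - dY h by rewrite -hE rmorphB opprB addrA [y + _]addrC subrK.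
  have [||||e [en dle eE]] := inj_qi (delta f2).
  - exact: sized_delta.
  - exact: delta_delta.
  - by rewrite -delta_d df2.
  - exists (- delta h); split.
    + by rewrite -sub0r; apply: sizedB => //; apply: sized_delta.
    + by rewrite deltaN delta_delta // oppr0.
    + by rewrite cochain_map_delta jf2 deltaB dly sub0r delta_d cdga_dN.
  have [e' e'n e'E] := X_exact en dle.
  exists (f2 - dX e'); split.
  - by apply: sizedB => //; apply: sized_d.
  - by rewrite deltaB delta_d e'E -eE subrr.
  - by rewrite cdga_dB cdga_dd subr0 df2.
have [c [cn dc [h hn hE]]] := level_surj yn dy.
have jc : j c = y + dY h by rewrite -hE addrC subrK.
have [||||e [en dle eE]] := inj_qi (delta c).
- exact: sized_delta.
- exact: delta_delta.
- by rewrite -delta_d dc delta0.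
- exists (delta h); split; [exact: sized_delta|exact: delta_delta|].
  by rewrite cochain_map_delta jc deltaD dly add0r delta_d.
have [e' e'n e'E] := X_exact en dle.
pose c1 := c - dX e'; pose h1 := h - j e'.
have c1n : sized n c1 by apply: sizedB => //; apply: sized_d.
have dc1 : dX c1 = 0 by rewrite cdga_dB cdga_dd dc subr0.
have dlc1 : delta c1 = 0 by rewrite deltaB delta_d e'E -eE subrr.
have h1n : sized n h1 by apply: sizedB => //; apply: cochain_map_sized.
have jc1 : j c1 - y = dY h1.
  by rewrite rmorphB cdga_dB cdga_hom_d -hE addrAC.
(* [h1] need not be closed under [delta]. Its coboundary is a cocycle of [Y] in size n + 1, and
   surjectivity there yields the correction of [c1] and [h1]. *)
have [||| m [mn dlm dm [k [kn dlk mk]]]] := surj_qi (delta h1).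
- exact: sized_delta.
- exact: delta_delta.
- by rewrite -delta_d -jc1 deltaB dly subr0 -cochain_map_delta dlc1 rmorph0.
have [m' m'n m'E] := X_exact mn dlm.
have [k' k'n k'E] := Y_exact kn dlk.
exists (c1 - dX m'); split.
- by apply: sizedB => //; apply: sized_d.
- by rewrite deltaB dlc1 delta_d m'E dm subrr.
- by rewrite cdga_dB dc1 cdga_dd subrr.
exists (h1 - j m' + dY k'); split.
- apply: sizedD; last exact: sized_d.
  by apply: sizedB => //; apply: cochain_map_sized.
- by rewrite deltaD deltaB -cochain_map_delta m'E delta_d k'E -mk addrA subrK subrr.
- by rewrite cdga_dD cdga_dd addr0 cdga_dB -jc1 rmorphB cdga_hom_d addrAC.
Qed.

Lemma cocycles_qi_all n : cocycles_qi n.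
Proof.
have [m] := ubnP (#|V|.+1 - n); elim: m n => [//|m IHm] n nm.
have [Vn|nV] := ltnP #|V| n; last first.
  by apply: cocycles_qi_step; apply: IHm; lia.
split=> [x /(sized_large Vn) -> _ _ _|y /(sized_large Vn) -> _ _].
  by exists 0; split=> //; rewrite ?cdga_d0 ?delta0.
exists 0; split; rewrite ?cdga_d0 ?delta0 //.
by exists 0; split; rewrite ?cdga_d0 ?delta0 // rmorph0 subrr.
Qed.

(** Such elements are the cocycles of size 0. [X] has no nonzero ones by the last hypothesis, so the
    quasi-isomorphism in size 0 makes those of [Y] an acyclic complex. *)
Lemma kernel_acyclic (y : Y set0) : (forall T (h : set0 \subset T), T != set0 -> sf_map Y h y = 0) ->
  cdga_d (Y set0) y = 0 ->
  (forall x : X set0, (forall i (h : set0 \subset [set i]), sf_map X h x = 0) -> x = 0) ->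
  exists z : Y set0, (forall T (h : set0 \subset T), T != set0 -> sf_map Y h z = 0) /\
    y = cdga_d (Y set0) z.
Proof.
move=> y0 dy Xinj; pose f : cochain Y := dfwith (fun S => 0 : Y S) y.
have f0 : f set0 = y by apply: dfwith_in.
have fT T : set0 != T -> f T = 0 by apply: (@dfwith_out _ _ (fun S => 0 : Y S)).
have fn : sized 0 f by move=> T; rewrite cards_eq0 eq_sym => /fT.
have [] := cocycles_qi_all 0 => _ /(_ f fn) [||x [xn dlx dx [z [zn dlz jz]]]].
- apply: cochain_ext => T; rewrite deltaE big1 // => i iT.
  have [Ti|Ti] := eqVneq (T :\ i) set0; last first.
    by rewrite res0 ?mulr0 // fT // eq_sym.
  rewrite (resE _ (subD1set T i)); move: (subD1set T i); rewrite Ti f0 => h.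
  by rewrite y0 ?mulr0 //; apply/set0Pn; exists i.
- apply: cochain_ext => T; have [T0|T0] := eqVneq set0 T.
    by subst T; rewrite [LHS](_ : _ = cdga_d (Y set0) (f set0)) // f0.
  by rewrite [LHS](_ : _ = cdga_d (Y T) (f T)) // fT // cdga_d0.
have single (Z : set_functor K V) (g : cochain Z) i (h : set0 \subset [set i]) :
    delta g = 0 -> sf_map Z h (g set0) = 0.
  move=> /(congr1 (fun g : cochain Z => g [set i])); rewrite deltaE big_set1.
  move=> /(congr1 (fun a => (-1) ^+ npos i [set i] * a)); rewrite signrMK mulr0.
  have e : [set i] :\ i = set0 by apply/setP => k; rewrite !inE andNb.
  by rewrite e (resE _ h).
have x0 : x set0 = 0 by apply: Xinj => i h; apply: single.
exists (- z set0); split=> [T h /set0Pn[i iT]|].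
  have hi : set0 \subset [set i] by apply: sub0set.
  have iT' : [set i] \subset T by rewrite sub1set.
  by rewrite rmorphN -(sf_map_comp hi iT') (single _ z) // rmorph0 oppr0.
have := congr1 (fun g : cochain Y => g set0) jz.
rewrite [X in X = _ -> _](_ : _ = j x set0 - f set0) // cochain_mapE x0 rmorph0 f0 sub0r.
by rewrite cdga_dN => /eqP; rewrite eqr_oppLR => /eqP.
Qed.

(* X set0 plays the role of the limit of X over the nonempty sets. *)
Lemma limit_quasi_iso :
  (forall x : X set0, (forall i (h : set0 \subset [set i]), sf_map X h x = 0) -> x = 0) ->
  reedy_at Y set0 ->
  quasi_iso (hom_comp (matching_map Y set0) (F set0)).
Proof.
(* What remains is the matching map, which is surjective with acyclic kernel. *)
move=> Xinj Yr; apply: quasi_iso_comp => //.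
have ker y : matching_map Y set0 y = 0 <->
    forall T (h : set0 \subset T), T != set0 -> sf_map Y h y = 0.
  split=> [my T h T0|hy].
    have hT : set0 \proper T by rewrite properEneq h eq_sym T0.
    rewrite (bool_irrelevance h (proper_sub hT)) -matching_mapE my.
    exact: (rmorph0 (matching_pr Y hT)).
  apply: matching_ext => T h; rewrite matching_mapE (rmorph0 (matching_pr Y h)).
  by apply: hy; rewrite eq_sym; case/andP: (h); rewrite properEneq in h; case/andP: h.
split=> [y dy [m my]|m dm].
  have [b bm] := Yr m.
  have [|||z [_ zE]] := @kernel_acyclic (y - cdga_d _ b).
  - by apply/ker; rewrite rmorphB my cdga_hom_d bm subrr.
  - by rewrite cdga_dB dy cdga_dd subrr.
  - exact: Xinj.
  by exists (z + b); rewrite cdga_dD -zE subrK.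
have [y ym] := Yr m.
have [|||z [zk zE]] := @kernel_acyclic (cdga_d _ y).
- by apply/ker; rewrite cdga_hom_d ym.
- exact: cdga_dd.
- exact: Xinj.
exists (y - z); split; first by rewrite cdga_dB -zE subrr.
exists 0; rewrite cdga_d0 rmorphB ym; move/ker: zk => ->.
by rewrite subr0 subrr.
Qed.

End LimitComparison.

(** * From sets to chains *)

Lemma dinj_ext m n (s t : dinj m n) : s =1 t -> s = t.
Proof.
case: s t => [s hs] [t ht] /= st; have {}st : s = t by apply: functional_extensionality_dep.
by subst t; congr Dinj; apply: Prop_irrelevance.
Qed.

Lemma dinj_inj m n (t : dinj m n) : injective t.
Proof.
move=> i j tij; apply: val_inj => /=.
by have [/(dinj_mono t)|/(dinj_mono t)|//] := ltngtP i j; rewrite tij ltnn.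
Qed.

Lemma dinj_leq m n (t : dinj m n) : (m <= n)%N.
Proof. by have := leq_card t (@dinj_inj _ _ t); rewrite !card_ord. Qed.

Lemma dinj_endo n (t : dinj n n) : t = dinj_id n.
Proof.
have ge_t d (i : 'I_n.+1) : (n - i <= d)%N -> (t i <= i)%N.
  elim: d i => [|d IHd] i hi.
    by apply: leq_trans (leq_ord (t i)) _; rewrite -subn_eq0 -leqn0.
  have [ni|ni] := leqP n i; first exact: leq_trans (leq_ord (t i)) ni.
  have hj : (i.+1 < n.+1)%N by [].
  rewrite -ltnS; apply: leq_trans (@dinj_mono _ _ t i (Ordinal hj) (leqnn _)) _.
  by apply: IHd => /=; lia.
have le_t k (i : 'I_n.+1) : (i <= k)%N -> (i <= t i)%N.
  elim: k i => [|k IHk] [[|i] hi] //= ik.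
  have hj : (i < n.+1)%N by apply: ltnW.
  apply: leq_ltn_trans (IHk (Ordinal hj) _) (@dinj_mono _ _ t (Ordinal hj) (Ordinal hi) (leqnn _)).
  exact: ik.
apply: dinj_ext => i; apply: val_inj; apply/eqP.
by rewrite eqn_leq (ge_t (n - i)%N) // (le_t i).
Qed.

Section Chains.
Variables (N : nat) (le : rel 'S_N).
Hypotheses (le_antisym : antisymmetric le) (le_trans : transitive le) (le_total : total le).
Local Notation chain := (chain le).
Local Notation V := 'S_N.

Lemma chainP n (tau : chain n) (i j : 'I_n.+1) : (i < j)%N ->
  le (val tau i) (val tau j) /\ val tau i != val tau j.
Proof.
by move=> ij; have /forallP/(_ i)/forallP/(_ j)/implyP/(_ ij)/andP := valP tau.
Qed.

Lemma chain_inj n (tau : chain n) : injective (val tau).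
Proof.
move=> i j tij; apply: val_inj => /=.
by have [/(chainP tau)[_]|/(chainP tau)[_]|//] := ltngtP i j; rewrite tij eqxx.
Qed.

Lemma chain_faceE m n (t : dinj m n) (tau : chain n) i :
  val (chain_face t tau) i = val tau (t i).
Proof. exact: ffunE. Qed.

Lemma chain_ext n (sigma tau : chain n) : val sigma =1 val tau -> sigma = tau.
Proof. by move=> st; apply/val_inj/ffunP. Qed.

Lemma card_chain_set n (tau : chain n) : #|chain_set tau| = n.+1.
Proof. by rewrite card_imset ?card_ord //; apply: chain_inj. Qed.

Lemma chain_set_proper n (tau : chain n) : set0 \proper chain_set tau.
Proof. by rewrite proper0 -card_gt0 card_chain_set. Qed.

Lemma chain_face_sub m n (t : dinj m n) (tau : chain n) :
  chain_set (chain_face t tau) \subset chain_set tau.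
Proof.
by apply/subsetP => s /imsetP[i _ ->]; rewrite chain_faceE; apply: imset_f.
Qed.

Lemma chain_of_set (S : {set V}) : set0 \proper S ->
  exists n (tau : chain n), chain_set tau = S.
Proof.
rewrite proper0 => /set0Pn[x0 x0S]; pose s := sort le (enum S).
have sS : size s = #|S| by rewrite size_sort -cardE.
have mem_s x : (x \in s) = (x \in S) by rewrite mem_sort mem_enum.
have us : uniq s by rewrite sort_uniq enum_uniq.
have: (0 < #|S|)%N by rewrite card_gt0; apply/set0Pn; exists x0.
case En : #|S| => [//|n] _; exists n.
have h : is_chain le [ffun i : 'I_n.+1 => nth x0 s i].
  apply/forallP => i; apply/forallP => j; apply/implyP => ij; rewrite !ffunE.
  apply/andP; split; last by rewrite nth_uniq ?sS ?En ?ltn_ord // neq_ltn ij.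
  apply: (sorted_ltn_nth le_trans); rewrite ?inE ?sS ?En ?ltn_ord //.
  exact: sort_sorted.
exists (Sub _ h); apply/setP => x; rewrite -mem_s; apply/imsetP/idP => [[i _ ->]|xs].
  by rewrite SubK ffunE mem_nth // sS En.
have ix : (index x s < n.+1)%N by rewrite -En -sS index_mem.
by exists (Ordinal ix) => //; rewrite SubK ffunE nth_index.
Qed.

(** Antisymmetry of [le] makes the positions increase. Together with [chain_of_set] and
    [chain_face_uniq] this identifies chains under faces with nonempty sets under inclusion, so that
    limits and lifts can be built set by set. *)
Lemma chain_face_ex m n (sigma : chain m) (tau : chain n) :
  chain_set sigma \subset chain_set tau -> exists t, chain_face t tau = sigma.
Proof.
move=> /subsetP st.
have t0 i : {j | val tau j = val sigma i}.
  apply: cid; have si : val sigma i \in chain_set sigma by apply: imset_f.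
  by have /imsetP[j _ ->] := st _ si; exists j.
pose t i := sval (t0 i); have tE i : val tau (t i) = val sigma i := svalP (t0 i).
have t_mono (i j : 'I_m.+1) : (i < j)%N -> (t i < t j)%N.
  move=> ij; have [sij nij] := chainP sigma ij.
  rewrite ltnNge leq_eqVlt; apply/negP => /orP[/eqP/val_inj e|/(chainP tau)[]].
    by move: nij; rewrite -!tE e eqxx.
  rewrite !tE => sji _; case/eqP: nij; apply: le_antisym; by rewrite sij sji.
by exists (Dinj t_mono); apply: chain_ext => i; rewrite chain_faceE.
Qed.

Lemma chain_face_uniq m n (s t : dinj m n) (tau : chain n) :
  chain_face s tau = chain_face t tau -> s = t.
Proof.
move=> st; apply: dinj_ext => i; apply: (@chain_inj _ tau).
by rewrite -!chain_faceE st.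
Qed.

Lemma chain_face_comp m n p (g : dinj n p) (f : dinj m n) (tau : chain p) :
  chain_face (dinj_comp g f) tau = chain_face f (chain_face g tau).
Proof. by apply: chain_ext => i; rewrite !chain_faceE. Qed.

Lemma chain_face_id n (tau : chain n) : chain_face (dinj_id n) tau = tau.
Proof. by apply: chain_ext => i; rewrite chain_faceE. Qed.

Variables (K : fieldType) (Y : set_functor K V).

Definition chain_prod n : cdga K := prod_cdga (fun tau : chain n => Y (chain_set tau)).

Definition chain_prod_map m n (t : dinj m n) : cdga_hom (chain_prod m) (chain_prod n) :=
  prod_pair (fun tau : chain n => hom_comp (sf_map Y (chain_face_sub t tau))
    (prod_pr (fun tau : chain m => Y (chain_set tau)) (chain_face t tau))).

Lemma chain_prod_eq n (f : chain_prod n) (S : {set V}) (sigma tau : chain n)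
    (h : chain_set sigma \subset S) (k : chain_set tau \subset S) :
  sigma = tau -> sf_map Y h (f sigma) = sf_map Y k (f tau).
Proof. by move=> e; subst tau; congr (sf_map Y _ _); apply: bool_irrelevance. Qed.

Lemma chain_prod_mapE m n (t : dinj m n) (f : chain_prod m) (tau : chain n)
    (sigma : chain m) (h : chain_set sigma \subset chain_set tau) :
  chain_face t tau = sigma -> chain_prod_map t f tau = sf_map Y h (f sigma).
Proof. exact: chain_prod_eq. Qed.

Definition chain_functor : semicosimplicial K.
Proof.
refine (@SemiCosimplicial K chain_prod chain_prod_map _ _).
- move=> n f; apply: dprod_ext => tau.
  by rewrite (chain_prod_mapE f (subxx _) (chain_face_id tau)) sf_map_id.
- move=> m n p g h f; apply: dprod_ext => tau.
  have s1 := chain_face_sub g tau; have s2 := chain_face_sub h (chain_face g tau).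
  have s3 := subset_trans s2 s1.
  rewrite (chain_prod_mapE _ s3 (chain_face_comp g h tau)).
  rewrite (chain_prod_mapE _ s1 erefl) (chain_prod_mapE _ s2 erefl).
  by rewrite (sf_map_comp s2 s1 s3).
Defined.

Definition cone_component n : cdga_hom (matching Y set0) (chain_functor n) :=
  prod_pair (fun tau : chain n => matching_pr Y (chain_set_proper tau)).

Fact cone_component_natural m n (t : dinj m n) x :
  sc_map chain_functor t (cone_component m x) = cone_component n x.
Proof.
apply: dprod_ext => tau; rewrite [LHS](chain_prod_mapE _ (chain_face_sub t tau) erefl).
exact: matching_pr_map.
Qed.

Definition limit_cone : cone chain_functor (matching Y set0) := Cone cone_component_natural.

(** Every inclusion of chain sets is a face, so a cone is the same as a family of maps to the Y(T),
    T nonempty, compatible with all inclusions. A chain is picked for each T, and [rE] shows that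
    the choice is immaterial. *)
Lemma chain_functor_limit : is_limit chain_functor (matching Y set0).
Proof.
exists limit_cone => B rho.
have pick (T : {set V}) (h : set0 \proper T) :
    {p : {n & chain n} | chain_set (tagged p) = T}.
  by apply: cid; have [n [tau e]] := chain_of_set h; exists (Tagged chain tau).
have sub (T : {set V}) (h : set0 \proper T) : chain_set (tagged (sval (pick T h))) \subset T.
  by rewrite (svalP (pick T h)).
pose r (T : {set V}) (h : set0 \proper T) : cdga_hom B (Y T) :=
  hom_comp (sf_map Y (sub T h)) (hom_comp
    (prod_pr (fun tau => Y (chain_set tau)) (tagged (sval (pick T h)))) (rho _)).
have rE (T : {set V}) (h : set0 \proper T) n (sigma : chain n) (k : chain_set sigma \subset T) b :
    sf_map Y k ((rho n b : chain_prod n) sigma) = r T h b.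
  rewrite /r /=; move: (sub T h); case: (pick T h) => [[p tau] /= e] l.
  have [|t tE] := @chain_face_ex _ _ sigma tau; first by rewrite e.
  have l' : chain_set sigma \subset chain_set tau by rewrite e.
  rewrite -(cone_natural rho t b) [X in _ = sf_map Y l X](chain_prod_mapE _ l' tE).
  by rewrite (sf_map_comp l' l k).
have rC (T U : {set V}) (h : set0 \proper T) (k : set0 \proper U) (l : T \subset U) b :
    sf_map Y l (r T h b) = r U k b.
  have s := sub T h; have su := subset_trans s l.
  by rewrite -(rE T h _ _ s) (sf_map_comp s l su) (rE U k).
exists (matching_pair rC); split=> [n b|h' hh' b].
  apply: dprod_ext => tau.
  rewrite [LHS](matching_pairE rC (chain_set_proper tau) b).
  by rewrite -(rE _ _ _ tau (subxx _)) sf_map_id.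
apply: matching_ext => T hT; rewrite matching_pairE.
have [n [tau e]] := chain_of_set hT; subst T.
rewrite -(rE _ _ _ tau (subxx _)) sf_map_id -hh' /=.
by rewrite (bool_irrelevance hT (chain_set_proper tau)).
Qed.

Hypothesis K0 : [pchar K] =i pred0.
Hypothesis Y_reedy : forall S, reedy_at Y S.

(** * Injective fibrancy by descending induction on chains *)

Section Lifting.
Variables (A B : semicosimplicial K) (i : sc_hom A B).
Hypotheses (i_cof : forall n, cofibration (i n)) (i_qi : forall n, quasi_iso (i n)).
Variable f : sc_hom A chain_functor.

Definition extends n (tau : chain n) (x : cdga_hom (B n) (Y (chain_set tau))) : Prop :=
  forall a, x (i n a) = (f n a : chain_prod n) tau.

(** At k = 0 no chain is in range, since its n + 1 elements are distinct members of [V]; at k = #|V|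
    + 1 all chains are. *)
Definition lift_family k := forall n (tau : chain n), (#|V| < n + k)%N ->
  cdga_hom (B n) (Y (chain_set tau)).

Definition lift_natural k (g : lift_family k) : Prop :=
  forall m n (sigma : chain m) (tau : chain n) hm hn (t : dinj m n)
    (l : chain_set sigma \subset chain_set tau), chain_face t tau = sigma ->
  forall b, sf_map Y l (g m sigma hm b) = g n tau hn (sc_map B t b).

Definition lift_extends k (g : lift_family k) : Prop :=
  forall n (tau : chain n) h, extends (g n tau h).

(** The maps chosen on the chains strictly containing [tau] combine into a map from [B n] to the
    matching object at its set. With [f] it forms a square against the surjective matching map,
    which [trivial_cofibration_lift] fills. *)
Lemma lift_step1 k (g : lift_family k) : lift_natural g -> lift_extends g ->
  forall n (tau : chain n), (#|V| < n + k.+1)%N ->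
  exists x : cdga_hom (B n) (Y (chain_set tau)), extends x /\
    forall n' (tau' : chain n') h' (t : dinj n n')
      (l : chain_set tau \subset chain_set tau'), chain_face t tau' = tau ->
    forall b, sf_map Y l (x b) = g n' tau' h' (sc_map B t b).
Proof.
move=> g_nat g_ext n tau hn.
have [hk|hk] := ltnP #|V| (n + k).
  exists (g n tau hk); split=> [|n' tau' h' t l e b]; first exact: g_ext.
  exact: g_nat.
pose S := chain_set tau.
have pick (T : {set V}) (h : S \proper T) :
    {p : {n' & chain n'} | chain_set (tagged p) = T}.
  apply: cid; have [|n' [tau' e]] := @chain_of_set T.
    by apply: sub_proper_trans h; apply: sub0set.
  by exists (Tagged chain tau').
have range (T : {set V}) (h : S \proper T) : (#|V| < tag (sval (pick T h)) + k)%N.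
  have := card_chain_set (tagged (sval (pick T h))); rewrite (svalP (pick T h)).
  by have := proper_card h; rewrite card_chain_set; move: hn; lia.
have face (T : {set V}) (h : S \proper T) :
    {t | chain_face t (tagged (sval (pick T h))) = tau}.
  apply: cid; apply: chain_face_ex; rewrite (svalP (pick T h)).
  exact: proper_sub.
have sub (T : {set V}) (h : S \proper T) : chain_set (tagged (sval (pick T h))) \subset T.
  by rewrite (svalP (pick T h)).
pose r (T : {set V}) (h : S \proper T) : cdga_hom (B n) (Y T) :=
  hom_comp (sf_map Y (sub T h)) (hom_comp (g _ _ (range T h)) (sc_map B (sval (face T h)))).
have rE (T : {set V}) (h : S \proper T) n' (tau' : chain n') h' (t : dinj n n')
    (l : chain_set tau' \subset T) b : chain_face t tau' = tau ->
    sf_map Y l (g n' tau' h' (sc_map B t b)) = r T h b.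
  move=> tE; have pE := svalP (pick T h).
  have [|s sE] := @chain_face_ex _ _ tau' (tagged (sval (pick T h))); first by rewrite pE.
  have l' : chain_set tau' \subset chain_set (tagged (sval (pick T h))) by rewrite pE.
  rewrite /r /=; have -> : sval (face T h) = dinj_comp s t.
    apply: (@chain_face_uniq _ _ _ _ (tagged (sval (pick T h)))).
    by rewrite (svalP (face T h)) chain_face_comp sE tE.
  by rewrite sc_map_comp -(g_nat _ _ _ _ h' _ _ l' sE) (sf_map_comp l' _ l).
have rC (T U : {set V}) (h : S \proper T) (k' : S \proper U) (l : T \subset U) b :
    sf_map Y l (r T h b) = r U k' b.
  have s := sub T h; have su := subset_trans s l.
  rewrite -(rE T h _ _ (range T h) _ s b (svalP (face T h))) (sf_map_comp s l su).
  by rewrite (rE U k' _ _ _ _ _ _ (svalP (face T h))).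
pose u : cdga_hom (A n) (Y S) :=
  hom_comp (prod_pr (fun tau : chain n => Y (chain_set tau)) tau) (f n).
have comm a : matching_map Y S (u a) = matching_pair rC (i n a).
  apply: matching_ext => T h; rewrite matching_mapE matching_pairE.
  have [t tE] := face T h; have s := sub T h.
  rewrite -(rE T h _ _ (range T h) t s _ tE) -sc_hom_natural g_ext.
  have l : S \subset chain_set (tagged (sval (pick T h))).
    by rewrite (svalP (pick T h)); apply: proper_sub.
  rewrite sc_hom_natural [X in _ = sf_map Y s X](chain_prod_mapE _ l tE).
  by rewrite (sf_map_comp l s (proper_sub h)).
have [x [x_ext xv]] := trivial_cofibration_lift K0 (@i_cof n) (@i_qi n) (@Y_reedy S) comm.
exists x; split=> // n' tau' h' t l tE b.
have lp : S \proper chain_set tau'.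
  rewrite properEcard l !card_chain_set ltnS; lia.
rewrite (bool_irrelevance l (proper_sub lp)) -matching_mapE xv matching_pairE.
by rewrite -(rE _ _ _ _ h' t (subxx _) _ tE) sf_map_id.
Qed.

(** By [dinj_endo] a face map between chains of equal length is the identity, so the maps on the
    newly reached chains can be chosen independently of one another. *)
Lemma lift_step k : (exists g : lift_family k, lift_natural g /\ lift_extends g) ->
  exists g : lift_family k.+1, lift_natural g /\ lift_extends g.
Proof.
move=> [g [g_nat g_ext]]; have H := lift_step1 g_nat g_ext.
pose g' : lift_family k.+1 := fun n tau h => sval (cid (H n tau h)).
have g'P n tau h := svalP (cid (H n tau h)) : _ /\ _.
exists g'; split=> [m n sigma tau hm hn t l tE b|n tau h]; last by have [] := g'P n tau h.
have [hk|hk] := ltnP #|V| (n + k).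
  have [_ h1] := g'P m sigma hm; have [_ h2] := g'P n tau hn.
  rewrite (h1 _ _ hk t l tE b).
  have := h2 _ _ hk (dinj_id n) (subxx _) (chain_face_id tau) (sc_map B t b).
  by rewrite sf_map_id sc_map_id => <-.
have mn := dinj_leq t; have {mn}nm : n = m by lia.
subst m; have e := dinj_endo t.
subst t; rewrite chain_face_id in tE; subst sigma; rewrite sf_map_id sc_map_id.
by congr (_ b); congr (cdga_hom_fun _); congr (g' n tau _); apply: bool_irrelevance.
Qed.

Lemma lift_family_ex k : exists g : lift_family k, lift_natural g /\ lift_extends g.
Proof.
elim: k => [|k IHk]; last exact: lift_step.
have small n (tau : chain n) : ~~ (#|V| < n + 0)%N.
  by rewrite addn0 -leqNgt ltnW // -(card_chain_set tau) max_card.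
exists (fun n tau h => match negP (small n tau) h with end).
by split=> [m n sigma tau hm|n tau h]; exfalso; [case/negP: (small m sigma)|case/negP: (small n tau)].
Qed.

Lemma lift_exists : exists g : sc_hom B chain_functor, forall n a, g n (i n a) = f n a.
Proof.
have [g [g_nat g_ext]] := lift_family_ex #|V|.+1.
have h n : (#|V| < n + #|V|.+1)%N by rewrite addnS ltnS leq_addl.
pose gn n : cdga_hom (B n) (chain_functor n) := prod_pair (fun tau => g n tau (h n)).
have gn_nat m n (t : dinj m n) x : gn n (sc_map B t x) = sc_map chain_functor t (gn m x).
  apply: dprod_ext => tau; rewrite [RHS](chain_prod_mapE _ (chain_face_sub t tau) erefl).
  exact/esym/g_nat.
exists (ScHom gn_nat) => n a; apply: dprod_ext => tau; exact: g_ext.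
Qed.

End Lifting.

Lemma chain_functor_fibrant : injectively_fibrant chain_functor.
Proof. by move=> A B i i_cof i_qi f; apply: lift_exists. Qed.

End Chains.

(** * The Poincare lemma *)

Section WeightDivision.
Variables (R : fieldType) (n : nat).
Implicit Types (p q : {mpoly R[n]}) (k : nat) (i : 'I_n) (T : {set 'I_n}).

(* Divides the monomial m by mdeg m + k; at weight 0 the junk value 0^-1 = 0
   kills the constant term. *)
Definition wdiv k p : {mpoly R[n]} :=
  \sum_(m <- msupp p) (p@_m / (mdeg m + k)%:R) *: 'X_[m].

Lemma mcoeff_wdiv k p m : (wdiv k p)@_m = p@_m / (mdeg m + k)%:R.
Proof.
rewrite raddf_sum /=.
under eq_bigr => m' _ do rewrite mcoeffZ mcoeffX.
have [mp|mp] := boolP (m \in msupp p).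
  rewrite (bigD1_seq m) ?msupp_uniq //= eqxx mulr1 big1 ?addr0 // => m' /negPf ->.
  by rewrite mulr0.
rewrite big1_seq ?(memN_msupp_eq0 mp) ?mul0r // => m' /andP[_ m'p].
by case: eqP mp => [<-|_]; rewrite ?m'p ?mulr0.
Qed.

Lemma wdivB k : zmod_morphism (wdiv k).
Proof.
by move=> p q; apply/mpolyP => m; rewrite mcoeffB !mcoeff_wdiv mcoeffB mulrBl.
Qed.
HB.instance Definition _ k :=
  GRing.isZmodMorphism.Build {mpoly R[n]} {mpoly R[n]} (wdiv k) (wdivB k).

Lemma wdivX k c m : wdiv k (c *: 'X_[m]) = (c / (mdeg m + k)%:R) *: 'X_[m].
Proof.
apply/mpolyP => m'; rewrite mcoeff_wdiv !mcoeffZ !mcoeffX.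
by case: eqP => [->|_]; rewrite ?mulr1 ?mulr0 ?mul0r.
Qed.

Lemma wdivMX k i p : wdiv k ('X_i * p) = 'X_i * wdiv k.+1 p.
Proof.
elim/mpolyind: p => [|c m p _ _ hp]; first by rewrite mulr0 !raddf0 mulr0.
rewrite mulrDr !raddfD /= mulrDr hp; congr (_ + _).
by rewrite -!scalerAr -mpolyXD !wdivX -scalerAr -mpolyXD mdegD mdeg1 add1n addSn addnS.
Qed.

Lemma wdiv_mderiv k i p : (wdiv k p)^`M(i) = wdiv k.+1 p^`M(i).
Proof.
apply/mpolyP => m; rewrite mcoeff_wdiv !mcoeff_mderiv mcoeff_wdiv.
by rewrite mdegD mdeg1 addn1 addSn addnS mulrnAl.
Qed.

Lemma wdiv_sign k b p : wdiv k ((-1) ^+ b * p) = (-1) ^+ b * wdiv k p.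
Proof.
by rewrite -signr_odd; case: odd; rewrite ?expr1 ?expr0 ?mulN1r ?mul1r ?raddfN.
Qed.

Lemma face_polyM_or T m : face_poly T 'X_[m] = 'X_[m] :> {mpoly R[n]} \/
  face_poly T 'X_[m] = 0 :> {mpoly R[n]}.
Proof.
rewrite /face_poly comp_mpolyX; have [mT|] := boolP [forall i, (i \notin T) ==> (m i == 0%N)].
  left; rewrite [RHS]mpolyXE_id; apply: eq_bigr => i _; rewrite tnth_mktuple.
  by case: ifPn => // /(implyP (forallP mT i)) /eqP ->; rewrite !expr0.
move/forallPn => hi; case: hi => i; rewrite negb_imply => /andP[iT mi].
right; rewrite (bigD1 i) //= tnth_mktuple (negPf iT) expr0n (negPf mi).
by rewrite mul0r.
Qed.

Lemma face_polyZ T c p : face_poly T (c *: p) = c *: face_poly T p.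
Proof. exact: comp_mpolyZ. Qed.

Lemma wdiv_face_poly k T p : wdiv k (face_poly T p) = face_poly T (wdiv k p).
Proof.
elim/mpolyind: p => [|c m p _ _ hp]; first by rewrite !raddf0.
rewrite !raddfD /= hp; congr (_ + _).
rewrite wdivX !face_polyZ; case: (face_polyM_or T m) => ->; first exact: wdivX.
by rewrite !scaler0 raddf0.
Qed.

Definition euler p := \sum_i 'X_i * p^`M(i).

Lemma eulerD p q : euler (p + q) = euler p + euler q.
Proof. by rewrite -big_split; apply: eq_bigr => i _; rewrite mderivD mulrDr. Qed.

Lemma mcoeff_euler p m : (euler p)@_m = (mdeg m)%:R * p@_m.
Proof.
elim/mpolyind: p => [|c m' p _ _ hp].
  rewrite /euler big1 ?mcoeff0 ?mulr0 // => i _.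
  by rewrite raddf0 mulr0.
rewrite eulerD !mcoeffD hp mulrDr; congr (_ + _).
have -> : euler (c *: 'X_[m']) = (c * (mdeg m')%:R) *: 'X_[m'].
  rewrite mdegE natr_sum mulr_sumr scaler_suml; apply: eq_bigr => i _.
  rewrite mderivZ mderivX !scalerA -scalerAr.
  case mi: (m' i) => [|k]; first by rewrite mulr0 !scale0r.
  rewrite -mpolyXD addmC submK // ; apply/mnm_lepP => j; rewrite mnm1E.
  by case: eqP => // <-; rewrite mi.
rewrite !mcoeffZ !mcoeffX; case: eqP => [->|_]; last by rewrite !mulr0.
by rewrite !mulr1 mulrC.
Qed.

Hypothesis R0 : [pchar R] =i pred0.

Lemma wdivK k p : euler (wdiv k p) + (wdiv k p) *+ k =
  if k == 0%N then p - (p@_(0%MM))%:MP else p.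
Proof.
apply/mpolyP => m; rewrite mcoeffD mcoeffMn mcoeff_euler !mcoeff_wdiv.
rewrite -[X in _ + X]mulr_natl -mulrDl -natrD mulrC.
have [mk0|mk] := posnP (mdeg m + k).
  move/eqP: mk0; rewrite addn_eq0 mdeg_eq0 => /andP[/eqP -> /eqP ->].
  by rewrite eqxx mdeg0 addn0 mulr0 mcoeffB mcoeffC eqxx mulr1 subrr.
rewrite mulfVK; last by move/pcharf0P: R0 => ->; rewrite -lt0n.
case: eqP => // k0; rewrite mcoeffB mcoeffC.
case: eqP => [m0|_]; last by rewrite mulr0 subr0.
by move: mk; rewrite k0 m0 mdeg0.
Qed.

End WeightDivision.

(** * The Euler vector field and the radial homotopy *)

Section Euler.
Variables (R : fieldType) (n : nat).
Local Notation form := (Defs.form R n).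
Implicit Types (x y : form) (i j : 'I_n) (J T : {set 'I_n}).

Definition sgn i J : {mpoly R[n]} := (-1) ^+ (\sum_(j in J) (j < i))%N.

Lemma sgn_sqr i J p : sgn i J * (sgn i J * p) = p.
Proof. exact: signrMK. Qed.

Lemma wedge_sign1 i J : i \notin J -> wedge_sign R [set i] J = sgn i J.
Proof.
by move=> iJ; rewrite /wedge_sign disjoints1 iJ /inversions big_set1.
Qed.

Lemma form_du_mulE i x J :
  (form_du R i * x : form) J = if i \in J then sgn i (J :\ i) * x (J :\ i) else 0.
Proof.
rewrite form_mulrE (bigD1 [set i]) //= [X in _ + X]big1 ?addr0; last first.
  by move=> s /negPf si; rewrite big1 // => t _; rewrite formE si mul0r mulr0.
case: ifP => iJ; last first.
  rewrite big1 // => t /eqP iJt; move: iJ.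
  by rewrite -iJt inE set11.
rewrite big_mkcond (bigD1 (J :\ i)) //= setD1K // eqxx formE eqxx mul1r.
rewrite wedge_sign1 ?inE ?eqxx // big1 ?addr0 // => t tJ; case: eqP => // iJt.
rewrite /wedge_sign disjoints1; case: (boolP (i \in t)) => it; rewrite ?mul0r //.
by case/eqP: tJ; rewrite -iJt setU1K.
Qed.

Lemma form_poly_mulE p x J : (form_poly p * x : form) J = p * x J.
Proof. exact: form_poly_mul. Qed.

Lemma form_poly_comm p x : form_poly p * x = x * form_poly p :> form.
Proof.
by apply: formP => J; rewrite form_poly_mulE [RHS]form_mul_poly mulrC.
Qed.

Definition contr i x : form :=
  [ffun J : {set 'I_n} => if i \in J then 0 else sgn i J * x (i |: J)].

Lemma contrE i x J : contr i x J = if i \in J then 0 else sgn i J * x (i |: J).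
Proof. exact: formE. Qed.

Lemma contrB i x y : contr i (x - y) = contr i x - contr i y.
Proof.
apply: formP => J; rewrite form_addE form_oppE !contrE form_addE form_oppE.
by case: ifP; rewrite ?subrr // mulrBr.
Qed.

Lemma contrD i x y : contr i (x + y) = contr i x + contr i y.
Proof.
apply: formP => J; rewrite form_addE !contrE form_addE.
by case: ifP; rewrite ?addr0 // mulrDr.
Qed.

Lemma contr_poly i p x : contr i (form_poly p * x) = form_poly p * contr i x.
Proof.
apply: formP => J; rewrite form_poly_mulE !contrE form_poly_mulE.
by case: ifP; rewrite ?mulr0 // mulrCA.
Qed.

Lemma sgn_D1 i j J : j \in J -> sgn i J = (-1) ^+ (j < i)%N * sgn i (J :\ j).
Proof. by move=> jJ; rewrite /sgn (big_setD1 j) //= exprD. Qed.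

Lemma sgn_U1 i j J : j \notin J -> sgn i (j |: J) = (-1) ^+ (j < i)%N * sgn i J.
Proof. by move=> jJ; rewrite (sgn_D1 i (setU11 j J)) setU1K. Qed.

Lemma contr_du i j x :
  contr i (form_du R j * x) = (if i == j then x else 0) - form_du R j * contr i x.
Proof.
apply: formP => J; rewrite form_addE form_oppE contrE !form_du_mulE !contrE.
have [<-|ij] := eqVneq i j.
  rewrite !inE eqxx /=; case: (boolP (i \in J)) => iJ.
    by rewrite setD1K // sgn_sqr subrr.
  by rewrite subr0 setU1K // sgn_sqr.
rewrite form_0E sub0r !inE ij [j == i]eq_sym (negPf ij) /=.
case: (boolP (j \in J)) => jJ; last by rewrite oppr0 mulr0 if_same.
case: (boolP (i \in J)) => iJ; first by rewrite mulr0 oppr0.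
have iJj : i \notin J :\ j by rewrite !inE (negPf iJ) andbF.
rewrite setU1_D1 // (sgn_D1 i jJ) (sgn_U1 j iJj) [LHS]mulrA [in RHS]mulrA -mulNr; congr (_ * _).
rewrite mulrACA -exprD [sgn j _ * _]mulrC.
have -> : ((j < i) + (i < j) = 1)%N.
  by have := ij; rewrite -val_eqE /=; case: ltngtP.
by rewrite expr1 mulN1r.
Qed.

Lemma partial_contr i j x : form_partial j (contr i x) = contr i (form_partial j x).
Proof.
apply: formP => J; rewrite formE !contrE formE; case: ifP => _; first exact: mderiv0.
rewrite /sgn -signr_odd; case: odd; rewrite ?expr1 ?expr0 ?mulN1r ?mul1r //.
exact: raddfN.
Qed.

(* Contraction with the Euler vector field. *)
Definition euler_contr x : form := \sum_i form_u R i * contr i x.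

Lemma euler_contrB x y : euler_contr (x - y) = euler_contr x - euler_contr y.
Proof. by rewrite -sumrB; apply: eq_bigr => i _; rewrite contrB mulrBr. Qed.

Lemma euler_contrD x y : euler_contr (x + y) = euler_contr x + euler_contr y.
Proof. by rewrite -big_split; apply: eq_bigr => i _; rewrite contrD mulrDr. Qed.

Lemma euler_contr0 : euler_contr 0 = 0.
Proof. by rewrite -(subrr 0) euler_contrB !subrr. Qed.

Lemma euler_contr_poly p x : euler_contr (form_poly p * x) = form_poly p * euler_contr x.
Proof.
rewrite mulr_sumr; apply: eq_bigr => i _; rewrite contr_poly !mulrA.
by rewrite -form_poly_comm.
Qed.

Lemma euler_contr_du j x : euler_contr (form_du R j * x) = form_u R j * x - form_du R j * euler_contr x.
Proof.
rewrite /euler_contr mulr_sumr.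
under eq_bigr => i _ do rewrite contr_du mulrBr.
rewrite sumrB; congr (_ - _).
  rewrite (bigD1 j) //= eqxx big1 ?addr0 // => i /negPf ->.
  by rewrite mulr0.
by apply: eq_bigr => i _; rewrite !mulrA form_poly_comm.
Qed.

(** Cartan's formula: the Lie derivative along the Euler field acts on the coefficient of du_J by
    the Euler operator plus |J|, every du_i having weight 1. *)
Lemma cartan x J : (form_d (euler_contr x) + euler_contr (form_d x)) J = euler (x J) + x J *+ #|J|.
Proof.
have -> : form_d (euler_contr x) + euler_contr (form_d x) =
    \sum_i form_du R i * contr i x + \sum_i form_u R i * form_partial i x.
  have dI : form_d (euler_contr x) = \sum_i form_du R i * contr i x +
      \sum_i form_du R i * euler_contr (form_partial i x).
    rewrite /form_d -big_split; apply: eq_bigr => j _ /=; rewrite -mulrDr; congr (_ * _).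
    have -> : form_partial j (euler_contr x) = \sum_i form_partial j (form_u R i * contr i x).
      apply: (big_morph (form_partial j) (@form_partialD R n j)).
      by apply: formP => s; rewrite formE !form_0E mderiv0.
    have pu i : form_partial j (form_u R i) = if i == j then 1 else 0.
      apply: formP => s; rewrite !formE; case: (eqVneq s set0) => [->|s0]; last first.
        rewrite mderiv0; case: ifP => _; last by rewrite form_0E.
        by rewrite [RHS]formE (negPf s0).
      rewrite mderivX mnm1E; case: eqP => [->|_]; last by rewrite form_0E scale0r.
      by rewrite [RHS]formE eqxx mnm_submm mpolyX0 scale1r.
    under eq_bigr => i _ do rewrite form_partialM pu partial_contr.
    rewrite big_split; congr (_ + _) => //=.
    rewrite (bigD1 j) //= eqxx mul1r big1 ?addr0 // => i /negPf ->.
    by rewrite mul0r.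
  have Id : euler_contr (form_d x) = \sum_i form_u R i * form_partial i x -
      \sum_i form_du R i * euler_contr (form_partial i x).
    rewrite /form_d (big_morph euler_contr euler_contrD euler_contr0) -sumrB; apply: eq_bigr => i _.
    exact: euler_contr_du.
  by rewrite dI Id addrACA subrr addr0.
rewrite form_addE !form_sumE addrC; congr (_ + _).
  by apply: eq_bigr => i _; rewrite form_poly_mulE formE.
rewrite -sumr_const [RHS]big_mkcond; apply: eq_bigr => i _; rewrite form_du_mulE contrE.
by case: ifP => // iJ; rewrite !inE eqxx /= setD1K // sgn_sqr.
Qed.

(** Division by the total weight, polynomial degree plus form degree, shifted by [c] to account for
    factors u_i or du_i already pulled out. *)
Definition fwdiv c x : form := [ffun J : {set 'I_n} => wdiv (#|J| + c) (x J)].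

Lemma fwdivE c x J : fwdiv c x J = wdiv (#|J| + c) (x J).
Proof. exact: formE. Qed.

Lemma fwdivB c x y : fwdiv c (x - y) = fwdiv c x - fwdiv c y.
Proof.
by apply: formP => J; rewrite form_addE form_oppE !fwdivE form_addE form_oppE raddfB.
Qed.

Lemma fwdivD c x y : fwdiv c (x + y) = fwdiv c x + fwdiv c y.
Proof. by apply: formP => J; rewrite form_addE !fwdivE form_addE raddfD. Qed.

Lemma fwdiv0 c : fwdiv c 0 = 0.
Proof. by rewrite -(subrr 0) fwdivB !subrr. Qed.

Lemma fwdiv_u c i x : fwdiv c (form_u R i * x) = form_u R i * fwdiv c.+1 x.
Proof.
by apply: formP => J; rewrite form_poly_mulE !fwdivE form_poly_mulE wdivMX addnS.
Qed.

Lemma fwdiv_du c i x : fwdiv c (form_du R i * x) = form_du R i * fwdiv c.+1 x.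
Proof.
apply: formP => J; rewrite form_du_mulE !fwdivE form_du_mulE.
case: ifP => iJ; last exact: raddf0.
by rewrite wdiv_sign (cardsD1 i J) iJ addnS add1n addSn.
Qed.

Lemma fwdiv_d c x : form_d (fwdiv c x) = fwdiv c (form_d x).
Proof.
rewrite /form_d (big_morph (fwdiv c) (fwdivD c) (fwdiv0 c)); apply: eq_bigr => i _.
rewrite fwdiv_du; congr (_ * _); apply: formP => J.
by rewrite formE !fwdivE formE wdiv_mderiv addnS.
Qed.

Lemma face_fwdiv c T x : face T (fwdiv c x) = fwdiv c (face T x).
Proof.
apply: formP => J; rewrite face_faceE !fwdivE face_faceE; case: ifP => _.
  by rewrite wdiv_face_poly.
by rewrite raddf0.
Qed.

Lemma face_euler_contr T x : face T (euler_contr x) = euler_contr (face T x).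
Proof.
rewrite raddf_sum; apply: eq_bigr => i _ /=; rewrite rmorphM /= face_u.
case: ifPn => iT.
  congr (_ * _); apply: formP => J; rewrite face_faceE !contrE face_faceE.
  rewrite subUset sub1set iT /=; case: (J \subset T); last by rewrite mulr0 if_same.
  case: ifP => _; first exact: raddf0.
  by rewrite rmorphM /sgn rmorphXn rmorphN1.
rewrite mul0r; apply/esym; apply: formP => J; rewrite form_poly_mulE contrE face_faceE.
by rewrite subUset sub1set (negPf iT) /= mulr0 if_same mulr0 form_0E.
Qed.

(** The radial homotopy of the Poincare lemma: integrating t^(w-1) over [0, 1] amounts to dividing
    by the weight w. *)
Definition cone_homotopy x : form := euler_contr (fwdiv 0 x).

(** What [face_ideal] becomes when a vertex of [T] is moved to the origin: its generators are then
    homogeneous, as division by weights requires. *)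
Definition lin_ideal T x : Prop := exists a b : form, [/\ face_form T a, face_form T b &
  x = a * (\sum_(i in T) form_u R i) + b * \sum_(i in T) form_du R i].

Lemma cone_homotopy_ideal T x : lin_ideal T x -> lin_ideal T (cone_homotopy x).
Proof.
move=> [a [b [ha hb ->]]]; set u := \sum_(i in T) form_u R i; set du := \sum_(i in T) form_du R i.
have uC y : y * u = u * y.
  by rewrite mulr_sumr mulr_suml; apply: eq_bigr => i _; rewrite [RHS]form_poly_comm.
have duC y : du * y = form_twist y * du by exact: dusumC.
have wu y : fwdiv 0 (u * y) = u * fwdiv 1 y.
  rewrite !mulr_suml (big_morph (fwdiv 0) (fwdivD 0) (fwdiv0 0)).
  by apply: eq_bigr => i _; rewrite fwdiv_u.
have wdu y : fwdiv 0 (du * y) = du * fwdiv 1 y.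
  rewrite !mulr_suml (big_morph (fwdiv 0) (fwdivD 0) (fwdiv0 0)).
  by apply: eq_bigr => i _; rewrite fwdiv_du.
have iu y : euler_contr (u * y) = u * euler_contr y.
  rewrite !mulr_suml (big_morph euler_contr euler_contrD euler_contr0).
  by apply: eq_bigr => i _; rewrite euler_contr_poly.
have idu y : euler_contr (du * y) = u * y - du * euler_contr y.
  rewrite !mulr_suml (big_morph euler_contr euler_contrD euler_contr0) -sumrB.
  by apply: eq_bigr => i _; rewrite euler_contr_du.
(* Contraction turns the generator [du] into [u], so the [b] term also contributes [z] to the
   coefficient of [u]. *)
pose z := fwdiv 1 (form_twist b).
exists (euler_contr (fwdiv 1 a) + z), (- form_twist (euler_contr z)); split.
- by rewrite /face_form raddfD /= face_euler_contr !face_fwdiv face_twist ha hb.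
- by rewrite /face_form raddfN /= face_twist face_euler_contr face_fwdiv face_twist hb.
rewrite /cone_homotopy fwdivD euler_contrD uC wu iu mulrDl !uC -addrA; congr (_ + _).
have -> : b * du = du * form_twist b by rewrite duC form_twistK.
by rewrite wdu idu mulNr -duC.
Qed.

Hypothesis R0 : [pchar R] =i pred0.

Lemma cone_homotopyP x :
  form_d (cone_homotopy x) + cone_homotopy (form_d x) = x - form_poly ((x set0)@_(0%MM))%:MP.
Proof.
apply: formP => J; rewrite /cone_homotopy -fwdiv_d cartan form_addE form_oppE fwdivE addn0.
rewrite wdivK // cards_eq0 formE; case: eqP => [->//|_].
by rewrite subr0.
Qed.

End Euler.

(** * Contraction to a vertex of the simplex *)

Section Translation.
Variables (R : fieldType) (n : nat) (s : 'I_n).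
Local Notation form := (Defs.form R n).
Implicit Types (p q : {mpoly R[n]}) (x y : form) (a : R) (J T : {set 'I_n}).

Definition shift_poly a p : {mpoly R[n]} :=
  p \mPo [tuple ('X_i + (if i == s then a%:MP else 0)) | i < n].

Fact shift_polyB a : zmod_morphism (shift_poly a).
Proof. by move=> p q; rewrite /shift_poly raddfB. Qed.
Fact shift_polyM a : monoid_morphism (shift_poly a).
Proof. by split=> [|p q]; rewrite /shift_poly ?rmorph1 ?rmorphM. Qed.
HB.instance Definition _ a :=
  GRing.isZmodMorphism.Build {mpoly R[n]} {mpoly R[n]} (shift_poly a) (shift_polyB a).
HB.instance Definition _ a :=
  GRing.isMonoidMorphism.Build {mpoly R[n]} {mpoly R[n]} (shift_poly a) (shift_polyM a).

Lemma shift_polyC a c : shift_poly a c%:MP = c%:MP.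
Proof. exact: comp_mpolyC. Qed.

Lemma shift_polyX a i : shift_poly a 'X_i = 'X_i + (if i == s then a%:MP else 0).
Proof. by rewrite /shift_poly comp_mpolyXU -tnth_nth tnth_mktuple. Qed.

Lemma shift_polyK a p : shift_poly (- a) (shift_poly a p) = p.
Proof.
elim/mpoly_ring_ind: p => [c|i|p q hp hq|p q hp hq].
- by rewrite !shift_polyC.
- rewrite shift_polyX raddfD /= shift_polyX; case: ifP => _; last by rewrite raddf0 !addr0.
  by rewrite shift_polyC mpolyCN addrNK.
- by rewrite !raddfD /= hp hq.
- by rewrite !rmorphM /= hp hq.
Qed.

Lemma mderiv_shift_poly a i p : (shift_poly a p)^`M(i) = shift_poly a p^`M(i).
Proof.
elim/mpoly_ring_ind: p => [c|j|p q hp hq|p q hp hq].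
- by rewrite shift_polyC !mderivC raddf0.
- rewrite shift_polyX mderivD mderivX mnm1E.
  have -> : (if j == s then a%:MP else 0 : {mpoly R[n]})^`M(i) = 0.
    by case: ifP => _; rewrite ?mderivC ?mderiv0.
  rewrite addr0; case: eqP => [->|_]; last by rewrite !scale0r raddf0.
  by rewrite scale1r mnm_submm mpolyX0 rmorph1.
- by rewrite raddfD /= !mderivD hp hq raddfD.
- by rewrite rmorphM /= !mderivM hp hq raddfD /= !rmorphM.
Qed.

Lemma face_shift_poly a T p : s \in T -> face_poly T (shift_poly a p) = shift_poly a (face_poly T p).
Proof.
move=> sT; elim/mpoly_ring_ind: p => [c|i|p q hp hq|p q hp hq].
- by rewrite shift_polyC !face_polyC shift_polyC.
- rewrite shift_polyX raddfD /= !face_polyX.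
  case: (eqVneq i s) => [->|si]; first by rewrite sT face_polyC shift_polyX eqxx.
  rewrite raddf0 addr0; case: ifP => _; last by rewrite raddf0.
  by rewrite shift_polyX (negPf si) addr0.
- by rewrite !raddfD /= hp hq.
- by rewrite !rmorphM /= hp hq.
Qed.

Definition shift_form a x : form := [ffun J => shift_poly a (x J)].

Lemma shift_formE a x J : shift_form a x J = shift_poly a (x J).
Proof. exact: formE. Qed.

Fact shift_formB a : zmod_morphism (shift_form a).
Proof.
by move=> x y; apply: formP => J; rewrite form_addE form_oppE !shift_formE form_addE form_oppE raddfB.
Qed.

Lemma shift_form_poly a p : shift_form a (form_poly p) = form_poly (shift_poly a p).
Proof. by apply: formP => J; rewrite shift_formE !formE; case: eqP; rewrite ?raddf0. Qed.

Fact shift_formM a : monoid_morphism (shift_form a).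
Proof.
split=> [|x y]; first by rewrite -[1]/(form_poly 1) shift_form_poly rmorph1.
apply: formP => w; rewrite shift_formE !form_mulrE raddf_sum; apply: eq_bigr => J _ /=.
rewrite raddf_sum; apply: eq_bigr => T _ /=; rewrite !rmorphM /= !shift_formE; congr (_ * _).
by rewrite /wedge_sign; case: ifP => _; rewrite ?raddf0 // rmorphXn rmorphN1.
Qed.
HB.instance Definition _ a := GRing.isZmodMorphism.Build form form (shift_form a) (shift_formB a).
HB.instance Definition _ a := GRing.isMonoidMorphism.Build form form (shift_form a) (shift_formM a).

Lemma shift_formK a x : shift_form (- a) (shift_form a x) = x.
Proof. by apply: formP => J; rewrite !shift_formE shift_polyK. Qed.

Lemma shift_form_du a i : shift_form a (form_du R i) = form_du R i.
Proof.
by apply: formP => J; rewrite shift_formE !formE; case: eqP; rewrite ?raddf0 ?rmorph1.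
Qed.

Lemma shift_form_u a i : shift_form a (form_u R i) = form_u R i + (if i == s then form_poly a%:MP else 0).
Proof.
rewrite /form_u shift_form_poly shift_polyX raddfD /=; congr (_ + _).
by case: ifP; rewrite ?raddf0.
Qed.

Lemma shift_form_d a x : form_d (shift_form a x) = shift_form a (form_d x).
Proof.
rewrite /form_d raddf_sum; apply: eq_bigr => i _ /=.
rewrite rmorphM /= shift_form_du; congr (_ * _); apply: formP => J.
by rewrite formE !shift_formE formE mderiv_shift_poly.
Qed.

Lemma face_shift_form a T x : s \in T -> face T (shift_form a x) = shift_form a (face T x).
Proof.
move=> sT; apply: formP => J; rewrite face_faceE !shift_formE face_faceE.
by case: ifP => _; rewrite ?raddf0 ?face_shift_poly.
Qed.

Lemma shift_form_usum a T : s \in T ->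
  shift_form a (\sum_(i in T) form_u R i) = \sum_(i in T) form_u R i + form_poly a%:MP.
Proof.
move=> sT; rewrite raddf_sum /=; under eq_bigr => i _ do rewrite shift_form_u.
rewrite big_split; congr (_ + _) => /=; rewrite (bigD1 s) //= eqxx big1 ?addr0 // => i /andP[_ /negPf ->].
by [].
Qed.

Lemma shift_form_dusum a T : shift_form a (\sum_(i in T) form_du R i) = \sum_(i in T) form_du R i.
Proof. by rewrite raddf_sum; apply: eq_bigr => i _; rewrite /= shift_form_du. Qed.

(** Since s lies in [T], replacing u_s by u_s + 1 cancels the constant term of the generator sum u -
    1. *)
Lemma lin_ideal_shift_form T x : s \in T -> face_ideal T x -> lin_ideal T (shift_form 1 x).
Proof.
move=> sT [a [b [ha hb ->]]]; exists (shift_form 1 a), (shift_form 1 b).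
split; rewrite /face_form ?face_shift_form ?ha ?hb //.
rewrite raddfD /= !rmorphM /= shift_form_dusum raddfB /= shift_form_usum // rmorph1.
by rewrite rmorph1 addrK.
Qed.

Lemma face_ideal_shift_form T x : s \in T -> lin_ideal T x -> face_ideal T (shift_form (-1) x).
Proof.
move=> sT [a [b [ha hb ->]]]; exists (shift_form (-1) a), (shift_form (-1) b).
split; rewrite /face_form ?face_shift_form ?ha ?hb //.
rewrite raddfD /= !rmorphM /= shift_form_dusum shift_form_usum //.
by rewrite mpolyCN mpolyC1 raddfN /= (rmorph1 (@form_poly R n)).
Qed.

(* The homotopy contracting affine space to the vertex u_s = 1, and the value
   of a form at that vertex. *)
Definition vertex_homotopy x : form := shift_form (-1) (cone_homotopy (shift_form 1 x)).
Definition vertex_value x : R := (shift_form 1 x set0)@_(0%MM).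

Lemma cone_homotopyB x y : cone_homotopy (x - y) = cone_homotopy x - cone_homotopy y.
Proof. by rewrite /cone_homotopy fwdivB euler_contrB. Qed.

Lemma vertex_homotopyB x y :
  vertex_homotopy (x - y) = vertex_homotopy x - vertex_homotopy y.
Proof. by rewrite /vertex_homotopy raddfB /= cone_homotopyB raddfB. Qed.

Lemma vertex_valueB x y : vertex_value (x - y) = vertex_value x - vertex_value y.
Proof. by rewrite /vertex_value raddfB /= form_addE form_oppE mcoeffB. Qed.

Lemma face_vertex_homotopy T x : s \in T ->
  face T (vertex_homotopy x) = vertex_homotopy (face T x).
Proof.
by move=> sT; rewrite /vertex_homotopy /cone_homotopy face_shift_form // face_euler_contr face_fwdiv face_shift_form.
Qed.

Lemma vertex_homotopy_ideal T x : s \in T -> face_ideal T x ->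
  face_ideal T (vertex_homotopy x).
Proof.
move=> sT hx; apply: face_ideal_shift_form => //; apply: cone_homotopy_ideal.
exact: lin_ideal_shift_form.
Qed.

Lemma vertex_value_d x : vertex_value (form_d x) = 0.
Proof.
rewrite /vertex_value -shift_form_d /form_d form_sumE big1 ?mcoeff0 // => i _.
by rewrite form_du_mulE inE.
Qed.

Lemma vertex_value_const c : vertex_value (form_poly c%:MP) = c.
Proof. by rewrite /vertex_value shift_form_poly shift_polyC formE eqxx mcoeffC eqxx mulr1. Qed.

Lemma vertex_value_ideal T x : s \in T -> face_ideal T x -> vertex_value x = 0.
Proof.
move=> sT /(lin_ideal_shift_form sT)[a [b [_ _ e]]].
rewrite /vertex_value e form_addE mulr_sumr mulr_sumr !form_sumE mcoeffD.
rewrite [X in _ + X@__]big1 ?mcoeff0 ?addr0 => [|i _]; last first.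
  by rewrite form_du_mul form_du_mulE inE.
rewrite raddf_sum big1 //= => i _.
rewrite -[form_u R i]/(form_poly 'X_i) [X in X@__]form_mul_poly.
rewrite mcoeffM big1 // => -[m1 m2] /= /eqP/esym/eqP; rewrite mnmD_eq0 => /andP[_ /eqP ->].
by rewrite mcoeffX mnm1_eq0 mulr0.
Qed.

Lemma vertex_value_face T x : s \in T -> vertex_value (face T x) = vertex_value x.
Proof.
move=> sT; rewrite /vertex_value -face_shift_form // face_faceE sub0set.
move: (shift_form 1 x set0); elim/mpolyind => [|c m p _ _ hp]; first by rewrite raddf0.
rewrite raddfD /= !mcoeffD hp; congr (_ + _); rewrite face_polyZ !mcoeffZ.
have [->|m0] := eqVneq m 0%MM; first by rewrite mpolyX0 rmorph1.
rewrite mcoeffX (negPf m0); case: (face_polyM_or R T m) => ->; rewrite ?mcoeff0 //.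
by rewrite mcoeffX (negPf m0).
Qed.

Hypothesis R0 : [pchar R] =i pred0.

(** [cone_homotopyP] conjugated by the translation. The term in [form_d x] is kept because
    representatives of closed classes are closed only modulo the ideal. *)
Lemma vertex_homotopyP x :
  form_poly (vertex_value x)%:MP - x =
  form_d (- vertex_homotopy x) - vertex_homotopy (form_d x).
Proof.
have dN y : form_d (- y) = - form_d y.
  by apply: (addrI (form_d y)); rewrite -form_dD !subrr /form_d big1 // => i _;
    rewrite (_ : form_partial i 0 = 0) ?mulr0 //; apply: formP => J; rewrite formE !form_0E mderiv0.
rewrite dN -opprD /vertex_homotopy shift_form_d -[shift_form 1 (form_d x)]shift_form_d.
rewrite -(raddfD (shift_form (-1))) /= cone_homotopyP //.
by rewrite raddfB /= shift_formK shift_form_poly shift_polyC opprB.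
Qed.

End Translation.

(** * Forms on closed stars *)

Section Stars.
Variables (K : fieldType) (K0 : [pchar K] =i pred0) (N : nat).
Local Notation V := 'S_N.
Local Notation R := (ratfun K N).
Local Notation n := (nperm N).
Local Notation form := (Defs.form R n).
Local Notation Omega := (Omega_SN K N).
Local Notation cls := (@Omega_class K R (ratfun_const K N) n).
Local Notation face_condition := (@face_condition K N).
Implicit Types (x y : form) (S T : {set V}).

Fact ratfun_pchar0 : [pchar R] =i pred0.
Proof. by move=> p; rewrite (fmorph_pchar (ratfun_const K N)) K0. Qed.

Section Over.
Variable O : subringClosed R.
Hypothesis O_div : forall k, (k%:R)^-1 \in O.

Fact form_over_wdiv k p : p \is a mpolyOver n O -> wdiv k p \is a mpolyOver n O.
Proof.
move=> /mpolyOverP pO; apply/mpolyOverP => m; rewrite mcoeff_wdiv.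
by rewrite rpredM.
Qed.

Fact form_over_cone_homotopy x : form_over O x -> form_over O (cone_homotopy x).
Proof.
move=> xO; apply: form_over_sum => i; apply: form_overM.
  by apply: form_over_poly; apply: mpolyOverX.
move=> J; rewrite contrE; case: ifP => _; first exact: rpred0.
by rewrite rpredM ?rpredX ?rpredN ?rpred1 // fwdivE form_over_wdiv.
Qed.

Fact form_over_shift_form s a x : a \in O -> form_over O x -> form_over O (shift_form s a x).
Proof.
move=> aO xO J; rewrite shift_formE /shift_poly comp_mpolyE; apply: rpred_sum => m _.
apply: mpolyOverZ; first by apply/mpolyOverP.
apply: rpred_prod => i _; apply: rpredX; rewrite tnth_mktuple rpredD ?mpolyOverX //.
by case: ifP => _; rewrite ?rpred0 // mpolyOverC.
Qed.

Fact form_over_vertex_homotopy s x : form_over O x -> form_over O (vertex_homotopy s x).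
Proof.
move=> xO; apply: form_over_shift_form; first by rewrite rpredN rpred1.
by apply: form_over_cone_homotopy; apply: form_over_shift_form; rewrite ?rpred1.
Qed.

Fact form_over_vertex_value s x : form_over O x -> vertex_value s x \in O.
Proof.
by move=> /(form_over_shift_form s (rpred1 O)) /(_ set0) /mpolyOverP; apply.
Qed.

End Over.

Fact OU_div prec k : (k%:R)^-1 \in OU (K := K) (N := N) prec.
Proof.
have -> : (k%:R)^-1 = ratfun_const K N (k%:R)^-1 by rewrite fmorphV rmorph_nat.
exact: OU_poly.
Qed.

Fact OU_sub_B prec : {subset OU (K := K) (N := N) prec <= @B_alg K N}.
Proof. by apply: OU_refine. Qed.

Fact OU_meet S T : S \subset T ->
  {subset OU (K := K) (meet_order S) <= OU (meet_order T)}.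
Proof. by move=> ST; apply: OU_refine => i j; apply: meet_orderS. Qed.

Fact face_condition_const c T : c \in OU (meet_order T) -> face_condition (form_poly c%:MP) T.
Proof.
move=> cT; exists (form_poly c%:MP); split.
- by rewrite /face_form face_polyform face_polyC.
- by apply: form_over_poly; rewrite mpolyOverC.
- by rewrite face_polyform face_polyC subrr; apply: face_ideal0.
Qed.

Fact face_conditionB x y T : face_condition x T -> face_condition y T -> face_condition (x - y) T.
Proof.
move=> [a [a1 a2 a3]] [b [b1 b2 b3]]; exists (a - b); split.
- by rewrite /face_form raddfB /= a1 b1.
- exact: form_overB.
- have -> : face (vertices T) (x - y) - (a - b) =
      (face (vertices T) x - a) - (face (vertices T) y - b).
    by rewrite raddfB /= !opprD addrACA.
  exact: face_idealB.
Qed.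

Fact face_conditionM x y T : face_condition x T -> face_condition y T -> face_condition (x * y) T.
Proof.
move=> [a [a1 a2 a3]] [b [b1 b2 b3]]; exists (a * b); split.
- by rewrite /face_form rmorphM /= a1 b1.
- exact: form_overM.
- have -> : face (vertices T) (x * y) - a * b =
      (face (vertices T) x - a) * face (vertices T) y +
      a * (face (vertices T) y - b).
    by rewrite rmorphM mulrBl mulrBr addrA subrK.
  apply: face_idealD; first exact: face_ideal_mulr (face_formP _ _) a3.
  exact: face_ideal_mull a1 b3.
Qed.

Fact face_condition_proj k x T : face_condition x T -> face_condition (form_proj k x) T.
Proof.
move=> [a [a1 a2 a3]]; exists (form_proj k a); split.
- by rewrite /face_form face_proj a1.
- exact: form_over_proj.
- have := face_ideal_proj k a3.
  by rewrite -[form_proj _ _]/(cdga_proj (form_cdga (ratfun_const K N) n) k _) cdga_projB /= face_proj.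
Qed.

Fact face_condition_d x T : face_condition x T -> face_condition (form_d x) T.
Proof.
move=> [a [a1 a2 a3]]; exists (form_d a); split.
- by rewrite /face_form face_d a1.
- exact: form_over_d.
- have := face_ideal_d a3.
  by rewrite -[form_d _]/(cdga_d (form_cdga (ratfun_const K N) n) _) cdga_dB /= face_d.
Qed.

(** A face containing [sigma] is a cone with apex [sigma], so the contraction restricts to it.
    Coefficients stay in the same localization because only integers are divided by. *)
Fact face_condition_homotopy x (sigma : V) T : sigma \in T ->
  face_condition x T -> face_condition (vertex_homotopy (enum_rank sigma) x) T.
Proof.
move=> sT [a [a1 a2 a3]]; have s_in : enum_rank sigma \in vertices T by apply: imset_f.
exists (vertex_homotopy (enum_rank sigma) a); split.
- by rewrite /face_form (face_vertex_homotopy _ s_in) a1.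
- by apply: form_over_vertex_homotopy => // k; apply: OU_div.
- rewrite (face_vertex_homotopy _ s_in) -vertex_homotopyB.
  exact: vertex_homotopy_ideal s_in a3.
Qed.

Fact vertex_value_OU x (sigma : V) T : sigma \in T ->
  face_condition x T -> vertex_value (enum_rank sigma) x \in OU (meet_order T).
Proof.
move=> sT [a [a1 a2 a3]]; have s_in : enum_rank sigma \in vertices T by apply: imset_f.
rewrite -(vertex_value_face _ s_in) -[face _ x](subrK a).
have vD y z : vertex_value (enum_rank sigma) (y + z) =
    vertex_value (enum_rank sigma) y + vertex_value (enum_rank sigma) z.
  by rewrite /vertex_value raddfD /= form_addE mcoeffD.
by rewrite vD (vertex_value_ideal s_in a3) add0r; apply: form_over_vertex_value.
Qed.

(* Forms on the closed star of the face S. *)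
Definition star_cond S x : Prop :=
  form_over (@B_alg K N) x /\ forall T, T != set0 -> S \subset T -> face_condition x T.

Definition star_mem S (w : Omega) : Prop := exists2 x : form, cls x = w & star_cond S x.

Fact star_condB S x y : star_cond S x -> star_cond S y -> star_cond S (x - y).
Proof.
move=> [Bx hx] [By hy]; split; first exact: form_overB.
by move=> T T0 ST; apply: face_conditionB; [apply: hx|apply: hy].
Qed.

Fact star_cond_const S c : c \in OU (meet_order S) -> star_cond S (form_poly c%:MP).
Proof.
move=> cS; split.
  by apply: form_over_poly; rewrite mpolyOverC; apply: OU_sub_B cS.
by move=> T _ ST; apply: face_condition_const; apply: OU_meet cS.
Qed.

Fact star_condN S x : star_cond S x -> star_cond S (- x).
Proof.
move=> hx; have e : form_poly 0%:MP = 0 :> form by rewrite mpolyC0; exact: raddf0.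
rewrite -[- x]add0r -e; apply: star_condB hx.
by apply: star_cond_const; apply: rpred0.
Qed.

Fact star_dg_subalgebra S : dg_subalgebra (star_mem S).
Proof.
split.
- move=> c; exists (form_unit (ratfun_const K N) n c) => //.
  by apply: star_cond_const; apply: OU_poly.
- move=> _ _ [x <- hx] [y <- hy]; exists (x - y); first exact: raddfB.
  exact: star_condB.
- move=> _ _ [x <- [Bx hx]] [y <- [By hy]]; exists (x * y); first exact: (rmorphM (quot_pi _)).
  split; first exact: form_overM.
  by move=> T T0 ST; apply: face_conditionM; [apply: hx|apply: hy].
- move=> k _ [x <- [Bx hx]]; exists (form_proj k x).
    exact/esym/(quot_projE (omega_dg_ideal (ratfun_const K N) n)).
  split; first exact: form_over_proj.
  by move=> T T0 ST; apply: face_condition_proj; apply: hx.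
- move=> _ [x <- [Bx hx]]; exists (form_d x).
    exact/esym/(quot_dE (omega_dg_ideal (ratfun_const K N) n)).
  split; first exact: form_over_d.
  by move=> T T0 ST; apply: face_condition_d; apply: hx.
Qed.

Definition star S : cdga K := sub_cdga (star_dg_subalgebra S).

Definition star_emb S : cdga_hom (star S) Omega := sub_incl (star_dg_subalgebra S).

Fact star_emb_inj S : injective (star_emb S).
Proof. exact: sub_val_inj. Qed.

Fact star_mono S T w : S \subset T -> star_mem S w -> star_mem T w.
Proof.
move=> ST [x xw [Bx hx]]; exists x => //; split=> // U U0 TU.
by apply: hx => //; apply: subset_trans ST TU.
Qed.

Definition star_map S T (h : S \subset T) : cdga_hom (star S) (star T) :=
  sub_lift (star_dg_subalgebra T) (f := star_emb S) (fun w => star_mono h (sub_valP w)).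

Definition star_functor : set_functor K V.
Proof.
refine (@SetFunctor K V star star_map _ _).
- by move=> S h w; apply: val_inj.
- by move=> S T U h k l w; apply: val_inj.
Defined.

Fact star_emb_map S T (h : S \subset T) w :
  star_emb T (sf_map star_functor h w) = star_emb S w.
Proof. by []. Qed.

Fact cls_eq x y : cls x = cls y <-> face_ideal setT (x - y).
Proof. exact: quot_piP. Qed.

Fact star_exact : rows_exact star_functor.
Proof.
refine (@partition_of_unity_exact K V star_functor Omega star_emb star_emb_inj
  star_emb_map (fun sigma : V => cls (form_u R (enum_rank sigma))) _ _).
- transitivity (cls (\sum_(sigma : V) form_u R (enum_rank sigma))).
    exact/esym/(raddf_sum (quot_pi (omega_dg_ideal (ratfun_const K N) n))).
  apply/cls_eq; exists 1, 0; rewrite /face_form rmorph1 raddf0; split=> //.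
  rewrite mul1r mul0r addr0; congr (_ - _).
  rewrite (reindex (@enum_rank V)) /=; last first.
    by exists enum_val => i _; rewrite ?enum_rankK ?enum_valK.
  by apply: eq_bigl => sigma; rewrite inE.
- move=> sigma S [w]; rewrite /star_emb => hw.
  have [x xw [Bx hx]] := asboolW hw.
  have mem : star_mem S (cls (form_u R (enum_rank sigma)) * w).
    exists (form_u R (enum_rank sigma) * x).
      by rewrite -xw; exact: (rmorphM (quot_pi (omega_dg_ideal (ratfun_const K N) n))).
    split.
      by apply: form_overM => //; apply: form_over_poly; apply: mpolyOverX.
    move=> T T0 ST; have [sT|sT] := boolP (sigma \in T).
      apply: face_conditionM; last by apply: hx; rewrite // subUset sub1set sT.
      exists (form_u R (enum_rank sigma)).
      have sv : enum_rank sigma \in vertices T by apply: imset_f.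
      split; rewrite /face_form ?face_u ?sv ?subrr //; last exact: face_ideal0.
      by apply: form_over_poly; apply: mpolyOverX.
    (* On a face without [sigma] the product restricts to 0, although [x] satisfies no known
       condition there. *)
    exists 0; rewrite /face_form raddf0; split=> //.
      by move=> J; rewrite form_0E rpred0.
    rewrite rmorphM /= face_u ifF ?mul0r ?subr0; first exact: face_ideal0.
    by apply: contraNF sT => /imsetP[t tT /enum_rank_inj ->].
  by exists (sub_in (star_dg_subalgebra S) mem).
Qed.

Fact cls_const_proj k c : cdga_proj Omega k (cls (form_poly c%:MP)) =
  if k == 0 then cls (form_poly c%:MP) else 0.
Proof.
transitivity (cls (form_proj k (form_poly c%:MP))); first exact: quot_projE.
case: eqP => [->|k0]; first by congr (cls _); apply: form_proj_poly.
rewrite (_ : form_proj k _ = 0); first exact: raddf0.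
apply: formP => J; rewrite !formE ?form_0E; case: eqP => [Jk|//].
by case: eqP => // J0; case: k0; rewrite -Jk J0 cards0.
Qed.

Fact cls_const_d c : cdga_d Omega (cls (form_poly c%:MP)) = 0.
Proof.
rewrite [LHS](quot_dE (omega_dg_ideal (ratfun_const K N) n)).
by rewrite [X in quot_pi _ X]form_d_poly_const; apply: raddf0.
Qed.

Fact const_mem S c : c \in OU (meet_order S) -> star_mem S (cls (form_poly c%:MP)).
Proof. by move=> cS; exists (form_poly c%:MP) => //; apply: star_cond_const. Qed.

Definition star_const S c (h : c \in OU (meet_order S)) : star S :=
  sub_in (star_dg_subalgebra S) (const_mem h).

(** Evaluation at a vertex kills exact forms and the ideal, and is the identity on constants. *)
Fact star_const_inj S c (h : c \in OU (meet_order S)) (w : star S) : S != set0 ->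
  star_const h = cdga_d (star S) w -> c = 0.
Proof.
move=> /set0Pn[sigma sS] /(congr1 val) /= e.
have [x xw _] := sub_valP w.
move: e; rewrite -xw [X in _ = X](quot_dE (omega_dg_ideal (ratfun_const K N) n)) => /cls_eq.
move/(vertex_value_ideal (in_setT (enum_rank sigma))).
by rewrite vertex_valueB vertex_value_const vertex_value_d subr0.
Qed.

(** The constant is the value at a vertex sigma of S; the condition on the face S itself places it
    in the required localization. All faces containing S contain sigma, so the primitive satisfies
    the conditions of the star. *)
Fact star_poincare S (w : star S) : S != set0 -> cdga_d (star S) w = 0 ->
  exists c (h : c \in OU (meet_order S)) (y : star S),
    star_const h - w = cdga_d (star S) y.
Proof.
move=> S0; have /set0Pn[sigma sS] := S0; move=> /(congr1 val) /= dw.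
have [x xw [Bx hx]] := sub_valP w.
pose s : 'I_n := enum_rank sigma.
have hc : vertex_value s x \in OU (meet_order S).
  by apply: vertex_value_OU => //; apply: hx.
have hy : star_mem S (cls (- vertex_homotopy s x)).
  exists (- vertex_homotopy s x); first exact: erefl.
  apply: star_condN; split.
    by apply: form_over_vertex_homotopy Bx => k; apply: OU_div.
  move=> T T0 ST; apply: face_condition_homotopy; first exact: (subsetP ST).
  exact: hx.
exists (vertex_value s x), hc, (sub_in (star_dg_subalgebra S) hy).
apply: val_inj => /=; rewrite -xw.
rewrite [RHS](quot_dE (omega_dg_ideal (ratfun_const K N) n)).
transitivity (cls (form_poly (vertex_value s x)%:MP - x)); first exact/esym/raddfB.
(* The leftover is the homotopy applied to [form_d x], which lies in the ideal since the class of
   [x] is closed; the homotopy preserves the ideal. *)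
apply/cls_eq; rewrite (vertex_homotopyP s ratfun_pchar0) addrAC subrr sub0r -sub0r.
apply: face_idealB; first exact: face_ideal0.
apply: vertex_homotopy_ideal; first exact: in_setT.
rewrite -[form_d x]subr0; apply/cls_eq.
transitivity (cdga_d Omega (cls x)).
  exact/esym/(quot_dE (omega_dg_ideal (ratfun_const K N) n)).
rewrite xw; transitivity (0 : Omega); first exact: dw.
exact/esym/(raddf0 (quot_pi (omega_dg_ideal (ratfun_const K N) n))).
Qed.

End Stars.

(** * From the Cech nerve to its fibrant replacement *)

Section Comparison.
Variables (K : fieldType) (K0 : [pchar K] =i pred0) (N : nat) (le : rel 'S_N).
Variables (Y : set_functor K 'S_N) (F : sf_hom (star_functor K N) Y).
Hypothesis F_qi : forall S, quasi_iso (F S).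
Local Notation chain := (chain le).
Local Notation cech := (cech K le).

Definition cech_star_fun k (tau : chain k) (f : cech k) : star K (chain_set tau) :=
  star_const (sub_valP f tau).

Definition cech_star k (tau : chain k) : cdga_hom (cech k) (star K (chain_set tau)).
Proof.
apply: (@mk_hom K (cech k) (star K (chain_set tau)) (@cech_star_fun k tau)).
- move=> f g; apply: val_inj => /=; rewrite ffunE ffunE mpolyCB.
  by rewrite (raddfB (@form_poly _ _)); apply: raddfB.
- split=> [|f g]; apply: val_inj => /=; rewrite ffunE.
    by rewrite mpolyC1 (rmorph1 (@form_poly _ _)).
  by rewrite mpolyCM (rmorphM (@form_poly _ _)); apply: (rmorphM (quot_pi _)).
- by move=> c; apply: val_inj => /=; rewrite ffunE.
- move=> m f; apply: val_inj; rewrite [RHS]cls_const_proj /= /disc_proj.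
  case: ifP => // _; rewrite ffunE.
  by rewrite mpolyC0 (raddf0 (@form_poly _ _)); apply: raddf0.
- move=> f; apply: val_inj; rewrite [RHS]cls_const_d /= ffunE.
  by rewrite mpolyC0 (raddf0 (@form_poly _ _)); apply: raddf0.
Defined.

Definition cech_chain k : cdga_hom (cech k) (chain_functor le Y k) :=
  prod_pair (fun tau : chain k => hom_comp (F (chain_set tau)) (cech_star tau)).

Fact cech_chain_natural m k (t : dinj m k) f :
  cech_chain k (sc_map cech t f) = sc_map (chain_functor le Y) t (cech_chain m f).
Proof.
apply: dprod_ext => tau.
rewrite [RHS](chain_prod_mapE _ (chain_face_sub t tau) erefl).
rewrite [RHS](_ : _ = sf_map Y (chain_face_sub t tau) (F _ (cech_star (chain_face t tau) f))) //.
rewrite -sf_hom_natural; congr (F _ _); apply: val_inj => /=.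
by rewrite ffunE.
Qed.

Definition cech_chain_hom : sc_hom cech (chain_functor le Y) := ScHom cech_chain_natural.

(** The target is a product over chains, so the claim reduces to the composite O(S) -> St(S) -> Y(S)
    for each chain set S, which is nonempty; primitives are chosen chain by chain. *)
Fact cech_chain_quasi_iso k : quasi_iso (cech_chain_hom k).
Proof.
have ne (tau : chain k) : chain_set tau != set0.
  by rewrite -proper0; apply: chain_set_proper.
split=> [f _ [z fz]|y dy].
  (* The source has zero differential, so to be exact is to be 0. *)
  exists 0; rewrite cdga_d0; apply: val_inj; apply/ffunP => tau.
  have e : F _ (cech_star tau f) = cdga_d (Y (chain_set tau)) (z tau).
    exact: (congr1 (fun g : chain_prod le Y k => g tau) fz).
  have [inj _] := F_qi (chain_set tau).
  have [||w wE] := inj (cech_star tau f); [|by exists (z tau)|].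
    by rewrite -cdga_hom_d [cdga_d _ f](_ : _ = 0) ?rmorph0 //; apply: val_inj.
  by rewrite (star_const_inj (ne tau) wE) ffunE.
have H (tau : chain k) : exists c (h : c \in OU (meet_order (chain_set tau))) z,
    F _ (star_const h) - y tau = cdga_d (Y (chain_set tau)) z.
  have [_ surj] := F_qi (chain_set tau).
  have [|w [dw [z zE]]] := surj (y tau).
    exact: (congr1 (fun g : chain_prod le Y k => g tau) dy).
  have [c [h [w' w'E]]] := star_poincare K0 (ne tau) dw.
  exists c, h, (F _ w' + z); rewrite cdga_dD -cdga_hom_d -w'E -zE rmorphB.
  by rewrite addrA subrK.
pose c (tau : chain k) := sval (cid (H tau)).
have cP tau := svalP (cid (H tau)) : exists h z, F _ (star_const h) - y tau = _.
have mem : cech_mem (K := K) ([ffun tau => c tau] : chain_cdga K le k).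
  by move=> tau; rewrite ffunE; have [h _] := cP tau.
exists (sub_in (cech_dg_subalgebra K le k) mem); split; first exact: val_inj.
suff H2 tau : exists zt, F _ (cech_star tau (sub_in (cech_dg_subalgebra K le k) mem)) - y tau =
    cdga_d (Y (chain_set tau)) zt.
  exists (fun tau => sval (cid (H2 tau))); apply: dprod_ext => tau.
  exact: (svalP (cid (H2 tau))).
have [h [zt e]] := cP tau; exists zt; rewrite -e; congr (F _ _ - _).
by apply: val_inj => /=; rewrite ffunE.
Qed.

End Comparison.

(** * Assembling the zigzag *)

Section Main.
Variables (K : fieldType) (K0 : [pchar K] =i pred0) (N : nat).

Fact A_star_mem (w : A_alg K N) : star_mem set0 (\val w : Omega_SN K N).
Proof.
by have [x [xw Bx hx]] := sub_valP w; exists x => //; split=> // T T0 _; apply: hx.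
Qed.

Definition A_star : cdga_hom (A_alg K N) (star K (N := N) set0) :=
  sub_lift (star_dg_subalgebra K (N := N) set0) (f := sub_incl (A_dg_subalgebra K N)) A_star_mem.

Fact A_star_surj w : exists a, A_star a = w.
Proof.
have mem : A_mem (\val w : Omega_SN K N).
  have [x xw [Bx hx]] := sub_valP w; exists x; split=> // T T0.
  by apply: hx => //; apply: sub0set.
by exists (sub_in (A_dg_subalgebra K N) mem); apply: val_inj.
Qed.

(** Both sides are the same subalgebra of forms under differently packaged predicates, so the map is
    bijective. *)
Fact A_star_quasi_iso : quasi_iso A_star.
Proof.
have inj : injective A_star by move=> a b /(congr1 val) /= ab; apply: val_inj.
split=> [a da [w aw]|w dw].
  have [b bw] := A_star_surj w; exists b; apply: inj.
  by rewrite cdga_hom_d bw.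
have [a aw] := A_star_surj w; exists a; split.
  by apply: inj; rewrite cdga_hom_d aw dw rmorph0.
by exists 0; rewrite aw subrr cdga_d0.
Qed.

Lemma A_alg_RGamma (le : rel 'S_N) (le_antisym : antisymmetric le)
    (le_trans : transitive le) (le_total : total le) :
  exists G : cdga K, is_RGamma_RavConf le G /\ zigzag (A_alg K N) G.
Proof.
have [Y [F [F_qi Y_reedy]]] := reedy_replacement K0 (star_functor K N).
exists (matching Y set0); split.
  exists (chain_functor le Y), (cech_chain_hom le F); split.
  - by move=> k; apply: cech_chain_quasi_iso.
  - exact: chain_functor_fibrant.
  - exact: chain_functor_limit.
apply: (zigzag_fwd A_star_quasi_iso); apply: zigzag_fwd (zigzag_refl _).
apply: (limit_quasi_iso K0 F_qi).
- exact: star_exact.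
- exact: reedy_rows_exact.
- move=> x hx; apply: star_emb_inj.
  (* All stars embed in one algebra of forms, so a single vertex detects [x]; the identity
     permutation is always available. *)
  have x0 := hx 1%g (sub0set _).
  by rewrite -(star_emb_map (sub0set [set 1%g])) x0 !rmorph0.
- exact: Y_reedy.
Qed.

End Main.

Theorem theorem5 (R : realType) (N : nat) (hN : (1 <= N)%N)
    (le : rel 'S_N) (le_antisym : antisymmetric le) (le_trans : transitive le)
    (le_total : total le) :
  exists G : cdga R[i],
    is_RGamma_RavConf le G /\ zigzag (A_alg R[i] N) G.
Proof.
by apply: A_alg_RGamma => //; apply: Num.Theory.pchar_num.
Qed.
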